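(* There is an absolute constant $c>0$ such that for every $n\ge1$ and every $n$-dimensional lattice $\mathcal L\subset\mathbb R^n$, $$\tau_\infty(\mathcal L)\le c\;C^{(\mu,\circ)}_\eta(n)^2\;\tau_1(\mathcal L).$$
   Context: For a full-rank lattice $\mathcal L\subset\mathbb R^n$ with dual lattice $\mathcal L^*$, let $f_t:\mathbb R^n/\mathcal L\to\mathbb R^+$ for $t>0$ be $$f_t(x)=t^{-n/2}\sum_{y\in\mathcal L+x}e^{-\pi\|y\|_2^2/t},$$ the density at time $t$ of Brownian motion (with this time normalization) on the torus $\mathbb R^n/\mathcal L$ started from the origin. The $L_1$ and $L_\infty$ mixing times are $$\tau_1(\mathcal L)=\inf\Big\{t>0:\det(\mathcal L)^{-1}\int_{\mathbb R^n/\mathcal L}|\det(\mathcal L)f_t(x)-1|\,dx<1/4\Big\},$$ $$\tau_\infty(\mathcal L)=\inf\{t>0:\forall x,\ |\det(\mathcal L)f_t(x)-1|<1/4\}.$$ Smoothing parameter: $\eta(\mathcal L)$ is the unique $s>0$ with $\sum_{y\in\mathcal L^*}e^{-\pi s^2\|y\|_2^2}=3/2$. Covering radius: $\mu(\mathcal L)=\inf\{r\ge0:\mathcal L+rB_2^n=\mathbb R^n\}$, with $B_2^n$ the closed Euclidean unit ball. Define $$\eta^{\circ}_\mu(\mathcal L)=\sup_{R\in\mathbb R^{n\times n}\text{ non-singular}}\frac{\mu(R\mathcal L)}{\sqrt{\mathrm{tr}(R^{\mathsf T}R)}},$$ and let $C^{(\mu,\circ)}_\eta(n)>0$ be the smallest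 number such that $\eta(\mathcal L)\le C^{(\mu,\circ)}_\eta(n)\,\eta^{\circ}_\mu(\mathcal L)$ for every $n$-dimensional lattice $\mathcal L\subset\mathbb R^n$. *)

(* Defs.v *)
From HB Require Import structures.
From mathcomp Require Import all_boot all_order all_algebra.
From mathcomp Require Import all_classical all_reals all_analysis.

Set Implicit Arguments.
Unset Strict Implicit.
Unset Printing Implicit Defensive.
Import Order.TTheory GRing.Theory Num.Theory.

Local Open Scope classical_set_scope.
Local Open Scope ring_scope.

(* Lebesgue measure on R^n, carried by [n.-tuple R] (which has the product
   sigma-algebra in the library, unlike ['cV[R]_n]): the unit point mass for
   n = 0, then the image of [lebesgue_measure \x lebesgue_tuple n] under
   [(x, v) |-> x :: v]. *)
Section cons_measure.
Context d (T : measurableType d) (R : realType) (n : nat).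
Variables (m : {sigma_finite_measure set T -> \bar R})
  (mn : {sigma_finite_measure set (n.-tuple T) -> \bar R}).

Definition cons_pair (p : T * n.-tuple T) : n.+1.-tuple T :=
  [the n.+1.-tuple T of p.1 :: p.2].

Lemma measurable_cons_pair : measurable_fun setT cons_pair.
Proof. exact: measurable_cons. Qed.

Definition cons_measure : set (n.+1.-tuple T) -> \bar R :=
  pushforward (m \x mn)%E cons_pair.

Let mu : {measure set (n.+1.-tuple T) -> \bar R} :=
  measure_function_pushforward__canonical__measure_function_Measure
    (m \x mn)%E measurable_cons_pair.

HB.instance Definition _ := isMeasure.Build _ _ _ cons_measure
  (measure0 mu) (measure_ge0 mu) (@measure_semi_sigma_additive _ _ _ mu).

Let split_tuple (v : n.+1.-tuple T) : T * n.-tuple T :=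
  (thead v, [tuple of behead v]).

Let measurable_split_tuple : measurable_fun setT split_tuple.
Proof.
apply/measurable_fun_pairP; split => /=; first exact: measurable_tnth.
exact: measurable_behead.
Qed.

Let cons_measure_sigma_finite : sigma_finite setT cons_measure.
Proof.
have /sigma_finiteP[F [FT ndF Foo]] := sigma_finiteT m.
have /sigma_finiteP[G [GT ndG Goo]] := sigma_finiteT mn.
exists (fun k => split_tuple @^-1` (F k `*` G k)).
  apply/seteqP; split=> // v _.
  have [i _ Fi] : (\bigcup_i F i) (thead v) by rewrite -FT.
  have [j _ Gj] : (\bigcup_i G i) [tuple of behead v] by rewrite -GT.
  exists (maxn i j) => //; split => /=.
    by move: Fi; exact/subsetPset/ndF/leq_maxl.
  by move: Gj; exact/subsetPset/ndG/leq_maxr.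
move=> k; have [mF Fk] := Foo k; have [mG Gk] := Goo k; split.
  rewrite -[_ @^-1` _]setTI; apply: measurable_split_tuple => //.
  exact: measurableX.
rewrite /cons_measure /pushforward -comp_preimage.
rewrite (_ : split_tuple \o cons_pair = id) ?preimage_id; last first.
  by apply/funext => -[x v]; congr (_, _); exact/val_inj.
by rewrite product_measure1E// lte_mul_pinfty// ge0_fin_numE.
Qed.

HB.instance Definition _ :=
  Measure_isSigmaFinite.Build _ _ _ cons_measure cons_measure_sigma_finite.

End cons_measure.

Fixpoint lebesgue_tuple (R : realType) (n : nat) :
    {sigma_finite_measure set (n.-tuple (measurableTypeR R)) -> \bar R} :=
  match n with
  | 0 => \d_([tuple] : 0.-tuple (measurableTypeR R))
  | k.+1 => cons_measure (@lebesgue_measure R) (lebesgue_tuple R k)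
  end.

Section lattices.
Variables (R : realType) (n : nat).
Implicit Types (B : 'M[R]_n) (L : set 'cV[R]_n) (x y : 'cV[R]_n) (s t : R).

Definition dotp x y : R := \sum_i x i 0 * y i 0.

(* The library norm [`|x|] on matrices is the sup norm. *)
Definition norm2 x : R := Num.sqrt (dotp x x).

(* Full-rank lattices are the sets [lattice B] with [B] invertible; the
   columns of [B] form a basis. *)
Definition lattice B : set 'cV[R]_n :=
  [set B *m map_mx intr z | z in [set: 'cV[int]_n]].

Definition lattice_det B : R := `|\det B|.

Definition dual_lattice L : set 'cV[R]_n :=
  [set y | forall x, L x -> dotp x y \is a Num.int].

(* As a function on R^n, f_t is L-periodic, and functions on the torus R^n/L
   are handled as L-periodic functions on R^n. *)
Definition torus_heat L t x : R :=
  t `^ (- (n%:R / 2)) *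
  fine (\esum_(y in [set u + x | u in L]) (expR (- (pi * norm2 y ^+ 2 / t)))%:E).

Definition tuple_col (v : n.-tuple (measurableTypeR R)) : 'cV[R]_n :=
  \col_i (tnth v i : R).

Definition fundamental_domain B : set 'cV[R]_n :=
  [set B *m s | s in [set s : 'cV[R]_n | forall i, 0 <= s i 0 < 1]].

Definition torus_integral B (g : 'cV[R]_n -> R) : \bar R :=
  \int[lebesgue_tuple R n]_(v in tuple_col @^-1` fundamental_domain B)
    (g (tuple_col v))%:E.

(* Infima and suprema are taken in [\bar R], so that they are meaningful
   without any nonemptiness or boundedness side condition. *)
Definition mixing_time_L1 B : \bar R :=
  ereal_inf [set t%:E | t in [set t | 0 < t /\
    ((lattice_det B)^-1%:E *
     torus_integral B
       (fun x => `|lattice_det B * torus_heat (lattice B) t x - 1%R|%R)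
     < (1 / 4)%:E)%E]].

Definition mixing_time_Linfty B : \bar R :=
  ereal_inf [set t%:E | t in [set t | 0 < t /\
    forall x, `|lattice_det B * torus_heat (lattice B) t x - 1| < 1 / 4]].

(* [xget] performs the definite description "the unique s"; the default value
   0 is irrelevant, as s exists and is unique for full-rank L and n >= 1. *)
Definition smoothing_parameter L : R :=
  xget 0 [set s | 0 < s /\
    \esum_(y in dual_lattice L) (expR (- (pi * s ^+ 2 * norm2 y ^+ 2)))%:E
    = (3 / 2)%:E].

Definition covering_radius L : \bar R :=
  ereal_inf [set r%:E | r in [set r | 0 <= r /\
    [set u + r *: v | u in L & v in [set v | norm2 v <= 1]] = setT]].

Definition eta_mu L : \bar R :=
  ereal_sup [set (covering_radius [set M *m u | u in L] *
                  (Num.sqrt (\tr (M^T *m M)))^-1%:E)%E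
            | M in [set M : 'M[R]_n | M \in unitmx]].

End lattices.

Definition C_eta_mu (R : realType) (n : nat) : \bar R :=
  ereal_inf [set C%:E | C in [set C : R | 0 < C /\
    forall B : 'M[R]_n, B \in unitmx ->
      ((smoothing_parameter (lattice B))%:E <= C%:E * eta_mu (lattice B))%E]].

(* Main.v *)
(* Poisson summation turns [det L * f_t(x) - 1] into a sum over the nonzero dual
   vectors, bounded by [sum exp(-pi t |y|^2)]; at [t = 3 eta^2] every term is the cube
   of a number at most 1/2, so the sum is at most 1/8 and tau_oo <= 3 eta^2, hence
   tau_oo <= 3 C^2 eta_mu^2.
   Conversely, for nonsingular M put mu = mu(M L).  For x uniform on the torus, Mx is
   at distance at least about mu/2 from M L with probability at least 1/2 (if h is a
   deep hole, x and h - x cannot both be close), while under f_t the expected squared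
   distance is at most 2 t tr(M^T M).  By Markov's inequality the L_1 distance can be
   below 1/4 only if mu^2 <= 44 t tr(M^T M), so that eta_mu^2 <= 44 tau_1.

   One-dimensional Poisson summation, with phases, is obtained following Polya, as the
   limit of a finite identity: averaging (2 cos)^(2M) over N-th roots of unity selects
   every N-th binomial coefficient, and M ~ c N^2.  The case of a positive definite form
   follows by induction on the dimension, completing the square. *)
From HB Require Import structures.
Require Import Defs.
From mathcomp Require Import all_boot all_order all_algebra.
From mathcomp Require Import all_classical all_reals all_analysis.
From mathcomp Require Import finmap measurable_realfun ring lra zify.

Set Implicit Arguments.
Unset Strict Implicit.
Unset Printing Implicit Defensive.
Import Order.TTheory GRing.Theory Num.Theory.
Import numFieldNormedType.Exports.
Local Open Scope classical_set_scope.
Local Open Scope ring_scope.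

(** * Unconditional sums *)

(** The deviation 1/8 serves twice. It lies strictly below 1/4, where time [2 * eta ^+ 2] would give
    only the bound 1/4 by the same argument. And since the heat kernel has mass 1 on the fundamental
    domain, it places the volume of that domain between 8/9 and 8/7 of the determinant. In the
    converse direction the far points have at least half of that volume; after the loss of 1/4
    allowed by L_1 mixing, 7/36 of the determinant is left for Markov's inequality. This gives 72/7
    <= 11; halving the radius turns 11 into 44, and 132 = 3 * 44.

    Eliminating one coordinate of a quadratic form turns the remaining ones into a shift on one side
    of Poisson's formula and a frequency on the other. The one-dimensional formula therefore carries
    a shift, a frequency and a phase from the start, and its sums are signed.

    All infima are taken in [\bar R], and [C_eta_mu] is not known beforehand to be finite. A
    positive lower bound on the L_1 mixing time keeps the product on the right from being 0 times
    infinity. *)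

Section signed_sums.
Variable R : realType.

(* Unconditional sums of real families, as differences of two finite sums of
   nonnegative families; the library's [esum] is only meaningful for the latter. *)
Definition has_sum (T : choiceType) (f : T -> R) (s : R) : Prop :=
  exists p q : T -> R, exists P Q : R,
    [/\ forall x, 0 <= p x /\ 0 <= q x,
        forall x, f x = p x - q x,
        (\esum_(x in setT) (p x)%:E = P%:E)%E,
        (\esum_(x in setT) (q x)%:E = Q%:E)%E & s = P - Q].

(** Two decompositions of the same family satisfy p + q' = p' + q, an identity between nonnegative
    families whose sums can be added. *)
Lemma has_sum_unique (T : choiceType) (f : T -> R) s t :
  has_sum f s -> has_sum f t -> s = t.
Proof.
move=> [p [q [P [Q [pq0 fpq sP sQ ->]]]]] [p' [q' [P' [Q' [pq0' fpq' sP' sQ' ->]]]]].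
have : (\esum_(x in setT) ((p x)%:E + (q' x)%:E) = \esum_(x in setT) ((p' x)%:E + (q x)%:E))%E.
  apply: eq_esum => x _; rewrite -!EFinD; congr (_%:E).
  by have := fpq x; rewrite fpq'; lra.
rewrite !esumD; do ?by move=> x _; rewrite lee_fin; have := pq0 x; have := pq0' x => -[? ?] [].
by rewrite sP sQ sP' sQ' -!EFinD => -[]; lra.
Qed.

Lemma eq_has_sum (T : choiceType) (f g : T -> R) s :
  f =1 g -> has_sum f s -> has_sum g s.
Proof. by move=> /funext ->. Qed.

Lemma has_sum_ge0P (T : choiceType) (f : T -> R) s : (forall x, 0 <= f x) ->
  has_sum f s <-> (\esum_(x in setT) (f x)%:E = s%:E)%E.
Proof.
move=> f0; have sE S : (\esum_(x in setT) (f x)%:E = S%:E)%E -> has_sum f S.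
  move=> fS; exists f, (fun=> 0), S, 0; split => //; try by move=> x; rewrite ?subr0.
  by rewrite esum1.
  by rewrite subr0.
split=> [fs|]; last exact: sE.
have : (\esum_(x in setT) (f x)%:E \is a fin_num)%E.
  move: fs => [p [q [P [Q [pq0 fpq sP sQ _]]]]].
  rewrite ge0_fin_numE; last by apply: esum_ge0 => x _; rewrite lee_fin.
  apply: (@le_lt_trans _ _ P%:E); last exact: ltry.
  rewrite -sP; apply: le_esum => x _; rewrite lee_fin fpq.
  by have [] := pq0 x; lra.
move=> /fineK h; rewrite -h; congr (_%:E); apply: has_sum_unique fs.
by apply: sE; rewrite h.
Qed.

Lemma has_sumD (T : choiceType) (f g : T -> R) s t :
  has_sum f s -> has_sum g t -> has_sum (fun x => f x + g x) (s + t).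
Proof.
move=> [p [q [P [Q [pq0 fpq sP sQ ->]]]]] [p' [q' [P' [Q' [pq0' fpq' sP' sQ' ->]]]]].
exists (fun x => p x + p' x), (fun x => q x + q' x), (P + P'), (Q + Q'); split.
- by move=> x; have [? ?] := pq0 x; have [? ?] := pq0' x; rewrite !addr_ge0.
- by move=> x; rewrite fpq fpq'; ring.
- under eq_esum do rewrite EFinD.
  rewrite esumD ?sP ?sP'// => x _; rewrite lee_fin; [by case: (pq0 x)|by case: (pq0' x)].
- under eq_esum do rewrite EFinD.
  rewrite esumD ?sQ ?sQ'// => x _; rewrite lee_fin; [by case: (pq0 x)|by case: (pq0' x)].
- by ring.
Qed.

Lemma has_sumN (T : choiceType) (f : T -> R) s :
  has_sum f s -> has_sum (fun x => - f x) (- s).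
Proof.
move=> [p [q [P [Q [pq0 fpq sP sQ ->]]]]]; exists q, p, Q, P; split => //.
- by move=> x; have [] := pq0 x.
- by move=> x; rewrite fpq opprB.
- by rewrite opprB.
Qed.

Lemma has_sumB (T : choiceType) (f g : T -> R) s t :
  has_sum f s -> has_sum g t -> has_sum (fun x => f x - g x) (s - t).
Proof. by move=> fs /has_sumN; exact: has_sumD. Qed.

Lemma esumZl (T : choiceType) (p : T -> R) (P c : R) : (forall x, 0 <= p x) -> 0 <= c ->
  (\esum_(x in setT) (p x)%:E = P%:E)%E -> (\esum_(x in setT) (c * p x)%:E = (c * P)%:E)%E.
Proof.
move=> p0; rewrite le_eqVlt => /predU1P[<- _|c0 sP].
  by rewrite mul0r esum1// => x _; rewrite mul0r.
(* One inequality suffices: applied to [c^-1] and the scaled family, it gives the reverse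
   inequality. *)
have le1 (k : R) (h : T -> R) (H : R) : 0 < k -> (\esum_(x in setT) (h x)%:E <= H%:E)%E ->
    (\esum_(x in setT) (k * h x)%:E <= (k * H)%:E)%E.
  move=> k0 sH; apply: ge_ereal_sup => _ [A Afin <-].
  have -> : (\sum_(x \in A) (k * h x)%:E)%E = (k%:E * \sum_(x \in A) (h x)%:E)%E.
    have Af : finite_set A by case: Afin.
    by rewrite [LHS]fsbig_finite// [in RHS]fsbig_finite//= !sumEFin -EFinM mulr_sumr.
  rewrite EFinM lee_pmul2l//; apply: le_trans sH.
  by apply: ereal_sup_ubound; exists A.
apply/eqP; rewrite eq_le le1 ?sP//=.
have [sf|sf] := boolP (\esum_(x in setT) (c * p x)%:E \is a fin_num)%E.
  have := @le1 c^-1 (fun x => c * p x) (fine (\esum_(x in setT) (c * p x)%:E)%E).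
  rewrite invr_gt0 c0 fineK// => /(_ isT (lexx _)).
  rewrite (eq_esum (b := EFin \o p)); last first.
    by move=> x _ /=; rewrite mulrA mulVf ?gt_eqF// mul1r.
  by rewrite sP lee_fin -{2}(fineK sf) lee_fin ler_pdivlMl.
rewrite (_ : (\esum_(x in setT) (c * p x)%:E)%E = +oo%E) ?leey//.
move: sf; rewrite ge0_fin_numE ?ltey ?negbK; first by move/eqP.
by apply: esum_ge0 => x _; rewrite lee_fin mulr_ge0// ltW.
Qed.

Lemma has_sumZ (T : choiceType) (f : T -> R) (s c : R) :
  has_sum f s -> has_sum (fun x => c * f x) (c * s).
Proof.
wlog c0 : c / 0 <= c => [hw fs|].
  have [|c0] := leP 0 c; first by move/hw; exact.
  rewrite -[c]opprK mulNr; apply: eq_has_sum (has_sumN (hw (- c) _ fs)) => [x|].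
    by rewrite !mulNr.
  by rewrite oppr_ge0 ltW.
move=> [p [q [P [Q [pq0 fpq sP sQ ->]]]]].
exists (fun x => c * p x), (fun x => c * q x), (c * P), (c * Q); split.
- by move=> x; have [? ?] := pq0 x; rewrite !mulr_ge0.
- by move=> x; rewrite fpq; ring.
- by apply: esumZl => // x; have [] := pq0 x.
- by apply: esumZl => // x; have [] := pq0 x.
- by ring.
Qed.

Lemma has_sum_ge0 (T : choiceType) (f : T -> R) s :
  (forall x, 0 <= f x) -> has_sum f s -> 0 <= s.
Proof.
move=> f0 /has_sum_ge0P-/(_ f0) fs; rewrite -lee_fin -fs.
by apply: esum_ge0 => x _; rewrite lee_fin.
Qed.

Lemma le_has_sum (T : choiceType) (f g : T -> R) s t :
  (forall x, f x <= g x) -> has_sum f s -> has_sum g t -> s <= t.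
Proof.
move=> fg fs gt; rewrite -subr_ge0; apply: has_sum_ge0 (has_sumB gt fs) => x.
by rewrite subr_ge0.
Qed.

Lemma le_norm_has_sum (T : choiceType) (f g : T -> R) s t :
  (forall x, `|f x| <= g x) -> has_sum f s -> has_sum g t -> `|s| <= t.
Proof.
move=> fg fs gt; rewrite ler_norml; apply/andP; split.
  by apply: le_has_sum (has_sumN gt) fs => x; have := fg x; rewrite ler_norml => /andP[].
by apply: le_has_sum fs gt => x; have := fg x; rewrite ler_norml => /andP[].
Qed.

Lemma ge0_has_sum_dominated (T : choiceType) (f g : T -> R) G :
  (forall x, 0 <= f x <= g x) -> has_sum g G -> exists s, has_sum f s.
Proof.
move=> fg gG; have f0 x : 0 <= f x by have /andP[] := fg x.
have g0 x : 0 <= g x by have /andP[] := fg x; exact: le_trans.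
exists (fine (\esum_(x in setT) (f x)%:E)%E); apply/has_sum_ge0P => //.
rewrite fineK// ge0_fin_numE; last by apply: esum_ge0 => x _; rewrite lee_fin.
move/(has_sum_ge0P _ g0) : gG => gG.
apply: (@le_lt_trans _ _ G%:E); last exact: ltry.
by rewrite -gG; apply: le_esum => x _; rewrite lee_fin; have /andP[] := fg x.
Qed.

(** Adding the majorant reduces to the nonnegative case: 0 <= f + g <= 2 g. *)
Lemma has_sum_dominated (T : choiceType) (f g : T -> R) G :
  (forall x, `|f x| <= g x) -> has_sum g G -> exists s, has_sum f s.
Proof.
move=> fg gG.
have [t ft] : exists t, has_sum (fun x => f x + g x) t.
  apply: (@ge0_has_sum_dominated _ _ (fun x => g x + g x)); last exact: (has_sumD gG gG).
  by move=> x; have := fg x; rewrite ler_norml; lra.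
exists (t - G); apply: eq_has_sum (has_sumB ft gG) => x; ring.
Qed.

Lemma has_sum_reindex (T U : choiceType) (h : T -> U) (k : U -> T) (f : U -> R) s :
  cancel h k -> cancel k h -> has_sum f s -> has_sum (f \o h) s.
Proof.
move=> hk kh [p [q [P [Q [pq0 fpq sP sQ sE]]]]].
have hb : set_bij [set: T] [set: U] h.
  split => //; first by move=> x y _ _ /(can_inj hk).
  by move=> y _; exists (k y).
exists (p \o h), (q \o h), P, Q; split => //=.
- by rewrite -sP; apply/esym/reindex_esum.
- by rewrite -sQ; apply/esym/reindex_esum.
Qed.

(** Tonelli applies separately to the two nonnegative parts. Their slices are finite because the
    total is, and uniqueness of sums identifies their difference with [g]. *)
Lemma has_sum_fubini (T U : choiceType) (f : T -> U -> R) (g : T -> R) s :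
  has_sum (fun tu => f tu.1 tu.2) s -> (forall t, has_sum (f t) (g t)) -> has_sum g s.
Proof.
move=> [p [q [P [Q [pq0 fpq sP sQ sE]]]]] fg.
have slice (r : T * U -> R) S : (forall x, 0 <= r x) ->
    (\esum_(x in setT) (r x)%:E = S%:E)%E ->
    exists rT : T -> R, [/\ forall t, 0 <= rT t,
      forall t, (\esum_(u in setT) (r (t, u))%:E = (rT t)%:E)%E &
      (\esum_(t in setT) (rT t)%:E = S%:E)%E].
  move=> r0 sS; have r0' t : (0 <= \esum_(u in setT) (r (t, u))%:E)%E.
    by apply: esum_ge0 => u _; rewrite lee_fin.
  have S2 : (\esum_(t in setT) \esum_(u in setT) (r (t, u))%:E = S%:E)%E.
    rewrite -sS (@esum_esum _ _ _ _ (fun=> setT) (fun t u => (r (t, u))%:E)).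
      rewrite (_ : _ `*`` _ = setT); last by apply/seteqP; split.
      by apply: eq_esum => -[].
    by move=> *; rewrite lee_fin.
  have fin t : (\esum_(u in setT) (r (t, u))%:E \is a fin_num)%E.
    rewrite ge0_fin_numE//; apply: (@le_lt_trans _ _ S%:E); last exact: ltry.
    rewrite -S2 (esumID [set t])// setTI esum_set1// leeDl//.
    exact: esum_ge0.
  exists (fun t => fine (\esum_(u in setT) (r (t, u))%:E)%E); split => [t|t|].
  - by rewrite fine_ge0.
  - by rewrite fineK.
  - by rewrite -S2; apply: eq_esum => t _; rewrite fineK.
have [pT [pT0 pTE pTS]] := slice p P (fun x => (pq0 x).1) sP.
have [qT [qT0 qTE qTS]] := slice q Q (fun x => (pq0 x).2) sQ.
exists pT, qT, P, Q; split => // t; apply: has_sum_unique (fg t) _.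
exists (fun u => p (t, u)), (fun u => q (t, u)), (pT t), (qT t); split => // u.
by rewrite -fpq.
Qed.

Lemma has_sum_prod_ge0 (T U : choiceType) (f : T -> U -> R) (g : T -> R) s :
  (forall t u, 0 <= f t u) ->
  (forall t, has_sum (f t) (g t)) -> has_sum g s -> has_sum (fun tu => f tu.1 tu.2) s.
Proof.
move=> f0 fg gs; apply/has_sum_ge0P => //.
rewrite (_ : setT = setT `*`` (fun=> setT)); last by apply/seteqP; split.
rewrite -(@esum_esum _ _ _ _ _ (fun t u => (f t u)%:E)); last by move=> *; rewrite lee_fin.
have g0 t : 0 <= g t by exact: has_sum_ge0 (fg t).
rewrite -((has_sum_ge0P _ g0).1 gs); apply: eq_esum => t _.
exact: (has_sum_ge0P _ (f0 t)).1.
Qed.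

Lemma has_sum_fset (T : choiceType) (A : {fset T}) (f : T -> R) :
  (forall x, x \notin A -> f x = 0) -> has_sum f (\sum_(x <- A) f x).
Proof.
move=> fA.
have ge0 (h : T -> R) : (forall x, 0 <= h x) -> (forall x, x \notin A -> h x = 0) ->
    (\esum_(x in setT) (h x)%:E = (\sum_(x <- A) h x)%:E)%E.
  move=> h0 hA.
  transitivity (\esum_(x in [set` A]) (h x)%:E)%E.
    rewrite [RHS]esum_mkcond; apply: eq_esum => x _; case: ifPn => //.
    by rewrite notin_setE/= => /negP/hA ->.
  rewrite esum_fset; [|exact: finite_fset|by move=> i _; rewrite lee_fin].
  by rewrite fsbig_finite ?set_fsetK ?sumEFin//; exact: finite_fset.
exists (fun x => Num.max (f x) 0), (fun x => Num.max (- f x) 0).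
exists (\sum_(x <- A) Num.max (f x) 0), (\sum_(x <- A) Num.max (- f x) 0).
have posneg x : f x = Num.max (f x) 0 - Num.max (- f x) 0.
  by have [h1|h1] := leP (f x) 0; have [h2|h2] := leP (- f x) 0; lra.
split => //.
- by move=> x; rewrite !le_max lexx !orbT.
- by apply: ge0 => x; rewrite ?le_max ?lexx ?orbT// => /fA ->; rewrite maxxx.
- by apply: ge0 => x; rewrite ?le_max ?lexx ?orbT// => /fA ->; rewrite oppr0 maxxx.
- by rewrite -sumrB; apply: eq_bigr.
Qed.

Lemma has_sum1 (T : choiceType) (a : T) (f : T -> R) :
  (forall x, x != a -> f x = 0) -> has_sum f (f a).
Proof.
move=> fa; have := @has_sum_fset _ [fset a]%fset f; rewrite big_seq_fset1; apply.
by move=> x; rewrite inE => /fa.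
Qed.

Lemma has_sum_delta (T : choiceType) (a : T) (c : R) :
  has_sum (fun x => if x == a then c else 0) c.
Proof.
have := @has_sum1 T a (fun x => if x == a then c else 0).
by rewrite eqxx; apply => x /negbTE ->.
Qed.

Lemma has_sum_tail (T : choiceType) (g : T -> R) G e :
  (forall x, 0 <= g x) -> has_sum g G -> 0 < e ->
  exists A : {fset T}, G - e < \sum_(x <- A) g x.
Proof.
move=> g0 /(has_sum_ge0P _ g0) gG e0.
have : ((G - e)%:E < \esum_(x in setT) (g x)%:E)%E by rewrite gG lte_fin; lra.
move=> /ereal_sup_gt[_ [X [finX _]] <-]; rewrite fsbig_finite//= sumEFin lte_fin.
by exists (fset_set X).
Qed.

(** Dominated convergence for series. Off a finite set carrying all but e/4 of the majorant the
    difference is at most 2 g; on that set only finitely many limits are involved. This is the tool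
    for every passage to the limit below. *)
Lemma has_sum_tannery (J : Type) (F : set_system J) (FF : ProperFilter F)
    (T : choiceType) (f : J -> T -> R) (h g : T -> R) (G : R) (s : J -> R) :
  has_sum g G ->
  (\forall j \near F, forall x, `|f j x| <= g x) ->
  (forall x, f ^~ x @ F --> h x) ->
  (\forall j \near F, has_sum (f j) (s j)) ->
  exists2 S, has_sum h S & s @ F --> S.
Proof.
move=> gG fg fh fs.
have hg x : `|h x| <= g x.
  apply: (@cvgr_to_le _ F FF _ (fun j => `|f j x|)).
    by apply: cvg_norm; exact: fh.
  by apply: filterS fg => j /(_ x).
have [S hS] := has_sum_dominated hg gG.
exists S => //; apply/cvgrPdist_le => e e0.
have e4 : 0 < e / 4 by lra.
have g0 x : 0 <= g x by apply: le_trans (hg x).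
have [A gA] := has_sum_tail g0 gG e4.
have fA : (fun j => \sum_(x <- A) `|f j x - h x|) @ F --> 0.
  rewrite [X in _ --> X](_ : _ = \sum_(x <- A) 0); last by rewrite big1.
  apply: cvg_big => [|x _]; first exact: add_continuous.
  rewrite -(@normr0 _ R) -(subrr (h x)).
  by apply: cvg_norm; apply: cvgB; [exact: fh|exact: cvg_cst].
have e2 : 0 < e / 2 by lra.
move/cvgrPdist_le : fA => /(_ _ e2) fA.
near=> j.
have fgj : forall x, `|f j x| <= g x by near: j.
have fsj : has_sum (f j) (s j) by near: j.
have fAj : `|0 - \sum_(x <- A) `|f j x - h x| | <= e / 2 by near: j.
rewrite sub0r normrN ger0_norm ?sumr_ge0// in fAj.
(* The comparison family is [|f j x - h x|] on [A] and 2 g elsewhere, written as 2 g plus a finitely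
   supported correction so that its sum is explicit. *)
have k1 := @has_sum_fset _ A (fun x => if x \in A then `|f j x - h x| - 2 * g x else 0).
have {}k1 := has_sumD (k1 (fun x xA => ifN _ _ xA)) (has_sumZ 2 gG).
have := le_norm_has_sum _ (has_sumB fsj hS) k1.
rewrite distrC => /(_ _)/le_trans; apply.
  move=> x /=; case: ifPn => xA; first by lra.
  rewrite add0r; apply: le_trans (ler_normB _ _) _.
  by have := fgj x; have := hg x; lra.
rewrite big_seq_cond (eq_bigr (fun x => `|f j x - h x| - 2 * g x)); last first.
  by move=> x /andP[->].
rewrite -big_seq_cond sumrB -mulr_sumr; lra.
Unshelve. all: by end_near. Qed.

End signed_sums.

(** * Poisson summation in dimension one *)

Section cosine_sums.
Variable R : realType.
Implicit Types x y psi : R.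

(** Pascal's rule summed against an arbitrary function; it is the induction step of [expr_cos]. *)
Lemma sum_binS n (g : nat -> R) :
  \sum_(i < n.+2) 'C(n.+1, i)%:R * g i = \sum_(i < n.+1) 'C(n, i)%:R * (g i + g i.+1).
Proof.
rewrite big_ord_recl/= bin0.
under eq_bigr do rewrite /bump/= add1n binS natrD mulrDl.
rewrite big_split/= big_ord_recr/= bin_small// mul0r addr0 addrA.
under [RHS]eq_bigr do rewrite mulrDr.
rewrite [RHS]big_split/=; congr (_ + _).
by rewrite [RHS]big_ord_recl/= bin0.
Qed.

(** Real part of the binomial expansion of (e^(ix) + e^(-ix))^n times e^(i psi). The induction uses
    2 cos x cos t = cos (t + x) + cos (t - x). *)
Lemma expr_cos n x psi : (2 * cos x) ^+ n * cos psi =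
  \sum_(i < n.+1) 'C(n, i)%:R * cos ((n%:R - 2 * i%:R) * x + psi).
Proof.
elim: n => [|n IH]; first by rewrite big_ord1 bin0 !mul1r mulr0 subrr mul0r add0r.
rewrite exprS -mulrA IH.
rewrite (@sum_binS n (fun i => cos ((n.+1%:R - 2 * i%:R) * x + psi))) mulr_sumr.
apply: eq_bigr => i _; rewrite mulrCA; congr (_ * _).
set t := (n%:R - 2 * i%:R) * x + psi.
have -> : (n.+1%:R - 2 * i%:R) * x + psi = t + x by rewrite /t -[n.+1%:R]natr1; ring.
have -> : (n.+1%:R - 2 * i.+1%:R) * x + psi = t - x.
  by rewrite /t -[n.+1%:R]natr1 -[i.+1%:R]natr1; ring.
by rewrite (cosD t x) (cosB t x); ring.
Qed.

Lemma cosD_int x (z : int) : cos (x + 2 * pi * z%:~R) = cos x.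
Proof.
have nat_case y (n : nat) : cos (y + 2 * pi * n%:R) = cos y.
  by rewrite -(periodicn (@cosD2pi R) n y); congr cos; rewrite -mulrnA mulr_natr mulr_natl -mulrnA.
case: z => n; first exact: nat_case.
rewrite NegzE mulrNz mulrN -[in RHS](subrK (2 * pi * n.+1%:R) x).
by rewrite nat_case.
Qed.

(** If [N] divides [l] all the terms agree. Otherwise multiplication by 2 sin t, with t half the
    common step of the arguments, makes the sum telescope over a full number of periods. *)
Lemma sum_cos_roots (N : nat) (l : int) psi : (0 < N)%N ->
  \sum_(j < N) cos (2 * pi * (l%:~R * j%:R / N%:R) + psi) =
  if (N %| l)%Z then N%:R * cos psi else 0.
Proof.
move=> N0; have Nn0 : N%:R != 0 :> R by rewrite pnatr_eq0 -lt0n.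
case: ifPn => [/dvdzP[q lq]|Nl].
  rewrite (eq_bigr (fun=> cos psi)); last first.
    move=> j _; rewrite -(cosD_int psi (q * j%:Z)) lq; congr cos.
    by rewrite !intrM; field.
  by rewrite sumr_const card_ord mulr_natl.
pose t : R := pi * l%:~R / N%:R.
(* The square of sin t depends only on cos (2 t), so [l] may be replaced by its remainder modulo
   [N]. For a remainder strictly between 0 and [N] the angle lies in ]0, pi[. *)
have sin0 : sin t != 0.
  rewrite -sqrf_eq0 (_ : sin t ^+ 2 = (1 - cos (t *+ 2)) / 2); last first.
    by rewrite cos_mulr2n cos2sin2; field.
  have [r [q [lqr /andP[r0 rN]]]] : exists r : nat, exists q : int, l = q * N%:Z + r%:Z /\ (0 < r < N)%N.
    have NZ : N%:Z != 0 by rewrite eqz_nat -lt0n.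
    move: Nl; rewrite (sameP dvdz_mod0P eqP).
    have := divz_eq l N%:Z; have := modz_ge0 l NZ; have := ltz_mod l NZ.
    case: (l %% N)%Z => // r rN _ lE r0; exists r, (l %/ N)%Z; split => //.
    by move: r0 rN; lia.
  pose w : R := pi * r%:R / N%:R.
  have -> : cos (t *+ 2) = cos (w *+ 2).
    rewrite -(cosD_int (w *+ 2) q); congr cos.
    by rewrite /t /w lqr intrD intrM !mulr2n; field.
  have -> : (1 - cos (w *+ 2)) / 2 = sin w ^+ 2 by rewrite cos_mulr2n cos2sin2; field.
  rewrite sqrf_eq0 gt_eqF// sin_gt0_pi// /w.
  rewrite divr_gt0 ?mulr_gt0 ?pi_gt0 ?ltr0n//=.
  by rewrite ltr_pdivrMr ?ltr0n// ltr_pM2l ?pi_gt0// ltr_nat.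
apply: (mulfI (_ : 2 * sin t != 0)); first by rewrite mulf_neq0.
rewrite mulr0 mulr_sumr.
pose G (j : nat) := sin (2 * t * j%:R - t + psi).
rewrite (eq_bigr (fun j : 'I_N => G j.+1 - G j)); last first.
  move=> j _; rewrite /G -[j.+1%:R]natr1.
  set w := 2 * t * j%:R + psi.
  rewrite (_ : _ + psi = w); last by rewrite /w /t; field.
  rewrite (_ : 2 * t * _ - t + psi = w + t); last by rewrite /w; ring.
  rewrite (_ : 2 * t * _ - t + psi = w - t); last by rewrite /w; ring.
  by rewrite (sinD w t) (sinB w t); ring.
rewrite -(big_mkord xpredT (fun j => G j.+1 - G j)) telescope_sumr//.
rewrite /G; apply/eqP; rewrite subr_eq0 -!cosBpihalf mulr0 add0r.
rewrite -[eqbRHS](cosD_int _ l); apply/eqP; congr cos.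
by rewrite /t; field.
Qed.

(* Only the [i] with [M - i + r] divisible by [N] survive the summation over the
   [N]-th roots of unity. *)
Lemma sum_cos_expr (N M : nat) (r j0 : int) (xi phi : R) : (0 < N)%N ->
  \sum_(j < N) cos (pi * ((j0 + j%:Z)%:~R + xi) / N%:R) ^+ (2 * M) *
     cos (2 * pi * (r%:~R * (j0 + j%:Z)%:~R / N%:R + phi)) =
  N%:R / 4 ^+ M * \sum_(i < (2 * M).+1 | (N %| M%:Z - i%:Z + r)%Z)
     'C(2 * M, i)%:R * cos (2 * pi * ((M%:Z - i%:Z)%:~R * xi / N%:R + phi)).
Proof.
move=> N0; have Nn0 : N%:R != 0 :> R by rewrite pnatr_eq0 -lt0n.
apply: (mulfI (_ : 4 ^+ M != 0)); first by rewrite expf_neq0.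
rewrite mulrA [4 ^+ M * (_ / _)]mulrC divfK ?expf_neq0// mulr_sumr.
pose t (j : 'I_N) : R := pi * ((j0 + j%:Z)%:~R + xi) / N%:R.
pose psij (j : 'I_N) : R := 2 * pi * (r%:~R * (j0 + j%:Z)%:~R / N%:R + phi).
rewrite (eq_bigr (fun j => \sum_(i < (2 * M).+1)
    'C(2 * M, i)%:R * cos (((2 * M)%:R - 2 * i%:R) * t j + psij j))); last first.
  move=> j _; rewrite -expr_cos exprMn (exprM 2) (_ : 2 ^+ 2 = 4 :> R); last by ring.
  by rewrite mulrA.
rewrite exchange_big/= mulr_sumr [RHS]big_mkcond/=.
apply: eq_bigr => i _; rewrite -mulr_sumr.
pose l : int := M%:Z - i%:Z + r.
pose psi : R := 2 * pi * (l%:~R * j0%:~R / N%:R) + 2 * pi * ((M%:Z - i%:Z)%:~R * xi / N%:R + phi).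
rewrite (eq_bigr (fun j : 'I_N => cos (2 * pi * (l%:~R * j%:R / N%:R) + psi))); last first.
  move=> j _; congr cos; rewrite /t /psij /psi /l !(intrD, intrM, mulrNz, rmorphB)/= natrM.
  by field.
rewrite sum_cos_roots// -/l; case: ifPn => [/dvdzP[q lq]|_]; last by rewrite mulr0.
rewrite mulrCA; congr (_ * (_ * _)).
rewrite /psi addrC (_ : 2 * pi * (l%:~R * _ / _) = 2 * pi * (q * j0)%:~R) ?cosD_int//.
by rewrite lq !intrM; field.
Qed.

End cosine_sums.

(** * Gaussian bounds and limits for powers of the cosine and for binomial coefficients *)

Section elementary_limits.
Variable R : realType.
Implicit Types x y : R.

(** Take reciprocals in exp(y / (1 - y)) >= 1 + y / (1 - y) = 1 / (1 - y). *)
Lemma expR_div_le1B y : y < 1 -> expR (- (y / (1 - y))) <= 1 - y.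
Proof.
move=> y1; have y0 : 0 < 1 - y by lra.
rewrite expRN -[leRHS]invrK lef_pV2 ?posrE ?invr_gt0 ?expR_gt0//.
apply: le_trans (expR_ge1Dx _); rewrite le_eqVlt; apply/orP; left.
by apply/eqP; field; lra.
Qed.

(** Squeeze: exp(- M y / (1 - y)) <= (1 - y)^M <= exp(- M y). *)
Lemma cvg_expr1B (M : nat -> nat) (y : R^nat) (L : R) :
  y @ \oo --> 0 -> (fun n => (M n)%:R * y n) @ \oo --> L ->
  (fun n => (1 - y n) ^+ M n) @ \oo --> expR (- L).
Proof.
move=> y0 MyL.
have yinv : (fun n => (1 - y n)^-1) @ \oo --> (1 : R).
  rewrite -[X in _ --> X]invr1; apply: cvgV; first exact: oner_neq0.
  by rewrite -[X in _ --> X]subr0; apply: cvgB => //; exact: cvg_cst.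
apply: (@squeeze_cvgr _ \oo _ _ (fun n => expR (- ((M n)%:R * y n * (1 - y n)^-1)))
  (fun n => expR (- ((M n)%:R * y n)))); first last.
- by apply: continuous_cvg; [exact: continuous_expR|apply: cvgN].
- apply: continuous_cvg; [exact: continuous_expR|apply: cvgN].
  by rewrite -[X in _ --> X]mulr1; exact: cvgM.
have : \forall n \near \oo, y n < 1 by apply: (cvgr_lt 0).
apply: filterS => n yn; have yn0 : 0 <= 1 - y n by lra.
apply/andP; split.
  rewrite -mulrA -mulrN expRM_natl lerXn2r ?nnegrE ?expR_ge0//.
  exact: expR_div_le1B.
by rewrite -mulrN expRM_natl lerXn2r ?nnegrE ?expR_ge0// expR_ge1Dx.
Qed.

Lemma sin_mvt y : 0 <= y <= pi / 2 -> y * cos y <= sin y <= y.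
Proof.
move=> /andP[y0 ypi].
have [c] := @MVT_segment R sin cos 0 y y0 (fun x _ => is_derive_sin x)
  (continuous_subspaceT (@continuous_sin R)).
rewrite in_itv/= sin0 !subr0 => /andP[c0 cy] ->; have := pihalf_lt2 R => pi4.
have pi0 := pi_gt0 R.
rewrite mulrC ler_wpM2r//=; first by rewrite ler_piMl// cos_le1.
rewrite leNgt ltr_cos ?in_itv/= -?leNgt//; apply/andP; split => //; lra.
Qed.

(** With y = |x| / 2, cos y >= 1/2, since otherwise cos (2 y) would be negative. Hence sin y >= y /
    2 and cos x = 1 - 2 sin^2 y <= 1 - x^2 / 8. *)
Lemma cos_le_expR x : - (pi / 2) <= x <= pi / 2 -> 0 <= cos x <= expR (- (x ^+ 2 / 8)).
Proof.
move=> xpi; rewrite cos_ge0_pihalf//=.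
wlog x0 : x xpi / 0 <= x => [hw|].
  have [|x0] := leP 0 x; first exact: hw.
  by rewrite -cosN -sqrrN; apply: hw; lra.
pose y : R := x / 2.
have /sin_mvt/andP[siny _] : 0 <= y <= pi / 2 by rewrite /y; have := pi_gt0 R; lra.
have cos_pi4 : 1 / 2 <= cos y.
  have y4 : - (pi / 2) <= y <= pi / 2 by rewrite /y; have := pi_gt0 R; lra.
  have c0 := cos_ge0_pihalf y4.
  rewrite leNgt; apply/negP => cy.
  have : cos x < 0.
    rewrite (_ : x = y *+ 2) ?cos_mulr2n; last by rewrite /y mulr2n; field.
    by rewrite mulr2n; nra.
  by rewrite ltNge cos_ge0_pihalf.
have y0 : 0 <= y by rewrite /y; lra.
have : y / 2 <= sin y by nra.
move=> ys; apply: le_trans (expR_ge1Dx _).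
rewrite (_ : x = y *+ 2) ?cos_mulr2n; last by rewrite /y mulr2n; field.
rewrite cos2sin2 !mulr2n; nra.
Qed.

Lemma cvg_sqr_sin (w : R) :
  (fun n : nat => (n.+1%:R * sin (w / n.+1%:R)) ^+ 2) @ \oo --> w ^+ 2.
Proof.
wlog w0 : w / 0 <= w => [hw|].
  have [|w0] := leP 0 w; first exact: hw.
  rewrite -sqrrN; under eq_fun do rewrite -sqrrN -mulrN -sinN -mulNr.
  by apply: hw; rewrite oppr_ge0 ltW.
have wn0 : (fun n : nat => w / n.+1%:R) @ \oo --> 0.
  by rewrite -(mulr0 w); apply: cvgM; [exact: cvg_cst|exact: cvg_harmonic].
rewrite expr2; under eq_fun do rewrite expr2.
suff h : (fun n : nat => n.+1%:R * sin (w / n.+1%:R)) @ \oo --> w by exact: cvgM.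
apply: (@squeeze_cvgr _ \oo _ _ (fun n : nat => w * cos (w / n.+1%:R)) (cst w)).
- have pi2 : 0 < pi / 2 :> R by have := pi_gt0 R; lra.
  have : \forall n \near \oo, w / n.+1%:R < pi / 2 by apply: (cvgr_lt 0).
  apply: filterS => n wn.
  have /sin_mvt/andP[h1 h2] : 0 <= w / n.+1%:R <= pi / 2 by rewrite divr_ge0//= ltW.
  set v := w / n.+1%:R in h1 h2 *.
  have -> : w = n.+1%:R * v by rewrite /v mulrC divfK.
  by rewrite /cst -mulrA !ler_pM2l// h1.
- rewrite -[X in _ --> X]mulr1; apply: cvgM; first exact: cvg_cst.
  rewrite -[X in _ --> X](cos0 R).
  by apply: continuous_cvg; [exact: continuous_cos|exact: wn0].
- exact: cvg_cst.
Qed.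

(** Weight at distance [k] from the centre of the binomial row, relative to the central weight. For
    [k > M] the truncated subtraction gives 0, so the estimates below assume [k <= M]. *)
Definition bin_ratio (M k : nat) : R := 'C(2 * M, M - k)%:R / 'C(2 * M, M)%:R.

Lemma bin_ratio0 M : bin_ratio M 0 = 1.
Proof. by rewrite /bin_ratio subn0 divff// pnatr_eq0 -lt0n bin_gt0; lia. Qed.

Lemma bin_ratioS M k : (k < M)%N ->
  bin_ratio M k.+1 = bin_ratio M k * (1 - (2 * k%:R + 1) / (M%:R + k%:R + 1)).
Proof.
move=> kM; rewrite /bin_ratio mulrAC; congr (_ / _).
have := mul_bin_left (2 * M) (M - k.+1).
rewrite (_ : (M - k.+1).+1 = M - k)%N; last by lia.
rewrite (_ : 2 * M - (M - k.+1) = M + k + 1)%N; last by lia.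
move=> /(congr1 (fun i : nat => i%:R : R)); rewrite !natrM !natrD natrB; last by lia.
have Mk0 : M%:R + k%:R + 1 != 0 :> R by rewrite gt_eqF// ltr_wpDl// addr_ge0.
move=> h; apply: (mulfI Mk0); rewrite -h; field.
by rewrite Mk0.
Qed.

Lemma bin_ratio_ge0 M k : 0 <= bin_ratio M k.
Proof. by rewrite divr_ge0. Qed.

(** Each factor in [bin_ratioS] is at most exp(- (2 k + 1) / (M + K)), and the odd numbers add up to
    k^2. The separate bound [K] keeps the denominator fixed during the induction. *)
Lemma bin_ratio_le (M K k : nat) : (k <= K)%N -> (k <= M)%N ->
  bin_ratio M k <= expR (- (k%:R ^+ 2 / (M%:R + K%:R))).
Proof.
elim: k => [|k IH] kK kM.
  by rewrite bin_ratio0 expr0n/= mul0r oppr0 expR0.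
have MK0 : 0 < M%:R + K%:R :> R by rewrite -natrD ltr0n; lia.
have Mk0 : 0 < M%:R + k%:R + 1 :> R by rewrite ltr_wpDl// addr_ge0.
rewrite bin_ratioS//; have {}IH := IH (ltnW kK) (ltnW kM).
have -> : expR (- (k.+1%:R ^+ 2 / (M%:R + K%:R))) =
    expR (- (k%:R ^+ 2 / (M%:R + K%:R))) * expR (- ((2 * k%:R + 1) / (M%:R + K%:R))) :> R.
  by rewrite -expRD -[k.+1%:R]natr1; congr expR; field; rewrite gt_eqF.
apply: ler_pM => //; first exact: bin_ratio_ge0.
  rewrite subr_ge0 ler_pdivrMr// mul1r.
  by have : k%:R + 1 <= M%:R :> R; [rewrite natr1 ler_nat|lra].
apply: le_trans (expR_ge1Dx _); rewrite lerD2l lerN2.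
rewrite ler_pM2l; last by rewrite ltr_wpDl// mulr_ge0.
by rewrite lef_pV2 ?posrE// -addrA lerD2l natr1 ler_nat.
Qed.

(** Same product from below: with y the quantity subtracted from 1 in [bin_ratioS], y / (1 - y) = (2
    k + 1) / (M - k), which [expR_div_le1B] turns into an exponential bound. *)
Lemma bin_ratio_ge (M K k : nat) : (k <= K)%N -> (K < M)%N ->
  expR (- (k%:R ^+ 2 / (M%:R - K%:R))) <= bin_ratio M k.
Proof.
move=> + KM; elim: k => [|k IH] kK.
  by rewrite bin_ratio0 expr0n/= mul0r oppr0 expR0.
have MK0 : 0 < M%:R - K%:R :> R by rewrite subr_gt0 ltr_nat.
have kKR : k%:R + 1 <= K%:R :> R by rewrite natr1 ler_nat.
have k0 : 0 <= k%:R :> R by [].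
have Mk0 : 0 < M%:R + k%:R + 1 :> R by lra.
rewrite bin_ratioS; last by lia.
have {}IH := IH (ltnW kK).
have -> : expR (- (k.+1%:R ^+ 2 / (M%:R - K%:R))) =
    expR (- (k%:R ^+ 2 / (M%:R - K%:R))) * expR (- ((2 * k%:R + 1) / (M%:R - K%:R))) :> R.
  by rewrite -expRD -[k.+1%:R]natr1; congr expR; field; rewrite gt_eqF.
apply: ler_pM => //; rewrite ?expR_ge0//.
set y : R := (2 * k%:R + 1) / (M%:R + k%:R + 1).
have y1 : y < 1 by rewrite /y ltr_pdivrMr// mul1r; lra.
apply: le_trans (expR_div_le1B y1); rewrite ler_expR lerN2.
have -> : y / (1 - y) = (2 * k%:R + 1) / (M%:R - k%:R).
  by rewrite /y; field; rewrite !gt_eqF//=; lra.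
rewrite ler_pM2l; last by lra.
by rewrite lef_pV2 ?posrE; lra.
Qed.

(** Local de Moivre-Laplace limit, squeezed between the two preceding bounds taken at [K = k]. *)
Lemma cvg_bin_ratio (M k : nat -> nat) (L : R) :
  (fun n => (k n)%:R / (M n)%:R) @ \oo --> (0 : R) ->
  (fun n => (k n)%:R ^+ 2 / (M n)%:R) @ \oo --> L ->
  (\forall n \near \oo, (0 < M n)%N) ->
  (fun n => bin_ratio (M n) (k n)) @ \oo --> expR (- L).
Proof.
move=> kM k2M M0.
have inv (e : R) : (fun n => (1 + e * ((k n)%:R / (M n)%:R))^-1) @ \oo --> (1 : R).
  rewrite -[X in _ --> X]invr1; apply: cvgV; first exact: oner_neq0.
  rewrite -[X in _ --> X]addr0; apply: cvgD; first exact: cvg_cst.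
  by rewrite -(mulr0 e); apply: cvgM => //; exact: cvg_cst.
have bnd (e : R) : (fun n => expR (- ((k n)%:R ^+ 2 / (M n)%:R *
    (1 + e * ((k n)%:R / (M n)%:R))^-1))) @ \oo --> expR (- L).
  apply: continuous_cvg; [exact: continuous_expR|apply: cvgN].
  by rewrite -[X in _ --> X]mulr1; apply: cvgM.
apply: (squeeze_cvgr _ (bnd (- 1)) (bnd 1)).
have k1 : \forall n \near \oo, (k n)%:R / (M n)%:R < 1 :> R by apply: (cvgr_lt 0).
near=> n.
have Mn : 0 < (M n)%:R :> R by rewrite ltr0n; near: n.
have kMn : (k n < M n)%N.
  by rewrite -(ltr_nat R) -[ltRHS]mul1r -ltr_pdivrMr//; near: n.
have kMnR : (k n)%:R < (M n)%:R :> R by rewrite ltr_nat.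
have kn0 : 0 <= (k n)%:R :> R by [].
apply/andP; split.
  apply: le_trans (bin_ratio_ge (leqnn _) kMn); rewrite ler_expR lerN2 le_eqVlt.
  by apply/orP; left; apply/eqP; field; rewrite !gt_eqF//=; lra.
apply: le_trans (bin_ratio_le (leqnn _) (ltnW kMn)) _; rewrite ler_expR lerN2 le_eqVlt.
by apply/orP; left; apply/eqP; field; rewrite !gt_eqF//=; lra.
Unshelve. all: by end_near. Qed.

Definition central_bin (M : nat) : R := 'C(2 * M, M)%:R / 4 ^+ M.

Lemma central_bin_gt0 M : 0 < central_bin M.
Proof. by rewrite divr_gt0 ?exprn_gt0// ltr0n bin_gt0; lia. Qed.

Lemma central_binS M : central_bin M.+1 = central_bin M * ((2 * M%:R + 1) / (2 * M%:R + 2)).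
Proof.
have h : ((M.+1) * 'C(2 * M.+1, M.+1) = 2 * (2 * M + 1) * 'C(2 * M, M))%N.
  have e1 := mul_bin_diag (2 * M).+2 M.
  have e2 := mul_bin_left (2 * M).+1 M.
  have e3 := mul_bin_diag (2 * M).+1 M.
  have e4 := mul_bin_down (2 * M).+1 M.
  rewrite (_ : (2 * M.+1 = (2 * M).+2)%N); last by lia.
  move: e1 e2 e3 e4 => /=; rewrite (_ : (2 * M).+1 - M = M.+1)%N; last by lia.
  nia.
have M0 : M%:R + 1 != 0 :> R by rewrite gt_eqF// ltr_wpDl.
move/(congr1 (fun i : nat => i%:R : R)) : h; rewrite !natrM -natr1 natrD natrM => h.
apply: (mulfI M0); rewrite /central_bin mulrA h exprS; field.
have M2 : 2 * M%:R + 2 != 0 :> R by rewrite gt_eqF// ltr_wpDl// mulr_ge0.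
by rewrite M2 expf_neq0.
Qed.

(** The sequence is nondecreasing, and bounded by 1 because (2 M + 1) [central_bin M] ^2 decreases
    from the value 1. Only existence of the limit is obtained here; its value is fixed later by
    Poisson's formula itself. *)
Lemma is_cvg_sqrt_central_bin : exists beta : R,
  (fun M => Num.sqrt M%:R * central_bin M) @ \oo --> beta.
Proof.
have le1 M : (2 * M%:R + 1) * central_bin M ^+ 2 <= 1.
  elim: M => [|M IH]; first by rewrite /central_bin bin0 expr0 divr1 mulr0 add0r mul1r expr1n.
  apply: le_trans IH; rewrite central_binS exprMn mulrCA mulrC ler_wpM2r ?sqr_ge0//.
  have M0 : 0 <= M%:R :> R by [].
  rewrite -[M.+1%:R]natr1 expr_div_n mulrA ler_pdivrMr ?exprn_gt0//; last by lra.
suff : cvgn (fun M => Num.sqrt M%:R * central_bin M) by move=> h; eexists; exact: h.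
apply: nondecreasing_is_cvgn.
  apply/nondecreasing_seqP => M; rewrite central_binS [leRHS]mulrCA [leLHS]mulrC.
  rewrite ler_pM2l ?central_bin_gt0//.
  have M0 : 0 <= M%:R :> R by [].
  have q0 : 0 <= (2 * M%:R + 1) / (2 * M%:R + 2) :> R by rewrite divr_ge0//; lra.
  rewrite -(@ler_pXn2r _ 2) ?nnegrE ?mulr_ge0 ?sqrtr_ge0//.
  rewrite exprMn !sqr_sqrtr// -natr1 expr_div_n mulrA ler_pdivlMr ?exprn_gt0; nra.
exists 1 => _ [M _ <-].
have c0 := ltW (central_bin_gt0 M).
rewrite -(@ler_pXn2r _ 2) ?nnegrE ?mulr_ge0 ?sqrtr_ge0// exprMn sqr_sqrtr// expr1n.
apply: le_trans (le1 M); rewrite ler_wpM2r ?sqr_ge0//.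
by have : 0 <= M%:R :> R by []; lra.
Qed.

End elementary_limits.

(** * Sums over the integers *)

Section has_sum_int.
Variable R : realType.

Lemma has_sum_sum (T : choiceType) (I : Type) (r : seq I) (P : pred I)
    (F : I -> T -> R) (s : I -> R) :
  (forall i, P i -> has_sum (F i) (s i)) ->
  has_sum (fun x => \sum_(i <- r | P i) F i x) (\sum_(i <- r | P i) s i).
Proof.
move=> Fs; elim: r => [|i r IH].
  rewrite big_nil; have := @has_sum_fset R T fset0 (fun=> 0) (fun _ _ => erefl).
  by rewrite big_seq_fset0; apply: eq_has_sum => x; rewrite big_nil.
rewrite big_cons; case: ifPn => Pi.
  by apply: eq_has_sum (has_sumD (Fs i Pi) IH) => x; rewrite big_cons Pi.
by apply: eq_has_sum IH => x; rewrite big_cons (negbTE Pi).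
Qed.

Lemma has_sum_finite_image (T : choiceType) (I : finType) (P : pred I) (h : I -> T) (f : T -> R) :
  {in P &, injective h} -> (forall x, f x != 0 -> exists2 i, P i & x = h i) ->
  has_sum f (\sum_(i | P i) f (h i)).
Proof.
move=> hinj fh.
have h1 i : P i -> has_sum (fun x => if x == h i then f x else 0) (f (h i)).
  move=> _; apply: eq_has_sum (has_sum_delta (h i) (f (h i))) => x.
  by case: eqP => [->|].
apply: eq_has_sum (has_sum_sum (index_enum I) h1) => x.
have [fx0|/fh[i0 Pi0 xi0]] := eqVneq (f x) 0.
  by rewrite big1// => i _; rewrite fx0 if_same.
rewrite (bigD1 i0)//= xi0 eqxx big1 ?addr0// => i /andP[Pi ii0].
by rewrite ifN//; apply: contra ii0 => /eqP/hinj -> //.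
Qed.

Lemma has_sum_geometric_int (q : R) : 0 <= q < 1 ->
  exists s, has_sum (fun z : int => q ^+ `|z|%N) s.
Proof.
move=> /andP[q0 q1].
have geo (a : R) : 0 <= a -> has_sum (fun n : nat => a * q ^+ n) (a / (1 - q)).
  move=> a0; apply/has_sum_ge0P => [n|]; first by rewrite mulr_ge0// exprn_ge0.
  rewrite -nneseries_esumT; last by move=> n; rewrite lee_fin mulr_ge0// exprn_ge0.
  apply/cvg_lim => //.
  have := @cvg_geometric_series R a q; rewrite ger0_norm// => /(_ q1) h.
  rewrite (_ : (fun n => _) = EFin \o (series (geometric a q))).
    by apply: cvg_comp h _.
  by apply/funext => n /=; rewrite /series/= sumEFin.
pose to (z : int) : bool * nat := match z with Posz n => (true, n) | Negz n => (false, n) end.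
pose of_ (x : bool * nat) : int := if x.1 then Posz x.2 else Negz x.2.
have to_of : cancel to of_ by case.
have of_to : cancel of_ to by case=> -[].
(* [Negz n] has absolute value [n.+1], hence the extra factor [q] on the negative branch. *)
pose F (b : bool) (n : nat) : R := if b then 1 * q ^+ n else q * q ^+ n.
have hF := @has_sum_prod_ge0 R bool nat F (fun b => (if b then 1 else q) / (1 - q)).
have [s2 hs2] : exists s2, has_sum (fun b : bool => (if b then 1 else q) / (1 - q)) s2.
  eexists; apply: (@has_sum_finite_image bool bool xpredT id) => //.
  by move=> x _; exists x.
exists s2; have := hF s2 _ _ hs2.
have F0 b n : 0 <= F b n by rewrite /F; case: b; rewrite mulr_ge0// exprn_ge0.
have Fs b : has_sum (F b) ((if b then 1 else q) / (1 - q)).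
  by rewrite /F; case: b; apply: geo.
move=> /(_ F0 Fs)/(has_sum_reindex to_of of_to); apply: eq_has_sum.
by case=> n; rewrite /F/= ?mul1r// -exprS.
Qed.

(** Since |z| <= z^2 and z^2 / 2 - v^2 <= (z + v)^2, the family is dominated by a geometric one of
    ratio exp(- a / 2). *)
Lemma has_sum_gauss_int (a v : R) : 0 < a ->
  exists s, has_sum (fun z : int => expR (- (a * (z%:~R + v) ^+ 2))) s.
Proof.
move=> a0.
have [|s hs] := @has_sum_geometric_int (expR (- (a / 2))).
  by rewrite expR_ge0/= -[ltRHS]expR0 ltr_expR; lra.
apply: (@ge0_has_sum_dominated R _ _ _ (expR (a * v ^+ 2) * s)); last exact: has_sumZ hs.
move=> z /=; rewrite expR_ge0/= -expRM_natl -expRD ler_expR.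
have h1 : (`|z|%N)%:R <= z%:~R ^+ 2 :> R.
  rewrite -[(`|z|%N)%:R]/((`|z|%N)%:~R) expr2 -intrM ler_int; nia.
have h2 : z%:~R ^+ 2 / 2 - v ^+ 2 <= (z%:~R + v) ^+ 2 :> R.
  by have := sqr_ge0 (z%:~R + 2 * v : R); lra.
have h3 : (`|z|%N)%:R / 2 - v ^+ 2 <= (z%:~R + v) ^+ 2 :> R by lra.
by have := ler_wpM2l (ltW a0) h3; lra.
Qed.

End has_sum_int.

Lemma bin_ratio_dist (R : realType) (M i : nat) : (i <= 2 * M)%N ->
  bin_ratio R M `|M%:Z - i%:Z|%N = 'C(2 * M, i)%:R / 'C(2 * M, M)%:R.
Proof.
move=> iM; rewrite /bin_ratio; congr (_%:R / _).
have [le_iM|lt_Mi] := leqP i M; first by congr 'C(_, _); lia.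
by rewrite -(bin_sub iM); congr 'C(_, _); lia.
Qed.

(** * Passage to the limit in the finite identity, with N = n + 1, M ~ c N^2 and r ~ u N *)

Section poisson_limit.
Variables (R : realType) (c u xi phi : R) (M : nat -> nat) (r : nat -> int).
Hypothesis c0 : 0 < c.
Hypothesis M_cvg : (fun n => (M n)%:R / n.+1%:R ^+ 2) @ \oo --> c.
Hypothesis M_oo : M @ \oo --> \oo.
Hypothesis r_near : forall n, `|(r n)%:~R / n.+1%:R - u| <= n.+1%:R^-1.

Let N0 (n : nat) : 0 < n.+1%:R :> R. Proof. by []. Qed.

Let r_cvg : (fun n => (r n)%:~R / n.+1%:R) @ \oo --> u.
Proof.
apply/cvgrPdist_le => e e0.
have : \forall n \near \oo, n.+1%:R^-1 < e :> R.
  by apply: (cvgr_lt 0) => //; exact: cvg_harmonic.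
by apply: filterS => n ne; rewrite distrC; apply: le_trans (r_near n) (ltW ne).
Qed.

(** Summand over the roots of unity in [sum_cos_expr], extended by 0 outside a window of length
    [n.+1] centred at [- xi]. Inside it the cosine raised to the power has argument in
    [-pi/2, pi/2], where a Gaussian majorant is available. *)
Let f (n : nat) (j : int) : R :=
  if - (n.+1%:R / 2) <= j%:~R + xi < n.+1%:R / 2 then
    cos (pi * (j%:~R + xi) / n.+1%:R) ^+ (2 * M n) *
    cos (2 * pi * ((- r n)%:~R * j%:~R / n.+1%:R + phi))
  else 0.

(** Signed distance to the central binomial coefficient: the surviving indices [i] are those with
    [M n - i = k n z] for some integer [z]. *)
Let k (n : nat) (z : int) : int := r n + n.+1%:Z * z.

Let g (n : nat) (z : int) : R :=
  if (`|k n z| <= M n)%N then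
    bin_ratio R (M n) `|k n z| * cos (2 * pi * ((k n z)%:~R * xi / n.+1%:R + phi))
  else 0.

(** The finite identity rewritten as two families over the integers with proportional sums, the form
    in which [has_sum_tannery] applies to each side. *)
Let has_sum_fg n : exists t,
  has_sum (f n) (n.+1%:R * central_bin R (M n) * t) /\ has_sum (g n) t.
Proof.
pose P (i : 'I_(2 * M n).+1) := (n.+1 %| (M n)%:Z - i%:Z + - r n)%Z.
pose h (i : 'I_(2 * M n).+1) := (((M n)%:Z - i%:Z + - r n) %/ n.+1)%Z.
have hE i : P i -> k n (h i) = (M n)%:Z - i%:Z.
  by move=> Pi; rewrite /k mulrC /h divzK//; ring.
exists (\sum_(i | P i) g n (h i)); split; last first.
  apply: has_sum_finite_image.
    move=> i j Pi Pj hij; apply: val_inj => /=.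
    by have := hE i Pi; have := hE j Pj; rewrite hij; lia.
  move=> z; rewrite /g; case: ifPn; rewrite ?eqxx// => kM _.
  have iP : (`|((M n)%:Z - k n z)%R|%N < (2 * M n).+1)%N by move: kM; lia.
  pose i := Ordinal iP.
  have iE : (M n)%:Z - i%:Z = k n z by rewrite /=; move: kM; lia.
  have nz : (M n)%:Z - i%:Z + - r n = z * n.+1%:Z by rewrite iE /k; ring.
  exists i; first by rewrite /P nz; exact: dvdz_mull.
  by rewrite /h nz mulzK.
(* The least integer of the window; the [n.+1] consecutive integers starting there exhaust it. *)
pose j0 : int := Num.ceil (- (n.+1%:R / 2) - xi).
have /andP[j1 j2] := ceil_itv (- (n.+1%:R / 2) - xi).
rewrite -/j0 intrB in j1 j2.
have := @sum_cos_expr R n.+1 (M n) (- r n) j0 xi phi (ltn0Sn n).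
set S1 := \sum_(j < n.+1) _ => S12.
have -> : n.+1%:R * central_bin R (M n) * \sum_(i | P i) g n (h i) = S1.
  rewrite S12 !mulr_sumr; apply: eq_bigr => i Pi.
  have iM : (i <= 2 * M n)%N by rewrite -ltnS.
  rewrite /g hE// ifT; last by lia.
  rewrite bin_ratio_dist// /central_bin intrB; field.
  by rewrite !gt_eqF ?exprn_gt0 ?ltr0n ?bin_gt0//; lia.
have S1E : S1 = \sum_(j < n.+1) f n (j0 + j%:Z).
  apply: eq_bigr => j _; rewrite /f ifT//.
  have : (j%:R + 1 <= n.+1%:R :> R) by rewrite natr1 ler_nat.
  by rewrite intrD; have : 0 <= j%:R :> R by []; lra.
rewrite S1E; apply: has_sum_finite_image.
  by move=> i j _ _ ij; apply: val_inj => /=; lia.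
move=> j; rewrite /f; case: ifPn; rewrite ?eqxx// => /andP[h1 h2] _.
have h3 : j0 <= j by rewrite /j0 ceil_le_int; lra.
have h4 : j < j0 + n.+1%:Z by rewrite -(ltr_int R) intrD -[(n.+1%:Z)%:~R]/(n.+1%:R : R); lra.
have iP : (`|(j - j0)%R|%N < n.+1)%N by lia.
by exists (Ordinal iP) => //=; lia.
Qed.

Let inv_cvg : (fun n : nat => n.+1%:R^-1) @ \oo --> (0 : R).
Proof. exact: cvg_harmonic. Qed.

Let M_gt0 : \forall n \near \oo, (0 < M n)%N.
Proof. by move/cvgnyPge : M_oo => /(_ 1%N). Qed.

(** Eventually M >= (c / 2) N^2, so raising exp(- x^2 / 8) to the power 2 M leaves a Gaussian in [j]
    that does not depend on [n]. *)
Let f_dominated : \forall n \near \oo, forall j,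
  `|f n j| <= expR (- (c * pi ^+ 2 / 8 * (j%:~R + xi) ^+ 2)).
Proof.
have c2 : c / 2 < c by move: c0; lra.
have : \forall n \near \oo, c / 2 < (M n)%:R / n.+1%:R ^+ 2 by apply: (cvgr_gt c).
apply: filterS => n cM j; rewrite /f; case: ifPn => [/andP[j1 j2]|]; last by rewrite normr0 expR_ge0.
have p0 := pi_gt0 R; set x := pi * (j%:~R + xi) / n.+1%:R.
have xE : x * n.+1%:R = pi * (j%:~R + xi) by rewrite divfK.
have /cos_le_expR/andP[cx0 cx] : - (pi / 2) <= x <= pi / 2.
  rewrite -(ler_pM2r (N0 n)) -[x <= _](ler_pM2r (N0 n)) xE.
  by have := ler_wpM2l (ltW p0) j1; have := ler_wpM2l (ltW p0) (ltW j2); lra.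
rewrite normrM -[leRHS]mulr1 ler_pM ?normr_ge0 ?cos_max//.
rewrite normrX ger0_norm//.
apply: (@le_trans _ _ (expR (- (x ^+ 2 / 8)) ^+ (2 * M n))); first by rewrite lerXn2r ?nnegrE ?expR_ge0.
rewrite -expRM_natl ler_expR mulrN lerN2 natrM.
have -> : 2 * (M n)%:R * (x ^+ 2 / 8) = (M n)%:R / n.+1%:R ^+ 2 * (pi ^+ 2 * (j%:~R + xi) ^+ 2 / 4).
  by rewrite /x; field.
rewrite (_ : c * pi ^+ 2 / 8 * _ = c / 2 * (pi ^+ 2 * (j%:~R + xi) ^+ 2 / 4)); last by field.
apply: ler_wpM2r; last exact: ltW.
by rewrite divr_ge0// mulr_ge0// sqr_ge0.
Qed.

(** The even power of the cosine is (1 - sin^2)^M, where M sin^2 (w / N) tends to c w^2; every fixed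
    [j] eventually lies in the window. *)
Let f_cvg j : f ^~ j @ \oo -->
  expR (- (c * pi ^+ 2 * (j%:~R + xi) ^+ 2)) * cos (2 * pi * (- u * j%:~R + phi)).
Proof.
pose w : R := pi * (j%:~R + xi).
have yE n : sin (w / n.+1%:R) ^+ 2 =
    (n.+1%:R * sin (w / n.+1%:R)) ^+ 2 * (n.+1%:R^-1 * n.+1%:R^-1) by field.
have lim : (fun n => (1 - sin (w / n.+1%:R) ^+ 2) ^+ M n *
    cos (2 * pi * ((- r n)%:~R * j%:~R / n.+1%:R + phi))) @ \oo -->
    expR (- (c * pi ^+ 2 * (j%:~R + xi) ^+ 2)) * cos (2 * pi * (- u * j%:~R + phi)).
  apply: cvgM.
    have -> : c * pi ^+ 2 * (j%:~R + xi) ^+ 2 = c * w ^+ 2 by rewrite /w; ring.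
    apply: cvg_expr1B.
      rewrite (funext yE) [X in _ --> X](_ : 0 = w ^+ 2 * (0 * 0)); last by rewrite !mulr0.
      by apply: cvgM; [exact: cvg_sqr_sin|exact: cvgM].
    rewrite (_ : (fun n => _) = (fun n => (M n)%:R / n.+1%:R ^+ 2 * (n.+1%:R * sin (w / n.+1%:R)) ^+ 2)).
      by apply: cvgM => //; exact: cvg_sqr_sin.
    by apply/funext => n; field.
  apply: continuous_cvg; first exact: continuous_cos.
  apply: cvgM; first exact: cvg_cst.
  apply: cvgD; last exact: cvg_cst.
  rewrite (_ : (fun n => _) = (fun n => - ((r n)%:~R / n.+1%:R) * j%:~R)).
    by apply: cvgM; [exact: cvgN|exact: cvg_cst].
  by apply/funext => n; rewrite mulrNz; field.
apply: cvg_trans lim; apply: near_eq_cvg.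
have := nbhs_infty_ger (2 * (`|j%:~R + xi| + 1) : R).
apply: filterS => n hn.
have n1 : n.+1%:R = n%:R + 1 :> R by rewrite natr1.
rewrite /f ifT; last by have := ler_norm (j%:~R + xi); have := ler_norm (- (j%:~R + xi)); rewrite normrN; lra.
by rewrite exprM cos2sin2.
Qed.

Let kN_cvg z : (fun n => (k n z)%:~R / n.+1%:R) @ \oo --> z%:~R + u.
Proof.
rewrite (_ : (fun n => _) = (fun n => z%:~R + (r n)%:~R / n.+1%:R)).
  by apply: cvgD => //; exact: cvg_cst.
apply/funext => n; rewrite /k intrD intrM -[(n.+1%:Z)%:~R]/(n.+1%:R : R).
by field.
Qed.

(** [bin_ratio_le] with [K = M] gives exp(- k^2 / (2 M)). Eventually M < 2 c N^2, and k / N stays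
    within 1 of z + u, so its square is at least (z + u)^2 / 2 - 1; that 1 produces the constant
    factor. *)
Let g_dominated : \forall n \near \oo, forall z,
  `|g n z| <= expR (1 / (4 * c)) * expR (- (1 / (8 * c) * (z%:~R + u) ^+ 2)).
Proof.
have c2 : c < 2 * c by move: c0; lra.
have : \forall n \near \oo, (M n)%:R / n.+1%:R ^+ 2 < 2 * c by apply: (cvgr_lt c).
apply: filterS2 M_gt0 => n M0 cM z; rewrite /g.
case: ifPn => kM; last by rewrite normr0 mulr_ge0 ?expR_ge0.
rewrite normrM (ger0_norm (bin_ratio_ge0 _ _ _)).
apply: (@le_trans _ _ (bin_ratio R (M n) `|k n z|)).
  by rewrite ler_piMr ?bin_ratio_ge0 ?cos_max.
apply: le_trans (bin_ratio_le _ kM kM) _.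
have M0R : 0 < (M n)%:R :> R by rewrite ltr0n.
rewrite -expRD ler_expR natr_absz intr_norm real_normK ?num_real//.
pose x : R := (k n z)%:~R / n.+1%:R.
have kx : (k n z)%:~R = x * n.+1%:R by rewrite divfK.
have xzu : `|x - (z%:~R + u)| <= 1.
  have -> : x - (z%:~R + u) = (r n)%:~R / n.+1%:R - u.
    by rewrite /x /k intrD intrM -[(n.+1%:Z)%:~R]/(n.+1%:R : R); field.
  by apply: le_trans (r_near n) _; rewrite invf_le1// ler1n.
clearbody x.
have x2 : (z%:~R + u) ^+ 2 / 2 - 1 <= x ^+ 2.
  have := sqr_ge0 (2 * x - (z%:~R + u)).
  have : (x - (z%:~R + u)) ^+ 2 <= 1 by rewrite -[leRHS](expr1n _ 2) -real_normK ?num_real// lerXn2r ?nnegrE.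
  by move: (z%:~R + u) => y; lra.
move: cM; rewrite ltr_pdivrMr ?exprn_gt0// => cM.
have : x ^+ 2 / (4 * c) <= (k n z)%:~R ^+ 2 / ((M n)%:R + (M n)%:R).
  rewrite ler_pdivlMr ?addr_gt0// mulrAC ler_pdivrMr ?mulr_gt0//.
  rewrite kx exprMn -[leRHS]mulrA ler_wpM2l ?sqr_ge0//; lra.
have : ((z%:~R + u) ^+ 2 / 2 - 1) / (4 * c) <= x ^+ 2 / (4 * c).
  by rewrite ler_pM2r// invr_gt0 mulr_gt0.
have -> : 1 / (8 * c) * (z%:~R + u) ^+ 2 = (z%:~R + u) ^+ 2 / 2 / (4 * c).
  by field; rewrite gt_eqF.
lra.
Qed.

Let g_cvg z : g ^~ z @ \oo -->
  expR (- ((z%:~R + u) ^+ 2 / c)) * cos (2 * pi * ((z%:~R + u) * xi + phi)).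
Proof.
have Minv : (fun n => ((M n)%:R / n.+1%:R ^+ 2)^-1) @ \oo --> c^-1.
  by apply: cvgV => //; rewrite gt_eqF.
have absk n : (`|k n z|%N)%:R = `|(k n z)%:~R| :> R by rewrite natr_absz intr_norm.
have kM0 : (fun n => (`|k n z|%N)%:R / (M n)%:R) @ \oo --> (0 : R).
  rewrite (_ : (fun n => _) = (fun n => `|(k n z)%:~R / n.+1%:R| *
      (((M n)%:R / n.+1%:R ^+ 2)^-1 * n.+1%:R^-1))).
    rewrite -[X in _ --> X](mulr0 `|z%:~R + u|); apply: cvgM.
      by apply: cvg_norm.
    by rewrite -[X in _ --> X](mulr0 c^-1); apply: cvgM.
  apply/funext => n; rewrite absk normrM (@ger0_norm _ n.+1%:R^-1) ?invr_ge0//.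
  have [->|Mn0] := eqVneq (M n) 0%N; first by rewrite !(mul0r, invr0, mulr0).
  by field; rewrite nat1r !pnatr_eq0.
have kM2 : (fun n => (`|k n z|%N)%:R ^+ 2 / (M n)%:R) @ \oo --> (z%:~R + u) ^+ 2 / c.
  rewrite (_ : (fun n => _) = (fun n => ((k n z)%:~R / n.+1%:R) * ((k n z)%:~R / n.+1%:R) *
      ((M n)%:R / n.+1%:R ^+ 2)^-1)).
    by rewrite expr2; apply: cvgM => //; apply: cvgM.
  apply/funext => n; rewrite absk real_normK ?num_real//.
  have [->|Mn0] := eqVneq (M n) 0%N; first by rewrite !(mul0r, invr0, mulr0).
  by field; rewrite nat1r !pnatr_eq0.
have lim : (fun n => bin_ratio R (M n) `|k n z| *
    cos (2 * pi * ((k n z)%:~R * xi / n.+1%:R + phi))) @ \oo -->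
    expR (- ((z%:~R + u) ^+ 2 / c)) * cos (2 * pi * ((z%:~R + u) * xi + phi)).
  apply: cvgM; first exact: cvg_bin_ratio.
  apply: continuous_cvg; first exact: continuous_cos.
  apply: cvgM; first exact: cvg_cst.
  apply: cvgD; last exact: cvg_cst.
  rewrite (_ : (fun n => _) = (fun n => (k n z)%:~R / n.+1%:R * xi)).
    by apply: cvgM => //; exact: cvg_cst.
  by apply/funext => n; field.
apply: cvg_trans lim; apply: near_eq_cvg.
have : \forall n \near \oo, (`|k n z|%N)%:R / (M n)%:R < 1 :> R by apply: (cvgr_lt 0).
apply: filterS2 M_gt0 => n M0; rewrite ltr_pdivrMr ?ltr0n// mul1r ltr_nat => kM.
by rewrite /g ifT// ltnW.
Qed.

(** The factor between the two finite sums is N [central_bin] M, that is, N / sqrt M times sqrt M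
    [central_bin] M, which tends to beta / sqrt c. *)
Lemma poisson_limit (beta : R) :
  (fun m => Num.sqrt m%:R * central_bin R m) @ \oo --> beta ->
  exists T, has_sum (fun z : int => expR (- ((z%:~R + u) ^+ 2 / c)) *
                       cos (2 * pi * ((z%:~R + u) * xi + phi))) T /\
    has_sum (fun j : int => expR (- (c * pi ^+ 2 * (j%:~R + xi) ^+ 2)) *
                       cos (2 * pi * (- u * j%:~R + phi))) ((Num.sqrt c)^-1 * beta * T).
Proof.
move=> hbeta; have /choice[t ht] := has_sum_fg.
have [Gf hGf] : exists G, has_sum (fun j : int => expR (- (c * pi ^+ 2 / 8 * (j%:~R + xi) ^+ 2))) G.
  by apply: has_sum_gauss_int; rewrite divr_gt0 ?mulr_gt0 ?exprn_gt0 ?pi_gt0.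
have [Gg hGg] : exists G, has_sum (fun z : int => expR (- (1 / (8 * c) * (z%:~R + u) ^+ 2))) G.
  by apply: has_sum_gauss_int; rewrite divr_gt0 ?mulr_gt0.
have [T hT tT] := has_sum_tannery (@eventually_filter) (has_sumZ (expR (1 / (4 * c))) hGg) g_dominated
  g_cvg (nearW _ (fun n => (ht n).2)).
have [S hS sS] := has_sum_tannery (@eventually_filter) hGf f_dominated
  f_cvg (nearW _ (fun n => (ht n).1)).
exists T; split => //.
suff -> : (Num.sqrt c)^-1 * beta * T = S by [].
apply: (@cvg_unique _ (@Rhausdorff R) _ _ _ _ _ sS).
apply: cvgM => //.
have lim : (fun n => (Num.sqrt ((M n)%:R / n.+1%:R ^+ 2))^-1 *
    (Num.sqrt (M n)%:R * central_bin R (M n))) @ \oo --> (Num.sqrt c)^-1 * beta.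
  apply: cvgM.
    apply: cvgV; first by rewrite gt_eqF// sqrtr_gt0.
    by apply: continuous_cvg => //; exact: sqrt_continuous.
  exact: (cvg_comp _ _ M_oo hbeta).
apply: cvg_trans lim; apply: near_eq_cvg.
apply: filterS M_gt0 => n M0.
rewrite sqrtrM// sqrtrV ?sqr_ge0// sqrtr_sqr ger0_norm//.
have sM : Num.sqrt (M n)%:R != 0 :> R by rewrite gt_eqF// sqrtr_gt0 ltr0n.
by field; rewrite sM nat1r pnatr_eq0.
Qed.

End poisson_limit.

Section poisson_dim1.
Variable R : realType.

Lemma poisson_dim1_const : exists beta : R, forall (a u xi phi : R), 0 < a ->
  exists T, has_sum (fun z : int => expR (- (pi * (a * (z%:~R + u) ^+ 2))) *
                       cos (2 * pi * ((z%:~R + u) * xi + phi))) T /\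
    has_sum (fun m : int => expR (- (pi * ((m%:~R - xi) ^+ 2 / a))) *
                       cos (2 * pi * (u * m%:~R + phi))) (Num.sqrt (pi * a) * beta * T).
Proof.
have [beta hbeta] := is_cvg_sqrt_central_bin R.
exists beta => a u xi phi a0; have p0 := pi_gt0 R.
(* This choice makes 1 / c equal to pi a on one side and c pi^2 equal to pi / a on the other. *)
pose c : R := (pi * a)^-1.
have c0 : 0 < c by rewrite invr_gt0 mulr_gt0.
pose M (n : nat) : nat := Num.truncn (c * n.+1%:R ^+ 2).
pose r (n : nat) : int := Num.floor (u * n.+1%:R).
have Mitv n : (M n)%:R <= c * n.+1%:R ^+ 2 < (M n)%:R + 1.
  by rewrite /M natr1; apply: truncn_itv; rewrite mulr_ge0// ltW.
have N0 (n : nat) : 0 < n.+1%:R :> R by [].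
have M_cvg : (fun n => (M n)%:R / n.+1%:R ^+ 2) @ \oo --> c.
  apply: (@squeeze_cvgr _ \oo _ _ (fun n => c - n.+1%:R^-1 * n.+1%:R^-1) (cst c)).
  - apply: nearW => n; have /andP[M1 M2] := Mitv n.
    have N2 : 0 < n.+1%:R ^+ 2 :> R by rewrite exprn_gt0.
    rewrite /cst ler_pdivrMr// M1 andbT ler_pdivlMr// mulrBl -expr2 exprVn.
    by rewrite mulVf ?gt_eqF//; lra.
  - rewrite -[X in _ --> X]subr0 -[X in _ - X](mulr0 0).
    by apply: cvgB; [exact: cvg_cst|apply: cvgM; exact: cvg_harmonic].
  - exact: cvg_cst.
have r_near n : `|(r n)%:~R / n.+1%:R - u| <= n.+1%:R^-1.
  have := floor_itv (u * n.+1%:R); rewrite intrD1 -/(r n) => /andP[r1 r2].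
  rewrite distrC ger0_norm; last by rewrite subr_ge0 ler_pdivrMr.
  by rewrite -(ler_pM2r (N0 n)) mulVf ?gt_eqF// mulrBl divfK ?gt_eqF//; lra.
have M_oo : M @ \oo --> \oo.
  apply/cvgnyPge => A.
  have c2 : c / 2 < c by move: (c) c0 => C C0; lra.
  have h1 : \forall n \near \oo, c / 2 < (M n)%:R / n.+1%:R ^+ 2 by apply: (cvgr_gt c).
  apply: filterS2 (nbhs_infty_ger (A%:R / (c / 2) : R)) h1 => n h3 h2.
  have N2 : 0 < n.+1%:R ^+ 2 :> R by rewrite exprn_gt0.
  rewrite -(ler_nat R).
  move: h2; rewrite ltr_pdivlMr// => /ltW; apply: le_trans.
  rewrite -ler_pdivrMl ?divr_gt0// mulrC (le_trans h3)//.
  rewrite -natr1; have : 0 <= n%:R :> R by [].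
  by have := sqr_ge0 (n%:R : R); lra.
have [T [hT hS]] := poisson_limit xi phi c0 M_cvg M_oo r_near hbeta.
exists T; split.
  apply: eq_has_sum hT => z; congr (expR (- _) * _).
  by rewrite /c invrK; ring.
have -> : Num.sqrt (pi * a) = (Num.sqrt c)^-1.
  by rewrite /c sqrtrV ?invrK// mulr_ge0// ltW.
(* Substituting - m for the index turns j + xi and - u j into the m - xi and u m of the
   statement. *)
apply: eq_has_sum (has_sum_reindex (@opprK int) (@opprK int) hS) => m /=.
rewrite mulrNz; congr (expR (- _) * cos (_ * (_ + _))); last by ring.
by rewrite /c; move: (pi) (pi_gt0 R) => p p1; field; rewrite !gt_eqF.
Qed.

(* The constant, common to all [a], is read off at [a = 1], [u = xi = phi = 0],
   where both sides are the same positive sum. *)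
Lemma poisson_dim1 (a u xi phi : R) : 0 < a ->
  exists T, has_sum (fun z : int => expR (- (pi * (a * (z%:~R + u) ^+ 2))) *
                       cos (2 * pi * ((z%:~R + u) * xi + phi))) T /\
    has_sum (fun m : int => expR (- (pi * ((m%:~R - xi) ^+ 2 / a))) *
                       cos (2 * pi * (u * m%:~R + phi))) (Num.sqrt a * T).
Proof.
have [beta hbeta] := poisson_dim1_const.
suff beta1 : Num.sqrt pi * beta = 1.
  move=> a0; have [T [hT hS]] := hbeta a u xi phi a0; exists T; split => //.
  rewrite (_ : _ * T = Num.sqrt (pi * a) * beta * T)//.
  rewrite sqrtrM ?pi_ge0// -[LHS]mul1r -beta1; move: (Num.sqrt pi) => p; ring.
have [T [hT hS]] := hbeta 1 0 0 0 ltr01.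
have ST : Num.sqrt pi * beta * T = T.
  rewrite -[pi]mulr1; apply: has_sum_unique hS _; apply: eq_has_sum hT => z.
  by rewrite addr0 subr0 mul1r divr1 !(mulr0, mul0r, addr0).
(* The term at 0 already contributes 1, which allows [T] to be cancelled. *)
have T0 : 1 <= T.
  apply: le_has_sum (has_sum_delta 0 1) hT.
  move=> z /=; rewrite mulr0 !addr0 mulr0 cos0 mulr1.
  case: eqP => [->|_]; last exact: expR_ge0.
  by rewrite expr0n/= !mulr0 oppr0 expR0.
by apply: (mulIf (x := T)); [rewrite gt_eqF// (lt_le_trans ltr01)|rewrite ST mul1r].
Qed.

End poisson_dim1.

(** * Poisson summation for positive definite forms *)

Section positive_definite.
Variable R : realType.

Definition qform n (G : 'M[R]_n) (v : 'cV[R]_n) : R := (v^T *m G *m v) 0 0.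

Definition posdef n (G : 'M[R]_n) : Prop := G^T = G /\ forall v, v != 0 -> 0 < qform G v.

Lemma qform0 n (G : 'M[R]_n) : qform G 0 = 0.
Proof. by rewrite /qform mulmx0 mxE. Qed.

Lemma qform_ge0 n (G : 'M[R]_n) v : posdef G -> 0 <= qform G v.
Proof. by case=> _ G0; have [->|/G0/ltW//] := eqVneq v 0; rewrite qform0. Qed.

Lemma qform_congr n (P A : 'M[R]_n) v : qform (P^T *m A *m P) v = qform A (P *m v).
Proof. by rewrite /qform trmx_mul !mulmxA. Qed.

Lemma qform_block_diag n (a s : R) (A : 'M[R]_n) (v : 'cV[R]_n) :
  qform (block_mx a%:M 0 0 A : 'M[R]_(1 + n)) (col_mx s%:M v) = a * s ^+ 2 + qform A v.
Proof.
rewrite /qform tr_col_mx mul_row_block !mulmx0 addr0 add0r mul_row_col tr_scalar_mx.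
by rewrite -!scalar_mxM !mxE eqxx mulr1n; congr (_ + _); ring.
Qed.

Lemma dotpE n (v w : 'cV[R]_n) : dotp v w = (v^T *m w) 0 0.
Proof. by rewrite /dotp mxE; apply: eq_bigr => i _; rewrite mxE. Qed.

Lemma dotp_col_mx n (s t : R) (v w : 'cV[R]_n) :
  dotp (col_mx s%:M v : 'cV[R]_(1 + n)) (col_mx t%:M w) = s * t + dotp v w.
Proof.
rewrite !dotpE tr_col_mx mul_row_col mxE; congr (_ + _).
by rewrite tr_scalar_mx -scalar_mxM mxE eqxx mulr1n.
Qed.

Lemma dotpC n (v w : 'cV[R]_n) : dotp v w = dotp w v.
Proof. by apply: eq_bigr => i _; rewrite mulrC. Qed.

Lemma dotpDl n (v w x : 'cV[R]_n) : dotp (v + w) x = dotp v x + dotp w x.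
Proof. by rewrite /dotp -big_split; apply: eq_bigr => i _; rewrite mxE mulrDl. Qed.

Lemma dotpZl n (c : R) (v w : 'cV[R]_n) : dotp (c *: v) w = c * dotp v w.
Proof. by rewrite /dotp mulr_sumr; apply: eq_bigr => i _; rewrite mxE mulrA. Qed.

Lemma dotpDr n (v w x : 'cV[R]_n) : dotp x (v + w) = dotp x v + dotp x w.
Proof. by rewrite dotpC dotpDl (dotpC v) (dotpC w). Qed.

Lemma dotpZr n (c : R) (v w : 'cV[R]_n) : dotp v (c *: w) = c * dotp v w.
Proof. by rewrite dotpC dotpZl dotpC. Qed.

Lemma col_mxE (V : nzRingType) n (v : 'cV[V]_(1 + n)) : v = col_mx (v 0 0)%:M (dsubmx v).
Proof.
rewrite -{1}(vsubmxK v); congr col_mx; rewrite [LHS]mx11_scalar mxE.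
by congr ((v _ _)%:M); apply: val_inj.
Qed.

Section schur_complement.
Variables (n : nat) (G : 'M[R]_(1 + n)).
Hypothesis Gpos : posdef G.

Definition schur_head : R := ulsubmx G 0 0.
Definition schur_col : 'cV[R]_n := dlsubmx G.
Definition schur_compl : 'M[R]_n :=
  drsubmx G - schur_head^-1 *: (schur_col *m schur_col^T).

Local Notation a := schur_head.
Local Notation b := schur_col.
Local Notation S := schur_compl.

Let blockE : G = block_mx a%:M b^T b (drsubmx G).
Proof.
rewrite -{1}(submxK G) -/b; congr block_mx; first by rewrite [LHS]mx11_scalar.
by rewrite /b trmx_dlsub Gpos.1.
Qed.

Lemma schur_head_gt0 : 0 < a.
Proof.
have := Gpos.2 (col_mx 1%:M 0 : 'cV[R]_(1 + n)).
rewrite {1}blockE /qform tr_col_mx mul_row_block trmx0 !mul0mx !addr0 mul_row_col mulmx0 addr0.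
rewrite tr_scalar_mx -!scalar_mxM mxE eqxx mulr1n mul1r mulr1; apply.
apply/eqP => /(congr1 (@usubmx _ 1 n 1)); rewrite col_mxKu linear0.
by move/matrixP/(_ 0 0)/eqP; rewrite !mxE eqxx oner_eq0.
Qed.

Let Q : 'M[R]_(1 + n) := block_mx 1%:M (a^-1 *: b^T) 0 1%:M.
Let Dg : 'M[R]_(1 + n) := block_mx a%:M 0 0 S.

Let an0 : a != 0. Proof. by rewrite gt_eqF// schur_head_gt0. Qed.

Let QT : Q^T = block_mx 1%:M 0 (a^-1 *: b) 1%:M.
Proof. by rewrite /Q tr_block_mx !tr_scalar_mx trmx0 linearZ/= trmxK. Qed.

(** Block LDL^T factorisation; the completed square, the determinant and the inverse form are all
    read from it. *)
Let GE : G = Q^T *m Dg *m Q.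
Proof.
rewrite QT /Dg /Q !mulmx_block !mul1mx !mulmx1 !mulmx0 !mul0mx !addr0 !add0r {1}blockE.
have e1 : a%:M *m (a^-1 *: b^T) = b^T.
  by rewrite mul_scalar_mx scalerA mulfV// scale1r.
have e2 : (a^-1 *: b) *m a%:M = b by rewrite mul_mx_scalar scalerA mulfV// scale1r.
congr block_mx => //.
rewrite e2 -scalemxAr /S [RHS]addrC subrK//.
Qed.

Lemma qform_schur (s : R) (v : 'cV[R]_n) :
  qform G (col_mx s%:M v) = a * (s + dotp v b / a) ^+ 2 + qform S v.
Proof.
rewrite {1}GE qform_congr /Q mul_block_col !mul1mx mul0mx add0r.
rewrite -[X in col_mx X v](_ : (s + dotp v b / a)%:M = _) ?qform_block_diag//.
rewrite dotpC dotpE raddfD/=; congr (_ + _).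
by rewrite -scalemxAl [X in _ *: X]mx11_scalar scale_scalar_mx mulrC.
Qed.

Lemma schur_posdef : posdef S.
Proof.
split.
  rewrite /S linearB/= linearZ/= trmx_mul trmxK; congr (_ - _).
  by rewrite trmx_drsub Gpos.1.
move=> v v0; have := Gpos.2 (col_mx (- (dotp v b / a))%:M v : 'cV[R]_(1 + n)).
rewrite qform_schur addNr expr0n/= mulr0 add0r; apply.
by apply: contra v0 => /eqP/(congr1 (@dsubmx _ 1 n 1)); rewrite col_mxKd linear0 => ->.
Qed.

Lemma det_schur : \det G = a * \det S.
Proof.
rewrite {1}GE !det_mulmx det_tr /Q /Dg !det_ublock !det1 !mul1r mulr1.
by rewrite det_scalar1.
Qed.

Hypothesis Sunit : S \in unitmx.

(** Inverting the factorisation moves the coupling: for [G] the tail shifts the head, for its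
    inverse the head shifts the tail. This exchange is what lets the induction for Poisson summation
    close. *)
Lemma qform_inv_schur (s : R) (v : 'cV[R]_n) :
  qform (invmx G) (col_mx s%:M v) = s ^+ 2 / a + qform (invmx S) (v - (s / a) *: b).
Proof.
pose P : 'M[R]_(1 + n) := block_mx 1%:M 0 (- (a^-1 *: b)) 1%:M.
pose Di : 'M[R]_(1 + n) := block_mx (a^-1)%:M 0 0 (invmx S).
have PQ : Q^T *m P = 1%:M.
  rewrite QT /P mulmx_block !mul1mx !mulmx1 !mulmx0 !addr0 add0r subrr.
  by rewrite mul0mx addr0 -scalar_mx_block.
have QP : Q *m P^T = 1%:M by rewrite -[Q]trmxK -trmx_mul (mulmx1C PQ) trmx1.
have DD : Dg *m Di = 1%:M.
  rewrite /Dg /Di mulmx_block !mulmx0 !mul0mx !addr0 !add0r mulmxV//.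
  by rewrite -scalar_mxM mulfV// -scalar_mx_block.
have GX : G *m (P^T *m Di *m P) = 1%:M.
  rewrite {1}GE !mulmxA -(mulmxA _ Q) QP mulmx1 -(mulmxA _ Dg) DD mulmx1.
  by rewrite -/Q PQ.
have [Gu _] := mulmx1_unit GX.
have -> : invmx G = P^T *m Di *m P by rewrite -[RHS](mulKmx Gu) GX mulmx1.
rewrite qform_congr /P mul_block_col !mul1mx mul0mx addr0.
rewrite mul_mx_scalar scalerN scalerA qform_block_diag mulrC.
by rewrite [- _ + v]addrC.
Qed.

End schur_complement.

Lemma posdef_det_gt0 n (G : 'M[R]_n) : posdef G -> 0 < \det G.
Proof.
elim: n G => [|n IH] G Gpos; first by rewrite det_mx00.
by rewrite (@det_schur n G Gpos) mulr_gt0 ?schur_head_gt0 ?IH//; exact: schur_posdef.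
Qed.

Lemma posdef_unitmx n (G : 'M[R]_n) : posdef G -> G \in unitmx.
Proof. by move=> /posdef_det_gt0 G0; rewrite unitmxE unitfE gt_eqF. Qed.

End positive_definite.

(** * Poisson summation by induction on the dimension *)

Section poisson.
Variable R : realType.

Lemma has_sum_prod_dominated (T U : choiceType) (f p : T -> U -> R) (h : T -> R) H :
  (forall t u, `|f t u| <= p t u) ->
  (forall t, exists2 s, has_sum (p t) s & s <= h t) -> has_sum h H ->
  exists s, has_sum (fun tu => f tu.1 tu.2) s.
Proof.
move=> fp ph hH.
have p0 t u : 0 <= p t u by apply: le_trans (fp t u).
have /choice[g hg] : forall t, exists s, has_sum (p t) s /\ s <= h t.
  by move=> t; have [s] := ph t; exists s.
have [G gG] : exists G, has_sum g G.
  apply: (@ge0_has_sum_dominated _ _ _ h H) => // t.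
  by rewrite (has_sum_ge0 (p0 t) (hg t).1) (hg t).2.
have pG := has_sum_prod_ge0 p0 (fun t => (hg t).1) gG.
by apply: has_sum_dominated pG => -[t u] /=.
Qed.

Lemma has_sum_swap (T U : choiceType) (f : T -> U -> R) s :
  has_sum (fun tu => f tu.1 tu.2) s -> has_sum (fun ut => f ut.2 ut.1) s.
Proof.
pose sw (T U : Type) (x : T * U) := (x.2, x.1).
move=> fs; apply: eq_has_sum (has_sum_reindex (h := @sw U T) (k := @sw T U) _ _ fs).
- by case.
- by case.
- by case.
Qed.

Definition ivec n (z : 'cV[int]_n) : 'cV[R]_n := map_mx intr z.

Lemma ivec0 n : ivec (0 : 'cV_n) = 0.
Proof. exact: map_mx0. Qed.

Definition icons n (z : int * 'cV[int]_n) : 'cV[int]_n.+1 :=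
  col_mx z.1%:M z.2 : 'cV_(1 + n).

Definition iuncons n (z : 'cV[int]_n.+1) : int * 'cV[int]_n :=
  (z 0 0, @dsubmx _ 1 n 1 z).

Lemma iconsK n : cancel (@icons n) (@iuncons n).
Proof.
move=> [m z]; rewrite /iuncons /icons /= col_mxKd; congr (_, _).
transitivity (col_mx m%:M z (lshift n (0 : 'I_1)) 0); last by rewrite col_mxEu mxE.
by congr (col_mx _ _ _ _); exact: val_inj.
Qed.

Lemma iunconsK n : cancel (@iuncons n) (@icons n).
Proof.
by move=> z; rewrite [RHS]col_mxE.
Qed.

Lemma ivec_icons n m (z : 'cV[int]_n) :
  ivec (icons (m, z)) = col_mx (m%:~R)%:M (ivec z) :> 'cV[R]_(1 + n).
Proof. by rewrite /ivec /icons (@map_col_mx _ _ _ 1 n 1) map_scalar_mx. Qed.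

(** For a fixed tail the first coordinate is transformed by [poisson_dim1]. The shift caused by the
    coupling becomes a phase linear in the tail, that is, a frequency for the tail sum, to which the
    induction hypothesis for the Schur complement applies after exchanging the order of
    summation. *)
Lemma poisson_summation n (G : 'M[R]_n) : posdef G ->
  forall (x xi : 'cV[R]_n) (phi : R), exists T,
    has_sum (fun z => expR (- (pi * qform G (ivec z + x))) *
              cos (2 * pi * (dotp (ivec z + x) xi + phi))) T /\
    has_sum (fun m => expR (- (pi * qform (invmx G) (ivec m - xi))) *
              cos (2 * pi * (dotp x (ivec m) + phi))) (Num.sqrt (\det G) * T).
Proof.
elim: n G => [|n IH] G Gpos x xi phi.
  exists (cos (2 * pi * phi)); rewrite det_mx00 sqrtr1 mul1r.
  have qf0 (A : 'M[R]_0) v : qform A v = 0 by rewrite [v]flatmx0 qform0.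
  have dot0 (v w : 'cV[R]_0) : dotp v w = 0 by rewrite /dotp big_ord0.
  by split; [have := @has_sum1 R 'cV[int]_0 0 (fun z => expR (- (pi * qform G (ivec z + x))) *
              cos (2 * pi * (dotp (ivec z + x) xi + phi)))|
    have := @has_sum1 R 'cV[int]_0 0 (fun m => expR (- (pi * qform (invmx G) (ivec m - xi))) *
              cos (2 * pi * (dotp x (ivec m) + phi)))];
    rewrite qf0 dot0 mulr0 oppr0 expR0 add0r mul1r; apply;
    move=> z; rewrite [z]flatmx0 eqxx.
change 'M[R]_(1 + n) in (type of G).
pose a := schur_head G; pose b := schur_col G; pose S := schur_compl G.
have a0 : 0 < a := schur_head_gt0 Gpos.
have Spos : posdef S := schur_posdef Gpos.
have Sunit := posdef_unitmx Spos.
pose x1 := x 0 0; pose x' : 'cV[R]_n := @dsubmx _ 1 n 1 x.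
pose xi1 := xi 0 0; pose xi' : 'cV[R]_n := @dsubmx _ 1 n 1 xi.
have xE : x = col_mx x1%:M x' := col_mxE x.
have xiE : xi = col_mx xi1%:M xi' := col_mxE xi.
(* [F] is the original summand split along the first coordinate, [F2] its transform in that
   coordinate, and [F3] the transform of [F2] in the remaining ones. *)
pose u (z' : 'cV[int]_n) := x1 + dotp (ivec z' + x') b / a.
pose eS (z' : 'cV[int]_n) := expR (- (pi * qform S (ivec z' + x'))).
pose phi' (z' : 'cV[int]_n) := phi + dotp (ivec z' + x') (xi' - (xi1 / a) *: b).
pose F z' (z1 : int) := eS z' * (expR (- (pi * (a * (z1%:~R + u z') ^+ 2))) *
  cos (2 * pi * ((z1%:~R + u z') * xi1 + phi' z'))).
pose g1 (m1 : int) := expR (- (pi * ((m1%:~R - xi1) ^+ 2 / a))).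
pose F2 z' (m1 : int) := eS z' * (g1 m1 * cos (2 * pi * (u z' * m1%:~R + phi' z'))).
pose xi2 (m1 : int) := xi' + ((m1%:~R - xi1) / a) *: b.
pose eSi (m1 : int) (m' : 'cV[int]_n) := expR (- (pi * qform (invmx S) (ivec m' - xi2 m1))).
pose F3 m1 m' := g1 m1 * (eSi m1 m' * cos (2 * pi * (dotp x' (ivec m') + (phi + x1 * m1%:~R)))).
have FE z1 z' : expR (- (pi * qform G (ivec (icons (z1, z')) + x))) *
    cos (2 * pi * (dotp (ivec (icons (z1, z')) + x) xi + phi)) = F z' z1.
  rewrite ivec_icons xE (@add_col_mx _ 1 n 1) -raddfD/= (qform_schur Gpos) -/a -/b -/S.
  rewrite {1}xiE dotp_col_mx /F /eS mulrDr opprD expRD [expR _ * expR _]mulrC -[LHS]mulrA.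
  congr (_ * (expR (- (_ * (_ * _ ^+ 2))) * cos (_ * _))); first by rewrite /u addrA.
  by rewrite /phi' /u dotpDr -scaleNr dotpZr; field; exact: lt0r_neq0.
have F3E m1 m' : expR (- (pi * qform (invmx G) (ivec (icons (m1, m')) - xi))) *
    cos (2 * pi * (dotp x (ivec (icons (m1, m'))) + phi)) = F3 m1 m'.
  rewrite ivec_icons xE xiE (@opp_col_mx _ 1 n 1) (@add_col_mx _ 1 n 1) -raddfB/= (qform_inv_schur Gpos Sunit) -/a -/b -/S.
  rewrite dotp_col_mx /F3 /g1 /eSi mulrDr opprD expRD -[LHS]mulrA.
  have -> : ivec m' - xi2 m1 = ivec m' - xi' - ((m1%:~R - xi1) / a) *: b.
    by rewrite /xi2 opprD addrA.
  by rewrite [phi + _]addrC addrA [dotp _ _ + _]addrC.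
have p0 := pi_gt0 R.
have paE v : pi / a * v = pi * (v / a) by rewrite mulrAC -mulrA.
have cos00 (w : R) : w = 0 -> cos (2 * pi * w) = 1 by move=> ->; rewrite mulr0 cos0.
have gaussS y : exists K, has_sum (fun z : 'cV[int]_n => expR (- (pi * qform S (ivec z + y)))) K.
  have [K [hK _]] := IH S Spos y 0 0; exists K; apply: eq_has_sum hK => z.
  by rewrite cos00 ?mulr1// dotpC /dotp big1 ?addr0// => i _; rewrite mxE mul0r.
have [KS hKS] : exists K, has_sum eS K := gaussS x'.
have [K0 hK0] := gaussS 0.
have [H0 hH0] : exists H, has_sum (fun m : int => expR (- (pi / a * (m%:~R + 0) ^+ 2))) H.
  by apply: has_sum_gauss_int; rewrite divr_gt0.
have [H1 hH1] : exists H, has_sum g1 H.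
  have pa0 : 0 < pi / a by rewrite divr_gt0.
  have [H hH] := has_sum_gauss_int (- xi1) pa0.
  by exists H; apply: eq_has_sum hH => m; rewrite /g1 paE.
have sa0 : 0 < Num.sqrt a by rewrite sqrtr_gt0.
have sd0 : 0 <= Num.sqrt (\det S) by rewrite sqrtr_ge0.
have eS0 z' : 0 <= eS z' by rewrite expR_ge0.
have g10 m1 : 0 <= g1 m1 by rewrite expR_ge0.
(* A bound uniform in the shift: on the dual side the shift enters only through a cosine, which is
   at most 1. *)
have dim1_bounded v : exists2 t, has_sum (fun z1 : int => expR (- (pi * (a * (z1%:~R + v) ^+ 2)))) t &
    t <= H0 / Num.sqrt a.
  have [t [ht1 ht2]] := poisson_dim1 v 0 0 a0.
  exists t; first by apply: eq_has_sum ht1 => z; rewrite cos00 ?mulr1// mulr0 addr0.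
  rewrite ler_pdivlMr// mulrC; apply: le_has_sum ht2 hH0 => m.
  by rewrite subr0 !addr0 paE ler_piMr ?expR_ge0 ?cos_le1.
have norm_cos (e w : R) : 0 <= e -> `|e * cos w| <= e.
  by move=> e0; rewrite normrM (ger0_norm e0) ler_piMr// cos_max.
have /choice[t ht] z' := poisson_dim1 (u z') xi1 (phi' z') a0.
have [T hT] : exists T, has_sum (fun x => F x.1 x.2) T.
  apply: (@has_sum_prod_dominated _ _ _
    (fun z' (z1 : int) => eS z' * expR (- (pi * (a * (z1%:~R + u z') ^+ 2))))
    (fun z' => H0 / Num.sqrt a * eS z') (H0 / Num.sqrt a * KS)).
  - by move=> z' z1; rewrite /F mulrA norm_cos// mulr_ge0// expR_ge0.
  - move=> z'; have [s hs sle] := dim1_bounded (u z').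
    exists (eS z' * s); first exact: has_sumZ.
    by rewrite mulrC ler_wpM2r.
  - exact: has_sumZ.
have [T2 hT2] : exists T2, has_sum (fun x => F2 x.1 x.2) T2.
  apply: (@has_sum_prod_dominated _ _ _
    (fun z' (m1 : int) => eS z' * g1 m1) (fun z' => H1 * eS z') (H1 * KS)).
  - by move=> z' m1; rewrite /F2 mulrA norm_cos// mulr_ge0.
  - by move=> z'; exists (eS z' * H1); [exact: has_sumZ|rewrite mulrC].
  - exact: has_sumZ.
have T2E : T2 = Num.sqrt a * T.
  have h1 := has_sum_fubini hT (fun z' => has_sumZ (eS z') (ht z').1).
  have h2 := has_sum_fubini hT2 (fun z' => has_sumZ (eS z') (ht z').2).
  apply: has_sum_unique h2 _; apply: eq_has_sum (has_sumZ (Num.sqrt a) h1) => z'.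
  by ring.
have /choice[t' ht'] (m1 : int) := IH S Spos x' (xi2 m1) (phi + x1 * m1%:~R).
have hF2m1 m1 : has_sum (fun z' => F2 z' m1) (g1 m1 * t' m1).
  apply: eq_has_sum (has_sumZ (g1 m1) (ht' m1).1) => z'.
  rewrite /F2 /eS mulrCA; congr (_ * (_ * cos (_ * _))).
  rewrite /xi2 /u /phi' !dotpDr -scaleNr !dotpZr.
  by field; exact: lt0r_neq0.
have [T3 hT3] : exists T3, has_sum (fun x => F3 x.1 x.2) T3.
  apply: (@has_sum_prod_dominated _ _ _
    (fun m1 m' => g1 m1 * eSi m1 m') (fun m1 => Num.sqrt (\det S) * K0 * g1 m1)
    (Num.sqrt (\det S) * K0 * H1)).
  - by move=> m1 m'; rewrite /F3 mulrA norm_cos// mulr_ge0// expR_ge0.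
  (* Same principle in dimension [n]: the shifted sum for the inverse form is bounded, uniformly in
     the shift, by the sum for [S] with its cosines replaced by 1. *)
  - move=> m1; have [s [hs1 hs2]] := IH S Spos 0 (xi2 m1) 0.
    exists (g1 m1 * (Num.sqrt (\det S) * s)).
      apply: has_sumZ; apply: eq_has_sum hs2 => m'.
      by rewrite cos00 ?mulr1// /dotp big1 ?addr0// => i _; rewrite mxE mul0r.
    rewrite mulrC ler_wpM2r// ler_wpM2l//; apply: le_has_sum hs1 hK0 => z'.
    by rewrite ler_piMr ?expR_ge0 ?cos_le1.
  - exact: has_sumZ.
have T3E : T3 = Num.sqrt (\det S) * T2.
  have h2 := has_sum_fubini (has_sum_swap hT2) hF2m1.
  have h3 := has_sum_fubini hT3 (fun m1 => has_sumZ (g1 m1) (ht' m1).2).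
  apply: has_sum_unique h3 _; apply: eq_has_sum (has_sumZ (Num.sqrt (\det S)) h2) => m1.
  by rewrite mulrCA.
exists T; split.
  apply: eq_has_sum (has_sum_reindex (@iunconsK n) (@iconsK n) (has_sum_swap hT)) => z.
  by rewrite /= -FE -/(icons (iuncons z)) iunconsK.
have -> : Num.sqrt (\det G) * T = T3.
  by rewrite T3E T2E (det_schur Gpos) sqrtrM ?(ltW a0)// mulrA [_ * Num.sqrt a]mulrC.
apply: eq_has_sum (has_sum_reindex (@iunconsK n) (@iconsK n) hT3) => z.
by rewrite /= -F3E -/(icons (iuncons z)) iunconsK.
Qed.

End poisson.

(** * Theta series and the smoothing parameter *)

Section lattice_theta.
Variables (R : realType) (n : nat) (B : 'M[R]_n).
Hypothesis Bunit : B \in unitmx.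

Let Gram : 'M[R]_n := B^T *m B.

Lemma dotp0 m (v : 'cV[R]_m) : dotp v 0 = 0.
Proof. by rewrite /dotp big1// => i _; rewrite [X in _ * X]mxE mulr0. Qed.

Lemma norm2_sqr m (x : 'cV[R]_m) : norm2 x ^+ 2 = dotp x x.
Proof. by rewrite sqr_sqrtr// sumr_ge0// => i _; rewrite -expr2 sqr_ge0. Qed.

Lemma norm2_ge0 m (x : 'cV[R]_m) : 0 <= norm2 x.
Proof. exact: sqrtr_ge0. Qed.

Lemma dotp_gt0 m (x : 'cV[R]_m) : x != 0 -> 0 < dotp x x.
Proof.
move=> x0; rewrite lt_def sumr_ge0 ?andbT => [|i _]; last by rewrite -expr2 sqr_ge0.
apply: contra x0; rewrite psumr_eq0 => [|i _]; last by rewrite -expr2 sqr_ge0.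
move=> /allP h; apply/eqP/colP => i; rewrite [RHS]mxE.
have := h i (mem_index_enum i); rewrite implyTb -expr2 sqrf_eq0.
by move=> /eqP.
Qed.

Lemma qform_gram v : qform Gram v = dotp (B *m v) (B *m v).
Proof. by rewrite /qform dotpE trmx_mul !mulmxA. Qed.

Lemma gram_posdef : posdef Gram.
Proof.
split; first by rewrite trmx_mul trmxK.
move=> v v0; rewrite qform_gram dotp_gt0//.
by apply: contra v0 => /eqP Bv; rewrite -(mulKmx Bunit v) Bv mulmx0.
Qed.

Lemma posdefZ m (A : 'M[R]_m) c : 0 < c -> posdef A -> posdef (c *: A).
Proof.
move=> c0 [AT A0]; split; first by rewrite linearZ/= AT.
move=> v /A0 Av; rewrite /qform -scalemxAr -scalemxAl mxE mulr_gt0//.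
Qed.

Lemma qformZ m (A : 'M[R]_m) c v : qform (c *: A) v = c * qform A v.
Proof. by rewrite /qform -scalemxAr -scalemxAl mxE. Qed.

Lemma posdef_inv m (A : 'M[R]_m) : posdef A -> posdef (invmx A).
Proof.
move=> Apos; have Au := posdef_unitmx Apos; split; first by rewrite trmx_inv Apos.1.
move=> v v0; rewrite -(mulKVmx Au v).
have -> : qform (invmx A) (A *m (invmx A *m v)) = qform A (invmx A *m v).
  by rewrite -qform_congr Apos.1 mulmxV// mul1mx.
apply: Apos.2; apply: contra v0 => /eqP h.
by rewrite -(mulKVmx Au v) h mulmx0.
Qed.

Lemma dual_gram_posdef : posdef (invmx Gram).
Proof. exact: posdef_inv gram_posdef. Qed.

Lemma ivec_inj m : injective (@ivec R m).
Proof.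
by move=> z w /matrixP zw; apply/matrixP => i j; have := zw i j; rewrite !mxE => /intr_inj.
Qed.

Lemma esum_coset (h : 'cV[R]_n -> \bar R) (x : 'cV[R]_n) :
  (\esum_(y in [set (u + x)%R | u in lattice B]) h y =
   \esum_(z in [set: 'cV[int]_n]) h (B *m ivec R z + x)%R)%E.
Proof.
apply: (@reindex_esum R _ _ _ _ (fun z => B *m ivec R z + x)); split.
- by move=> z _; exists (B *m ivec R z) => //; exists z.
- move=> z w _ _ /addIr /(congr1 (mulmx (invmx B))).
  by rewrite !mulKmx// => /ivec_inj.
- by move=> _ [_ [z _ <-] <-]; exists z.
Qed.

(** Pairing with the columns of [B] reads off the coordinates of [B^T *m y], which must be integers;
    conversely an integral combination pairs integrally. *)
Lemma dual_latticeE : dual_lattice (lattice B) =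
  [set invmx B^T *m ivec R z | z in [set: 'cV[int]_n]].
Proof.
have BTu : B^T \in unitmx by rewrite unitmx_tr.
have dotpB w y : dotp (B *m w) y = dotp w (B^T *m y) by rewrite !dotpE trmx_mul mulmxA.
apply/seteqP; split => [y yd|_ [z _ <-] _ [w _ <-]]; last first.
  by rewrite dotpB mulKVmx// /dotp rpred_sum// => i _; rewrite !mxE rpredM// intr_int.
have yi i : (B^T *m y) i 0 \is a Num.int.
  have := yd (B *m ivec R (delta_mx i 0)) (ex_intro2 _ _ _ I erefl).
  rewrite dotpB; move: (B^T *m y) => v; rewrite /dotp (bigD1 i)//= big1; last first.
    by move=> j /negbTE ji; rewrite !mxE ji mul0r.
  by rewrite !mxE !eqxx mul1r addr0.
exists (\col_i Num.floor ((B^T *m y) i 0)) => //.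
rewrite -[RHS](mulKmx BTu); congr (_ *m _).
move: (B^T *m y) yi => v vi; apply/colP => i.
by rewrite !mxE; apply/eqP; rewrite -intrEfloor.
Qed.

Lemma esum_dual (h : 'cV[R]_n -> \bar R) :
  (\esum_(y in dual_lattice (lattice B)) h y =
   \esum_(z in [set: 'cV[int]_n]) h (invmx B^T *m ivec R z)%R)%E.
Proof.
have BTu : B^T \in unitmx by rewrite unitmx_tr.
rewrite dual_latticeE; apply: (@reindex_esum R _ _ _ _ (fun z => invmx B^T *m ivec R z)); split.
- by move=> z _; exists z.
- move=> z w _ _ /(congr1 (mulmx B^T)).
  by rewrite !mulKVmx// => /ivec_inj.
- by move=> _ [z _ <-]; exists z.
Qed.

Lemma norm2_dual (v : 'cV[R]_n) : norm2 (invmx B^T *m v) ^+ 2 = qform (invmx Gram) v.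
Proof.
have BTu : B^T \in unitmx by rewrite unitmx_tr.
have -> : invmx Gram = (invmx B^T)^T *m 1%:M *m invmx B^T.
  have Gu : Gram \in unitmx by rewrite unitmx_mul BTu.
  have h : Gram *m ((invmx B^T)^T *m 1%:M *m invmx B^T) = 1%:M.
    rewrite mulmx1 trmx_inv trmxK /Gram !mulmxA mulmxK//.
    by rewrite mulmxV.
  by rewrite -[RHS](mulKmx Gu) h mulmx1.
by rewrite qform_congr norm2_sqr dotpE /qform mulmx1.
Qed.

Definition dual_theta_term (t : R) (m : 'cV[int]_n) : R :=
  expR (- (pi * (t * qform (invmx Gram) (ivec R m)))).

Lemma dual_theta_term0 t : dual_theta_term t 0 = 1.
Proof. by rewrite /dual_theta_term ivec0 qform0 !mulr0 oppr0 expR0. Qed.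

Lemma ivec_eq0 m (z : 'cV[int]_m) : (ivec R z == 0) = (z == 0).
Proof. by rewrite -[X in _ == X](@ivec0 R) (inj_eq (@ivec_inj m)). Qed.

Lemma dual_qform_gt0 m : m != 0 -> 0 < qform (invmx Gram) (ivec R m).
Proof. by rewrite -ivec_eq0 => /dual_gram_posdef.2. Qed.

Lemma dual_qform_ge0 m : 0 <= qform (invmx Gram) (ivec R m).
Proof. exact: qform_ge0 dual_gram_posdef. Qed.

Lemma has_sum_dual_theta t : 0 < t -> exists D, has_sum (dual_theta_term t) D.
Proof.
move=> t0; have := poisson_summation (posdefZ t0 dual_gram_posdef) 0 0 0.
move=> [D [hD _]]; exists D; apply: eq_has_sum hD => m.
by rewrite addr0 qformZ dotp0 addr0 mulr0 cos0 mulr1.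
Qed.

Lemma coset_exponent t x (z : 'cV[R]_n) :
  pi * qform (t^-1 *: Gram) (z + invmx B *m x) = pi * norm2 (B *m z + x) ^+ 2 / t.
Proof.
rewrite qformZ qform_gram norm2_sqr mulmxDr mulKVmx//.
by rewrite mulrCA mulrC.
Qed.

Lemma powR_half_dim (t : R) (m : nat) : 0 < t -> t `^ (- (m%:R / 2)) = Num.sqrt (t^-1 ^+ m).
Proof.
move=> t0; apply/eqP.
rewrite -(@eqrXn2 _ 2) ?powR_ge0 ?sqrtr_ge0// sqr_sqrtr ?exprn_ge0 ?invr_ge0 ?(ltW t0)//.
rewrite -[eqbLHS]powR_mulrn ?powR_ge0// -powRrM -mulNr divfK// powRN powR_mulrn ?(ltW t0)//.
by rewrite exprVn.
Qed.

Lemma torus_heat_has_sum t x : 0 < t ->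
  has_sum (fun z => t `^ (- (n%:R / 2)) *
      expR (- (pi * norm2 (B *m ivec R z + x) ^+ 2 / t))) (torus_heat (lattice B) t x).
Proof.
move=> t0; have ti0 : 0 < t^-1 by rewrite invr_gt0.
have [F [hF _]] := poisson_summation (posdefZ ti0 gram_posdef) (invmx B *m x) 0 0.
have hF' : has_sum (fun z => expR (- (pi * norm2 (B *m ivec R z + x) ^+ 2 / t))) F.
  by apply: eq_has_sum hF => z; rewrite addr0 dotp0 mulr0 cos0 mulr1 coset_exponent.
have /(has_sum_ge0P _ (fun z => expR_ge0 _)) FE := hF'.
by rewrite /torus_heat esum_coset FE; exact: has_sumZ.
Qed.

(** Poisson summation for the form [t^-1 *: Gram] with shift [invmx B *m x]. The square root of its
    determinant is exactly [lattice_det B] times the heat normalisation, so no prefactor remains. *)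
Lemma torus_heat_poisson t x : 0 < t ->
  has_sum (fun m => dual_theta_term t m * cos (2 * pi * dotp (invmx B *m x) (ivec R m)))
    (lattice_det B * torus_heat (lattice B) t x).
Proof.
move=> t0; have ti0 : 0 < t^-1 by rewrite invr_gt0.
have tn0 : t != 0 by rewrite gt_eqF.
have [F [hF1 hF2]] := poisson_summation (posdefZ ti0 gram_posdef) (invmx B *m x) 0 0.
have FE : torus_heat (lattice B) t x = t `^ (- (n%:R / 2)) * F.
  apply: has_sum_unique (torus_heat_has_sum x t0) _; apply: has_sumZ.
  by apply: eq_has_sum hF1 => z; rewrite addr0 dotp0 mulr0 cos0 mulr1 coset_exponent.
rewrite FE mulrA.
have -> : lattice_det B * t `^ (- (n%:R / 2)) = Num.sqrt (\det (t^-1 *: Gram)).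
  rewrite detZ det_mulmx det_tr -expr2 sqrtrM ?exprn_ge0 ?(ltW ti0)// sqrtr_sqr mulrC.
  by rewrite powR_half_dim.
apply: eq_has_sum hF2 => m; rewrite subr0 addr0 invmxZ; last exact: posdef_unitmx (posdefZ ti0 gram_posdef).
by rewrite invrK qformZ.
Qed.

Lemma heat_deviation t x D : 0 < t -> has_sum (dual_theta_term t) D ->
  `|lattice_det B * torus_heat (lattice B) t x - 1| <= D - 1.
Proof.
move=> t0 hD.
have h1 := has_sum_delta (0 : 'cV[int]_n) (1 : R).
apply: le_norm_has_sum (has_sumB (torus_heat_poisson x t0) h1) (has_sumB hD h1) => m /=.
case: eqP => [->|_].
  by rewrite dual_theta_term0 ivec0 dotp0 mulr0 cos0 mulr1 !subrr normr0.
by rewrite !subr0 normrM ger0_norm ?expR_ge0// ler_piMr ?expR_ge0 ?cos_max.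
Qed.

End lattice_theta.

(** * The dual theta series at the smoothing parameter *)

Section smoothing.
Variables (R : realType) (n : nat) (B : 'M[R]_n).
Hypothesis n0 : (0 < n)%N.
Hypothesis Bunit : B \in unitmx.

Local Notation theta := (dual_theta_term B).
Local Notation q m := (qform (invmx (B^T *m B)) (ivec R m)).

(** Only the terms at 0 and [m] are kept. For total 3/2 this makes every term with [m] nonzero at
    most 1/2. *)
Lemma dual_theta_ge2 t D m : has_sum (theta t) D -> m != 0 -> 1 + theta t m <= D.
Proof.
move=> hD m0.
have h12 := has_sumD (has_sum_delta (0 : 'cV[int]_n) (1 : R)) (has_sum_delta m (theta t m)).
apply: le_has_sum h12 hD => z /=.
have [->|z0] := eqVneq z 0.
  by rewrite eq_sym (negbTE m0) addr0 dual_theta_term0.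
by case: eqP => [->|_]; rewrite add0r// expR_ge0.
Qed.

Lemma dual_theta_dominated t0 t m : t0 <= t -> `|theta t m| <= theta t0 m.
Proof.
move=> tt0; rewrite ger0_norm ?expR_ge0// ler_expR lerN2 ler_wpM2l ?pi_ge0//.
by rewrite ler_wpM2r// dual_qform_ge0.
Qed.

(** Near [t] all arguments exceed t / 2, and the series at t / 2 is a common majorant. *)
Lemma continuous_dual_theta (D : R -> R) : (forall t : R, 0 < t -> has_sum (theta t) (D t)) ->
  forall t : R, 0 < t -> {for t, continuous D}.
Proof.
move=> hD t t0; have t20 : 0 < t / 2 by rewrite divr_gt0.
have ht2 : \forall s \near t, t / 2 < s.
  by apply: lt_nbhsr; lra.
have dom : \forall s \near t, forall m, `|theta s m| <= theta (t / 2) m.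
  by apply: filterS ht2 => s /ltW ts m; exact: dual_theta_dominated.
have ptw m : theta ^~ m @ t --> theta t m.
  apply: continuous_cvg; [exact: continuous_expR|apply: cvgN].
  apply: cvgM; first exact: cvg_cst.
  by apply: cvgM; [exact: cvg_id|exact: cvg_cst].
have sum : \forall s \near t, has_sum (theta s) (D s).
  by apply: filterS ht2 => s ts; apply: hD; exact: lt_trans ts.
have [S hS DS] := has_sum_tannery (nbhs_pfilter (t : R^o)) (hD _ t20) dom ptw sum.
by rewrite (has_sum_unique hS (hD t t0)) in DS; exact: DS.
Qed.

(** Intermediate value theorem between a small argument, where one basis vector alone contributes
    1/2, and large arguments, where only the zero vector survives. *)
Lemma dual_theta_half : exists2 t, 0 < t & has_sum (theta t) (3 / 2).
Proof.
have /choice[D hD] : forall t, exists d, 0 < t -> has_sum (theta t) d.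
  move=> t; have [t0|t0] := ltP 0 t; last by exists 0.
  by have [d hd] := has_sum_dual_theta Bunit t0; exists d.
have p0 := pi_gt0 R.
pose m1 : 'cV[int]_n := delta_mx (Ordinal n0) 0.
have m10 : m1 != 0.
  by apply/eqP => /matrixP/(_ (Ordinal n0) 0)/eqP; rewrite !mxE !eqxx.
have q1 := dual_qform_gt0 Bunit m10.
(* Makes the term at [m1] equal to exp(- 1/2) >= 1/2. *)
pose t1 : R := (2 * pi * q m1)^-1.
have t10 : 0 < t1 by rewrite invr_gt0 !mulr_gt0.
have D1 : 3 / 2 <= D t1.
  apply: le_trans (dual_theta_ge2 (hD _ t10) m10).
  rewrite /dual_theta_term (_ : pi * (t1 * q m1) = 1 / 2).
    by have := expR_ge1Dx (- (1 / 2) : R); lra.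
  by rewrite /t1; move: (pi) (q m1) p0 q1 => p k p0 k0; field; rewrite !gt_eqF.
have [t2 t12 D2] : exists2 t2, t1 <= t2 & D t2 < 3 / 2.
  have dom : \forall k \near \oo, forall m, `|theta k.+1%:R m| <= theta 1 m.
    by apply: nearW => k m; apply: dual_theta_dominated; rewrite ler1n.
  have ptw m : (fun k => theta k.+1%:R m) @ \oo --> (if m == 0 then 1 else 0 : R).
    case: eqP => [->|/eqP m0].
      by under eq_cvg do rewrite dual_theta_term0; exact: cvg_cst.
    have qm := dual_qform_gt0 Bunit m0.
    apply: (@squeeze_cvgr _ \oo _ _ (cst 0) (fun k : nat => (pi * q m)^-1 * k.+1%:R^-1)).
    - apply: nearW => k; rewrite /cst expR_ge0/= /dual_theta_term expRN -invfM.
      rewrite lef_pV2 ?posrE ?expR_gt0 ?mulr_gt0//.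
      by apply: le_trans (expR_ge1Dx _); rewrite mulrAC mulrA; lra.
    - exact: cvg_cst.
    - by rewrite -(mulr0 (pi * q m)^-1); apply: cvgM; [exact: cvg_cst|exact: cvg_harmonic].
  have sum : \forall k \near \oo, has_sum (theta k.+1%:R) (D k.+1%:R).
    by apply: nearW => k; apply: hD.
  have [S hS DS] := has_sum_tannery (@eventually_filter) (hD _ ltr01) dom ptw sum.
  have S1 : S = 1 := has_sum_unique hS (has_sum_delta 0 1).
  have lt32 : \forall k \near \oo, D k.+1%:R < 3 / 2 by apply: (cvgr_lt S) => //; rewrite S1; lra.
  have [k [k1 k2]] := filter_ex (filterI (nbhs_infty_ger t1) lt32).
  by exists k.+1%:R => //; apply: le_trans k1 _; rewrite ler_nat.
have [||c /itvP ct Dc] := @IVT R D t1 t2 (3 / 2) t12.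
- apply: continuous_in_subspaceT => x /set_mem; rewrite /= in_itv/= => /andP[x1 _].
  by apply: (continuous_dual_theta hD); exact: lt_le_trans x1.
- by rewrite ge_min le_max D1 (ltW D2) orbT.
have c0 : 0 < c by apply: lt_le_trans t10 _; rewrite ct.
by exists c => //; rewrite -Dc; exact: hD.
Qed.

(** [xget] returns a solution as soon as one exists; [dual_theta_half] supplies one as a square
    root. *)
Lemma smoothing_parameterP :
  0 < smoothing_parameter (lattice B) /\
  has_sum (theta (smoothing_parameter (lattice B) ^+ 2)) (3 / 2).
Proof.
have sumE s : (\esum_(y in dual_lattice (lattice B)) (expR (- (pi * s ^+ 2 * norm2 y ^+ 2)))%:E
    = \esum_(m in setT) (theta (s ^+ 2) m)%:E)%E.
  rewrite esum_dual//; apply: eq_esum => m _.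
  by rewrite norm2_dual// /dual_theta_term mulrA.
have th0 s m : 0 <= theta s m by exact: expR_ge0.
rewrite /smoothing_parameter; case: xgetP => [s _ [s0 sE]|none].
  by split => //; apply/has_sum_ge0P => //; rewrite -sumE.
have [t t0 ht] := dual_theta_half.
exfalso; apply: (none (Num.sqrt t)); split; first by rewrite sqrtr_gt0.
by rewrite sumE sqr_sqrtr ?ltW//; apply/has_sum_ge0P.
Qed.

(** For e <= 1/2 one has e^3 <= e / 4, and the nonzero terms at the smoothing parameter add up to
    3/2 - 1 = 1/2. *)
Lemma dual_theta_smoothing (D : R) (s := smoothing_parameter (lattice B)) :
  has_sum (theta (3 * s ^+ 2)) D -> D - 1 <= 1 / 8.
Proof.
move=> hD; have [s0 hs] := smoothing_parameterP.
have h1 := has_sum_delta (0 : 'cV[int]_n) (1 : R).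
have := has_sumZ (1 / 4) (has_sumB hs h1).
have -> : 1 / 4 * (3 / 2 - 1) = 1 / 8 :> R by field.
apply: (le_has_sum _ (has_sumB hD h1)) => m /=.
case: eqP => [->|/eqP m0]; first by rewrite !dual_theta_term0 subrr mulr0.
rewrite !subr0; have := dual_theta_ge2 hs m0.
have -> : theta (3 * s ^+ 2) m = theta (s ^+ 2) m ^+ 3.
  by rewrite /dual_theta_term -expRM_natl; congr expR; ring.
have : 0 < theta (s ^+ 2) m by exact: expR_gt0.
rewrite -/s; move: (theta _ m) => e e0 e2.
have e1 : e <= 1 / 2 by lra.
rewrite exprSr mulrC [leRHS]mulrC ler_wpM2l ?(ltW e0)//.
by nra.
Qed.

End smoothing.

(** * Integration over columns *)

Section lebesgue_line.
Variable R : realType.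
Local Notation mu := (@lebesgue_measure R).
Local Notation RM := (measurableTypeR R).
Local Open Scope ereal_scope.

Lemma lebesgue_measure_shift (c : R) (A : set RM) : measurable A ->
  pushforward mu ((fun x => x + c)%R : RM -> RM) A = mu A.
Proof.
have mc : measurable_fun [set: RM] ((fun x => x + c)%R : RM -> RM).
  exact: measurable_funD.
move=> mA; apply/esym; pose m := measure_function_pushforward__canonical__measure_function_Measure
    mu mc.
apply: (@lebesgue_measure_unique R m) mA => _ [[a b]] _ <-.
rewrite /m/= /pushforward (_ : _ @^-1` _ = `](a - c)%R, (b - c)%R]%classic); last first.
  by apply/seteqP; split => x /=; rewrite !in_itv/= ltrBlDr lerBrDr.
by rewrite !lebesgue_measure_itv/= !lte_fin ltrD2r -!EFinB; case: ifPn => // _; congr (_%:E); lra.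
Qed.

Lemma ge0_integral_shift (c : R) (f : RM -> \bar R) : measurable_fun setT f ->
  (forall x, 0 <= f x) -> \int[mu]_x f (x + c)%R = \int[mu]_x f x.
Proof.
move=> mf f0; have mc : measurable_fun [set: RM] ((fun x => x + c)%R : RM -> RM).
  exact: measurable_funD.
rewrite -[LHS](@ge0_integral_pushforward _ _ _ _ R _ mc mu setT f)//.
by apply: eq_measure_integral => A mA _; exact: lebesgue_measure_shift.
Qed.

Lemma ge0_integral_oppr (f : RM -> \bar R) : measurable_fun setT f ->
  (forall x, 0 <= f x) -> \int[mu]_x f (- x)%R = \int[mu]_x f x.
Proof.
move=> mf f0; have mo : measurable_fun [set: RM] ((fun x => - x)%R : RM -> RM).
  exact: measurable_funN.
rewrite -[LHS](@ge0_integral_pushforward _ _ _ _ R _ mo mu setT f)//.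
by apply: eq_measure_integral => A mA _; exact: lebesgue_measureN.
Qed.

Definition gauss_density (t x : R) : R := ((Num.sqrt t)^-1 * expR (- (pi * x ^+ 2 / t)))%R.

Lemma gauss_density_ge0 t x : (0 <= gauss_density t x)%R.
Proof. by rewrite mulr_ge0 ?expR_ge0// invr_ge0 sqrtr_ge0. Qed.

Lemma measurable_gauss_density t : measurable_fun [set: RM] (gauss_density t).
Proof.
apply: measurable_funM => //; apply: measurableT_comp => //.
by apply: measurable_funN; apply: measurable_funM => //; apply: measurable_funM => //; exact: measurable_funX.
Qed.

Lemma integral_gauss_density t : (0 < t)%R -> \int[mu]_x (gauss_density t x)%:E = 1.
Proof.
move=> t0; pose s : R := Num.sqrt (t / (2 * pi)).
have p0 := pi_gt0 R.
have h0 : (0 < t / (2 * pi))%R by rewrite divr_gt0 ?mulr_gt0.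
have s2 : (s ^+ 2 = t / (2 * pi))%R by rewrite sqr_sqrtr// ltW.
rewrite -(integral_normal_pdf 0 s); apply: eq_integral => x _; congr (_%:E).
rewrite normal_pdfE; last by rewrite gt_eqF// sqrtr_gt0.
rewrite /gauss_density /normal_peak /normal_fun s2 subr0; congr (_^-1 * expR _)%R.
  by congr Num.sqrt; move: (pi) p0 => p p0; field; rewrite gt_eqF.
by move: (pi) p0 => p p0; field; rewrite !gt_eqF.
Qed.

(** Half of the exponent absorbs x^2 and the other half leaves a Gaussian at time 2 t, so the
    pointwise comparison with 2 t times the density at 2 t suffices. The exact moment is t / (2
    pi). *)
Lemma integral_gauss_density_sqr t : (0 < t)%R ->
  \int[mu]_x (gauss_density t x * x ^+ 2)%:E <= (2 * t)%:E.
Proof.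
move=> t0; have p0 := pi_gt0 R; have p2 := pi_ge2 R.
have t20 : (0 < 2 * t)%R by lra.
rewrite -[leRHS]mule1 -(integral_gauss_density t20) -ge0_integralZl//; last 3 first.
- by apply/measurable_EFinP; exact: measurable_gauss_density.
- by move=> x _; rewrite lee_fin gauss_density_ge0.
- by rewrite lee_fin ltW.
apply: ge0_le_integral => //.
- by move=> x _; rewrite lee_fin mulr_ge0 ?gauss_density_ge0 ?sqr_ge0.
- apply/measurable_EFinP; apply: measurable_funM; first exact: measurable_gauss_density.
  exact: measurable_funX.
- apply: measurable_funeM; apply/measurable_EFinP; exact: measurable_gauss_density.
move=> x _; rewrite -EFinM lee_fin /gauss_density.
pose w : R := (pi * x ^+ 2 / (2 * t))%R.
have -> : (pi * x ^+ 2 / t = w + w)%R by rewrite /w; move: (pi) => p; field; rewrite gt_eqF.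
rewrite -/w opprD expRD sqrtrM//.
have w1 : (x ^+ 2 * expR (- w) <= t)%R.
  have x2 : (x ^+ 2 <= w * t)%R.
    have -> : (w * t = x ^+ 2 * (pi / 2))%R by rewrite /w; move: (pi) => p; field; rewrite gt_eqF.
    by rewrite ler_peMr ?sqr_ge0// ler_pdivlMr// mul1r.
  rewrite expRN ler_pdivrMr ?expR_gt0//; apply: le_trans x2 _.
  by rewrite mulrC ler_pM2l//; have := expR_ge1Dx w; lra.
have s21 : (1 <= Num.sqrt 2 :> R)%R by rewrite -[leLHS](@sqrtr1 R) ler_sqrt//; lra.
have s22 : (Num.sqrt 2 <= 2 :> R)%R.
  rewrite -[leRHS](@sqr_sqrtr R 2)// expr2 ler_peMr//; lra.
have st0 : (0 < Num.sqrt t)%R by rewrite sqrtr_gt0.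
have -> : ((Num.sqrt t)^-1 * (expR (- w) * expR (- w)) * x ^+ 2 =
   ((Num.sqrt t)^-1 * expR (- w)) * (x ^+ 2 * expR (- w)))%R by ring.
have -> : (2 * t * ((Num.sqrt 2 * Num.sqrt t)^-1 * expR (- w)) =
   ((Num.sqrt t)^-1 * expR (- w)) * (2 / Num.sqrt 2 * t))%R.
  by field; rewrite !gt_eqF//=; lra.
apply: ler_wpM2l; first by rewrite mulr_ge0 ?expR_ge0// invr_ge0 ltW.
apply: (le_trans w1); rewrite ler_peMl ?(ltW t0)// ler_pdivlMr ?mul1r//; lra.
Qed.

End lebesgue_line.

(** * Tonelli, translations and reflections for integrals over columns *)

Section column_integrals.
Variable R : realType.
Local Notation mu := (@lebesgue_measure R).
Local Notation RM := (measurableTypeR R).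

Definition col_measurable n (g : 'cV[R]_n -> \bar R) : Prop :=
  measurable_fun [set: n.-tuple RM] (fun v => g (tuple_col v)).

Definition col_integral n (g : 'cV[R]_n -> \bar R) : \bar R :=
  (\int[lebesgue_tuple R n]_v g (tuple_col v))%E.

Definition col_tuple n (y : 'cV[R]_n) : n.-tuple RM := [tuple (y i 0 : RM) | i < n].

Lemma col_tupleK n : cancel (@col_tuple n) (@tuple_col R n).
Proof. by move=> y; apply/colP => i; rewrite mxE tnth_mktuple. Qed.

Lemma tuple_col_cons n (x : R) (v : n.-tuple RM) :
  tuple_col (cons_pair ((x : RM), v)) = col_mx x%:M (tuple_col v) :> 'cV[R]_(1 + n).
Proof.
apply/colP => i; rewrite [LHS]mxE; case: (splitP i) => j ij.
  rewrite (_ : i = lshift n j); last exact: val_inj.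
  rewrite col_mxEu (_ : lshift n j = ord0); last by apply: val_inj; rewrite /= ord1.
  by rewrite ord1 mxE eqxx mulr1n /cons_pair (tnth_nth 0).
rewrite (_ : i = rshift 1 j); last exact: val_inj.
by rewrite col_mxEd mxE /cons_pair !(tnth_nth 0).
Qed.

Lemma col_measurable_comp n m (f : 'cV[R]_n -> 'cV[R]_m) g :
  (forall i, measurable_fun [set: n.-tuple RM] (fun v => f (tuple_col v) i 0 : RM)) ->
  col_measurable g -> col_measurable (g \o f).
Proof.
move=> mf mg.
have -> : (g \o f) = (fun y => g (tuple_col (col_tuple (f y)))).
  by apply/funext => y /=; rewrite col_tupleK.
rewrite /col_measurable; apply: (measurableT_comp mg).
apply/measurable_fun_tnthP => i.
rewrite (_ : _ \o _ = (fun v => f (tuple_col v) i 0 : RM)); first exact: mf.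
by apply/funext => v /=; rewrite tnth_mktuple.
Qed.

Lemma measurable_coord n (i : 'I_n) :
  measurable_fun [set: n.-tuple RM] (fun v => tuple_col v i 0 : RM).
Proof.
rewrite (_ : (fun v => _) = (fun v : n.-tuple RM => tnth v i)); first exact: measurable_tnth.
by apply/funext => v; rewrite mxE.
Qed.

Lemma measurable_mulmx_coord n m (A : 'M[R]_(m, n)) (w : 'cV[R]_m) i :
  measurable_fun [set: n.-tuple RM] (fun v => (A *m tuple_col v + w) i 0 : RM).
Proof.
rewrite (_ : (fun v => _) = (fun v => (\sum_j A i j * tuple_col v j 0 + w i 0)%R)).
  apply: measurable_funD => //; apply: measurable_sum => j.
  by apply: measurable_funM => //; exact: measurable_coord.
by apply/funext => v; rewrite !mxE.
Qed.

Lemma col_measurable_affine n m (A : 'M[R]_(m, n)) (w : 'cV[R]_m) g :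
  col_measurable g -> col_measurable (fun y => g (A *m y + w)%R).
Proof. by move=> mg; apply: (col_measurable_comp (f := fun y => (A *m y + w)%R)) mg => i; exact: measurable_mulmx_coord. Qed.

(** Tonelli in the first coordinate. The measurability conclusions let inductions on the dimension
    continue on the slices. *)
Lemma col_integralS n (g : 'cV[R]_(1 + n) -> \bar R) :
  col_measurable g -> (forall y, 0 <= g y)%E ->
  [/\ col_integral g = (\int[mu]_x col_integral (fun y => g (col_mx x%:M y)))%E,
      forall x, col_measurable (fun y => g (col_mx x%:M y)) &
      measurable_fun [set: RM] (fun x => col_integral (fun y => g (col_mx x%:M y)))].
Proof.
move=> mg g0.
pose G (p : RM * n.-tuple RM) := g (tuple_col (cons_pair p)).
have mG : measurable_fun setT G by apply: (measurableT_comp mg); exact: measurable_cons_pair.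
have GE x v : G (x, v) = g (col_mx x%:M (tuple_col v)) by rewrite /G tuple_col_cons.
have FE : (fun x => col_integral (fun y => g (col_mx x%:M y))) = fubini_F (lebesgue_tuple R n) G.
  by apply/funext => x; apply: eq_integral => v _; rewrite GE.
split.
- rewrite FE -(@fubini_tonelli1 _ _ _ _ R mu (lebesgue_tuple R n) G mG); last by move=> p; exact: g0.
  rewrite -[RHS](@ge0_integral_pushforward _ _ _ _ R _ (@measurable_cons_pair _ _ n)
    (mu \x lebesgue_tuple R n)%E setT (fun v => g (tuple_col v)))//.
- move=> x; rewrite /col_measurable.
  rewrite (_ : (fun v => _) = G \o pair x); last by apply/funext => v /=; rewrite GE.
  by apply: measurableT_comp => //; exact: measurable_pair1.
- by rewrite FE; apply: measurable_fun_fubini_tonelli_F => // p; exact: g0.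
Qed.

(** Coordinate by coordinate, from the invariance of Lebesgue measure on the line. The boolean
    selects the sign, so one induction covers translations and point reflections. *)
Lemma col_integral_affine n (e : bool) (w : 'cV[R]_n) g :
  col_measurable g -> (forall y, 0 <= g y)%E ->
  col_integral (fun y => g ((-1) ^+ e *: y + w)%R) = col_integral g.
Proof.
elim: n w g => [|n IH] w g mg g0.
  by apply: eq_integral => v _; congr (g _); rewrite [LHS]flatmx0 [RHS]flatmx0.
have [gE gm1 gm2] := @col_integralS n g mg g0.
have mg' : col_measurable (fun y : 'cV[R]_(1 + n) => g ((-1) ^+ e *: y + w)%R).
  have := @col_measurable_affine (1 + n) (1 + n) ((-1) ^+ e)%:M%R w g mg.
  by under eq_fun do rewrite mul_scalar_mx.
have [-> _ _] := @col_integralS n _ mg' (fun y => g0 _).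
pose h x := col_integral (fun y => g (col_mx x%:M y)).
transitivity (\int[mu]_x h ((-1) ^+ e * x + w 0 0)%R)%E.
  apply: eq_integral => x _; rewrite /h -(IH (@dsubmx _ 1 n 1 w) _ (gm1 _))//.
  apply: eq_integral => v _; congr (g _).
  rewrite {1}(col_mxE w) (@scale_col_mx _ 1 n 1) (@add_col_mx _ 1 n 1).
  by rewrite scale_scalar_mx -raddfD.
rewrite gE -/h.
have h0 x : (0 <= h x)%E by apply: integral_ge0.
case: (e) => /=; last first.
  transitivity (\int[mu]_x h (x + w 0 0)%R)%E; last exact: ge0_integral_shift.
  by apply: eq_integral => x _; rewrite expr0 mul1r.
transitivity (\int[mu]_x h (- x + w 0 0)%R)%E.
  by apply: eq_integral => x _; rewrite expr1 mulN1r.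
rewrite (@ge0_integral_oppr R (fun x => h (x + w 0 0))) ?ge0_integral_shift//.
by apply: (measurableT_comp gm2); exact: measurable_funD.
Qed.

End column_integrals.

(** * Tiling by the fundamental domain and unfolding of integrals *)

Section unfolding.
Variable R : realType.
Local Notation RM := (measurableTypeR R).

(** Turns the unconditional sum into a series along the encoding of [T]; codes without a preimage
    count as 0. Monotone convergence and measurability of sums follow from this form. *)
Lemma esum_countable (T : countType) (a : T -> \bar R) : (forall t, 0 <= a t)%E ->
  (\esum_(t in setT) a t = \sum_(0 <= k <oo) oapp a 0 (@pickle_inv T k))%E.
Proof.
move=> a0; rewrite nneseries_esumT; last by move=> k; case: pickle_inv.
rewrite [RHS](@esumID _ _ (range (@choice.pickle T))); last by move=> k _; case: pickle_inv.
rewrite !setTI [X in (_ = _ + X)%E]esum1 ?adde0; last first.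
  move=> k /= kN; case ek : (@pickle_inv T k) => [t|//].
  by exfalso; apply: kN; exists t => //; have := @pickle_invK T k; rewrite ek.
rewrite (@reindex_esum R _ _ setT (range (@choice.pickle T)) (@choice.pickle T)).
  by apply: eq_esum => t _; rewrite pickleK_inv.
split; first by move=> t _; exists t.
  by move=> t u _ _; apply: (pcan_inj (@pickleK_inv T)).
by move=> k [t _ <-]; exists t.
Qed.

Lemma ge0_integral_esum d (X : measurableType d) (mu : {measure set X -> \bar R})
    (T : countType) (f : T -> X -> \bar R) :
  (forall t, measurable_fun setT (f t)) -> (forall t x, 0 <= f t x)%E ->
  (\int[mu]_x (\esum_(t in setT) f t x) = \esum_(t in setT) \int[mu]_x f t x)%E.
Proof.
move=> mf f0; pose F k x := oapp (fun t => f t x) 0%E (@pickle_inv T k).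
transitivity (\int[mu]_x \sum_(0 <= k <oo) F k x)%E.
  by apply: eq_integral => x _; rewrite esum_countable.
rewrite integral_nneseries//; last 2 first.
- by move=> k; rewrite /F; case: pickle_inv => [t|]; [exact: mf|exact: measurable_cst].
- by move=> k x _; rewrite /F; case: pickle_inv => [t|] /=; rewrite ?f0.
rewrite esum_countable; last by move=> t; exact: integral_ge0.
apply: eq_eseriesr => k _; rewrite /F; case: pickle_inv => //=.
by rewrite integral0.
Qed.

Lemma measurable_esum d (X : measurableType d) (T : countType) (f : T -> X -> \bar R) :
  (forall t, measurable_fun setT (f t)) -> (forall t x, 0 <= f t x)%E ->
  measurable_fun setT (fun x => \esum_(t in setT) f t x)%E.
Proof.
move=> mf f0; pose F k x := oapp (fun t => f t x) 0%E (@pickle_inv T k).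
rewrite (_ : (fun x => _) = (fun x => \sum_(0 <= k <oo) F k x)%E); last first.
  by apply/funext => x; rewrite esum_countable.
apply: ge0_emeasurable_sum => k; rewrite /F; first by move=> x _ _; case: pickle_inv => [t|] /=; rewrite ?f0.
by move=> _; case: pickle_inv => [t|]; [exact: mf|exact: measurable_cst].
Qed.

Variables (n : nat) (B : 'M[R]_n).
Hypothesis Bunit : B \in unitmx.
Local Notation FD := (fundamental_domain B).

Definition fd_indic (y : 'cV[R]_n) : \bar R := (\1_FD y)%:E.

Lemma fundamental_domainP y : FD y <-> forall i, 0 <= (invmx B *m y) i 0 < 1.
Proof.
split; first by move=> [s sP <-] i; rewrite mulKmx.
by move=> h; exists (invmx B *m y) => //; rewrite mulKVmx.
Qed.

Lemma fd_measurable : measurable ((@tuple_col R n) @^-1` FD).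
Proof.
rewrite (_ : _ @^-1` _ = \bigcap_(i in [set: 'I_n])
    ((fun v => (invmx B *m tuple_col v + 0) i 0 : RM) @^-1` `[0, 1[%classic)).
  apply: fin_bigcap_measurable => // i _; rewrite -[X in measurable X]setTI.
  by apply: measurable_mulmx_coord => //; exact: measurable_itv.
apply/seteqP; split => v /=.
  by move=> /fundamental_domainP h i _ /=; rewrite in_itv/= addr0.
by move=> h; apply/fundamental_domainP => i; have := h i I; rewrite /= in_itv/= addr0.
Qed.

Lemma fd_indic_measurable : col_measurable fd_indic.
Proof.
rewrite /col_measurable /fd_indic; apply/measurable_EFinP.
rewrite (_ : (fun v => _) = \1_(@tuple_col R n @^-1` FD)).
  by apply: measurable_indic; exact: fd_measurable.
by apply/funext => v; rewrite !indicE; congr (_%:R); apply/idP/idP; rewrite !inE.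
Qed.

Lemma fd_indic_ge0 y : (0 <= fd_indic y)%E.
Proof. by rewrite lee_fin indicE. Qed.

(** The translates of the domain tile the space: exactly one contains [y], given by the floors of
    its coordinates in the basis. *)
Lemma fd_indic_esum y (c : \bar R) : (0 <= c)%E ->
  (\esum_(z in setT) (fd_indic (y - B *m ivec R z)%R * c) = c)%E.
Proof.
move=> c0; pose s := invmx B *m y; pose z0 : 'cV[int]_n := \col_i Num.floor (s i 0).
have coordE z i : (invmx B *m (y - B *m ivec R z)) i 0 = s i 0 - (z i 0)%:~R.
  by rewrite mulmxBr mulKmx// mxE [X in _ + X]mxE [X in _ - X]mxE.
have inz0 z : FD (y - B *m ivec R z) <-> z = z0.
  rewrite fundamental_domainP; split.
    move=> h; apply/colP => i; rewrite mxE; apply/esym/floor_def.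
    by have := h i; rewrite coordE intrD1; lra.
  move=> -> i; rewrite coordE (_ : z0 i 0 = Num.floor (s i 0)); last by rewrite mxE.
  by have := floor_itv (s i 0); rewrite intrD1; lra.
have t0 z : (0 <= fd_indic (y - B *m ivec R z)%R * c)%E by rewrite mule_ge0// fd_indic_ge0.
rewrite (@esumID _ _ [set z0])// !setTI esum_set1// esum1 ?adde0.
  by rewrite /fd_indic indicE mem_set ?mul1e//; apply/inz0.
by move=> z /= zz0; rewrite /fd_indic indicE memNset ?mul0e// => /inz0.
Qed.

(** Insert the tiling, exchange sum and integral, and translate each tile back to the fundamental
    domain. *)
Lemma col_integral_unfold h : col_measurable h -> (forall y, 0 <= h y)%E ->
  col_integral h =
  col_integral (fun y => fd_indic y * \esum_(z in setT) h (y + B *m ivec R z)%R)%E.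
Proof.
move=> mh h0.
have m1 (w : 'cV[R]_n) g : col_measurable g -> col_measurable (fun y => g (y + w)).
  by move=> mg; have := col_measurable_affine 1%:M w mg; under eq_fun do rewrite mul1mx.
have shift (w : 'cV[R]_n) g : col_measurable g -> (forall y, 0 <= g y)%E ->
    col_integral (fun y => g (y + w)) = col_integral g.
  move=> mg g0; rewrite -(col_integral_affine false w mg g0).
  by apply: eq_integral => v _; rewrite expr0 scale1r.
transitivity (col_integral (fun y => \esum_(z in setT) (fd_indic (y - B *m ivec R z)%R * h y))%E).
  by apply: eq_integral => v _; rewrite fd_indic_esum.
transitivity (\esum_(z in setT) col_integral (fun y => fd_indic (y - B *m ivec R z)%R * h y))%E.
  apply: ge0_integral_esum => [z|z v]; last by rewrite mule_ge0// fd_indic_ge0.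
  apply: emeasurable_funM => //.
  exact: (m1 (- (B *m ivec R z)) _ fd_indic_measurable).
transitivity (\esum_(z in setT) col_integral (fun y => fd_indic y * h (y + B *m ivec R z)%R))%E.
  apply: eq_esum => z _.
  rewrite -(shift (- (B *m ivec R z)) (fun y => fd_indic y * h (y + B *m ivec R z)%R)%E).
  - by apply: eq_integral => v _; rewrite subrK.
  - by apply: emeasurable_funM; [exact: fd_indic_measurable|exact: m1].
  - by move=> y; rewrite mule_ge0// fd_indic_ge0.
rewrite -ge0_integral_esum; last 2 first.
- by move=> z; apply: emeasurable_funM; [exact: fd_indic_measurable|exact: m1].
- by move=> z v; rewrite mule_ge0// fd_indic_ge0.
apply: eq_integral => v _; rewrite /fd_indic indicE.
by case: (_ \in _); [under eq_esum do rewrite mul1e; rewrite mul1e|rewrite mul0e esum1// => z _; rewrite mul0e].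
Qed.

(* Folding [R^n] back along the fundamental domain [w - FD] instead of [FD]. *)
Lemma fd_integral_reflect (w : 'cV[R]_n) g : col_measurable g -> (forall y, 0 <= g y)%E ->
  (forall y z, g (y + B *m ivec R z) = g y) ->
  col_integral (fun y => fd_indic y * g (w - y)%R)%E =
  col_integral (fun y => fd_indic y * g y)%E.
Proof.
move=> mg g0 gper.
have refl h : col_measurable h -> (forall y, 0 <= h y)%E ->
    col_integral (fun y => h (w - y)) = col_integral h.
  move=> mh h0; rewrite -(col_integral_affine true w mh h0).
  by apply: eq_integral => v _; rewrite expr1 scaleN1r addrC.
have mrefl h : col_measurable h -> col_measurable (fun y => h (w - y)).
  move=> mh; have := col_measurable_affine (- 1%:M) w mh.
  by under eq_fun do rewrite mulNmx mul1mx addrC.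
rewrite -(refl (fun y => fd_indic y * g (w - y)%R)%E); last 2 first.
- by apply: emeasurable_funM; [exact: fd_indic_measurable|exact: mrefl].
- by move=> y; rewrite mule_ge0// fd_indic_ge0.
rewrite col_integral_unfold; last 2 first.
- apply: (mrefl (fun y => fd_indic y * g (w - y)%R)%E).
  by apply: emeasurable_funM; [exact: fd_indic_measurable|exact: mrefl].
- by move=> y; rewrite mule_ge0// fd_indic_ge0.
apply: eq_integral => v _; congr (_ * _)%E.
rewrite -[RHS](fd_indic_esum (w - tuple_col v)) ?g0//.
by apply: eq_esum => z _ /=; rewrite subKr gper opprD addrA.
Qed.

End unfolding.

(** * Mass and second moments of the Gaussian on columns *)

Section gaussian_moments.
Variables (R : realType) (t : R).
Hypothesis t0 : 0 < t.
Local Notation RM := (measurableTypeR R).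
Local Notation mu := (@lebesgue_measure R).

(** The heat kernel of the whole space, in product form so that integrals can be computed by
    induction; [gauss_colE] gives the radial form. *)
Definition gauss_col n (y : 'cV[R]_n) : R := \prod_i gauss_density t (y i 0).

Lemma gauss_col_ge0 n (y : 'cV[R]_n) : 0 <= gauss_col y.
Proof. by apply: prodr_ge0 => i _; exact: gauss_density_ge0. Qed.

Lemma gauss_colE n (y : 'cV[R]_n) :
  gauss_col y = t `^ (- (n%:R / 2)) * expR (- (pi * norm2 y ^+ 2 / t)).
Proof.
rewrite /gauss_col big_split/= prodr_const card_ord; congr (_ * _).
  rewrite powR_half_dim// -sqrtrV ?(ltW t0)//.
  elim: (n) => [|k IH]; first by rewrite !expr0 sqrtr1.
  by rewrite !exprS IH sqrtrM ?invr_ge0 ?(ltW t0).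
rewrite -expR_sum; congr expR; rewrite norm2_sqr /dotp mulr_sumr mulr_suml -sumrN.
by apply: eq_bigr => i _; rewrite expr2.
Qed.

Lemma gauss_col_mx n (x : R) (y : 'cV[R]_n) :
  gauss_col (col_mx x%:M y : 'cV_(1 + n)) = gauss_density t x * gauss_col y.
Proof.
rewrite /gauss_col big_split_ord big_ord1 col_mxEu mxE eqxx mulr1n; congr (_ * _).
by apply: eq_bigr => i _; rewrite col_mxEd.
Qed.

Lemma measurable_dotp_tuple n m (A : 'M[R]_(m, n)) w :
  measurable_fun [set: n.-tuple RM] (fun v => norm2 (A *m tuple_col v + w) ^+ 2 : RM).
Proof.
rewrite (_ : (fun v => _) = (fun v => \sum_i (A *m tuple_col v + w) i 0 * (A *m tuple_col v + w) i 0)).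
  apply: measurable_sum => i.
  by apply: measurable_funM; exact: measurable_mulmx_coord.
by apply/funext => v; rewrite norm2_sqr.
Qed.

Lemma measurable_gauss_col n :
  measurable_fun [set: n.-tuple RM] (fun v => gauss_col (tuple_col v) : RM).
Proof.
under eq_fun do rewrite gauss_colE.
apply: measurable_funM => //; apply: measurableT_comp => //.
apply: measurable_funN; apply: measurable_funM => //; apply: measurable_funM => //.
have := @measurable_dotp_tuple n n 1%:M 0.
by under eq_fun do rewrite mul1mx addr0.
Qed.

Lemma gauss_col_measurable n : col_measurable (fun y : 'cV[R]_n => (gauss_col y)%:E).
Proof. by apply/measurable_EFinP; exact: measurable_gauss_col. Qed.

Lemma col_integralZl n (c : \bar R) (g : 'cV[R]_n -> \bar R) : (0 <= c)%E ->
  col_measurable g -> (forall y, 0 <= g y)%E ->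
  (col_integral (fun y => c * g y) = c * col_integral g)%E.
Proof. by move=> c0 mg g0; rewrite /col_integral ge0_integralZl. Qed.

Lemma col_integral0 (g : 'cV[R]_0 -> \bar R) : col_integral g = g 0.
Proof.
rewrite /col_integral/= integral_dirac// ?diracT ?mul1e; first by congr g; exact: flatmx0.
rewrite (_ : (fun v => _) = cst (g 0))//; apply/funext => v; congr g; exact: flatmx0.
Qed.

Lemma col_integral_gauss n : col_integral (fun y : 'cV[R]_n => (gauss_col y)%:E) = 1%E.
Proof.
elim: n => [|n IH]; first by rewrite col_integral0 /gauss_col big_ord0.
have [-> _ _] := col_integralS (@gauss_col_measurable (1 + n)) (fun y => gauss_col_ge0 y).
rewrite -[RHS](integral_gauss_density t0); apply: eq_integral => x _.
under [X in col_integral X]eq_fun do rewrite gauss_col_mx EFinM.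
rewrite col_integralZl ?IH ?mule1 ?lee_fin ?gauss_density_ge0//.
  exact: gauss_col_measurable.
by move=> y; rewrite lee_fin gauss_col_ge0.
Qed.

Lemma norm2_line p (m w : 'cV[R]_p) x :
  norm2 (x *: m + w) ^+ 2 = x ^+ 2 * norm2 m ^+ 2 + 2 * x * dotp m w + norm2 w ^+ 2.
Proof. by rewrite !norm2_sqr !(dotpDl, dotpDr) !dotpZl !dotpZr (dotpC w m); ring. Qed.

Lemma measurable_norm2_line p (m w : 'cV[R]_p) :
  measurable_fun [set: RM] (fun x : RM => norm2 ((x : R) *: m + w) ^+ 2 : RM).
Proof.
under eq_fun do rewrite norm2_line.
apply: measurable_funD => //; apply: measurable_funD.
  by apply: measurable_funM => //; exact: measurable_funX.
by apply: measurable_funM => //; exact: measurable_funM.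
Qed.

(* The cross term cancels between [x] and [- x], so no signed integral is needed. *)
Lemma gauss_density_moment (p : nat) (m w : 'cV[R]_p) :
  (\int[mu]_x (gauss_density t x * norm2 (x *: m + w)%R ^+ 2)%:E <=
   (2 * t * norm2 m ^+ 2 + norm2 w ^+ 2)%:E)%E.
Proof.
have mg := measurable_gauss_density t.
have msq := measurable_norm2_line m w.
pose F (x : RM) := (gauss_density t x * norm2 ((x : R) *: m + w) ^+ 2)%:E.
have mF : measurable_fun setT F by apply/measurable_EFinP; exact: measurable_funM.
have F0 x : (0 <= F x)%E by rewrite lee_fin mulr_ge0 ?gauss_density_ge0 ?sqr_ge0.
have mFN : measurable_fun setT (fun x : RM => F (- (x : R))).
  by apply: (measurableT_comp mF); exact: measurable_funN.
rewrite -[leLHS]/(\int[mu]_x F x)%E; set I := (\int[mu]_x F x)%E.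
suff : (I + I <= (2 * (2 * t * norm2 m ^+ 2 + norm2 w ^+ 2))%:E)%E.
  by case: (I) => [r| |]; rewrite ?leNye// -?EFinD ?lee_fin//; lra.
have -> : (I + I = \int[mu]_x (F x + F (- (x : R))%R))%E.
  transitivity (I + \int[mu]_x F (- (x : R))%R)%E.
    by rewrite (ge0_integral_oppr mF F0).
  by apply/esym/ge0_integralD.
have -> : (\int[mu]_x (F x + F (- (x : R))%R) =
    \int[mu]_x ((2 * norm2 m ^+ 2)%:E * (gauss_density t x * x ^+ 2)%:E +
               (2 * norm2 w ^+ 2)%:E * (gauss_density t x)%:E))%E.
  apply: eq_integral => x _; rewrite /F -!EFinM -!EFinD; congr (_%:E).
  by rewrite !norm2_line /gauss_density sqrrN; ring.
have mgx : measurable_fun [set: RM] (fun x : RM => (gauss_density t x * (x : R) ^+ 2)%:E).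
  by apply/measurable_EFinP; apply: measurable_funM => //; exact: measurable_funX.
have gx0 (x : RM) : (0 <= (gauss_density t x * (x : R) ^+ 2)%:E)%E.
  by rewrite lee_fin mulr_ge0 ?gauss_density_ge0 ?sqr_ge0.
have g0 (x : RM) : (0 <= (gauss_density t x)%:E)%E by rewrite lee_fin gauss_density_ge0.
have m20 : 0 <= 2 * norm2 m ^+ 2 by rewrite mulr_ge0 ?sqr_ge0.
have w20 : 0 <= 2 * norm2 w ^+ 2 by rewrite mulr_ge0 ?sqr_ge0.
have mgE : measurable_fun [set: RM] (fun x : RM => (gauss_density t x)%:E).
  exact/measurable_EFinP.
rewrite ge0_integralD//; last 4 first.
- by move=> x _; rewrite mule_ge0.
- exact: measurable_funeM.
- by move=> x _; rewrite mule_ge0.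
- exact: measurable_funeM.
rewrite !ge0_integralZl// integral_gauss_density// mule1.
rewrite mulrDr EFinD leeD2r// (_ : 2 * (2 * t * norm2 m ^+ 2) = 2 * norm2 m ^+ 2 * (2 * t)); last by ring.
by rewrite [leRHS]EFinM lee_wpmul2l ?lee_fin// integral_gauss_density_sqr.
Qed.

Lemma mxtrace_gram_ge0 n p (M : 'M[R]_(p, n)) : 0 <= \tr (M^T *m M).
Proof.
apply: sumr_ge0 => i _; rewrite mxE; apply: sumr_ge0 => j _.
by rewrite mxE -expr2 sqr_ge0.
Qed.

(** Induction on the columns of [M]: with the first coordinate fixed, its column joins the offset
    [w] of the induction hypothesis and is then averaged by [gauss_density_moment]. The height [p]
    is separate from [n] because only columns are removed. *)
Lemma gauss_col_moment n p (M : 'M[R]_(p, n)) (w : 'cV[R]_p) :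
  (col_integral (fun y => (gauss_col y * norm2 (M *m y + w)%R ^+ 2)%:E) <=
   (2 * t * \tr (M^T *m M) + norm2 w ^+ 2)%:E)%E.
Proof.
elim: n M w => [|n IH] M w.
  rewrite col_integral0 /gauss_col big_ord0 mul1r mulmx0 add0r lee_fin.
  by rewrite /mxtrace big_ord0 mulr0 add0r.
pose m := @lsubmx _ p 1 n M; pose M' := @rsubmx _ p 1 n M.
have ME : M = row_mx m M' by rewrite hsubmxK.
have trE : \tr (M^T *m M) = norm2 m ^+ 2 + \tr (M'^T *m M').
  rewrite {1 2}ME (@tr_row_mx _ p 1 n) (@mul_col_row _ 1 n p 1 n) (@mxtrace_block _ 1 n).
  by rewrite norm2_sqr dotpE [in LHS](mx11_scalar (m^T *m m)) mxtrace_scalar.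
have mint : col_measurable (fun y : 'cV[R]_(1 + n) => (gauss_col y * norm2 (M *m y + w)%R ^+ 2)%:E).
  apply/measurable_EFinP; apply: measurable_funM; first exact: measurable_gauss_col.
  exact: measurable_dotp_tuple.
have int0 (k : nat) (A : 'M[R]_(p, k)) v (y : 'cV[R]_k) :
    (0 <= (gauss_col y * norm2 (A *m y + v)%R ^+ 2)%:E)%E.
  by rewrite lee_fin mulr_ge0 ?gauss_col_ge0 ?sqr_ge0.
have [-> _ minner] := col_integralS mint (int0 _ M w).
have mint' v : col_measurable (fun y : 'cV[R]_n => (gauss_col y * norm2 (M' *m y + v)%R ^+ 2)%:E).
  apply/measurable_EFinP; apply: measurable_funM; first exact: measurable_gauss_col.
  exact: measurable_dotp_tuple.
have mg : measurable_fun [set: RM] (gauss_density t) := measurable_gauss_density t.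
have msq := measurable_norm2_line m w.
have tr0 := mxtrace_gram_ge0 M'.
apply: (@le_trans _ _ (\int[mu]_x ((2 * t * \tr (M'^T *m M'))%:E * (gauss_density t x)%:E +
    (gauss_density t x * norm2 (x *: m + w)%R ^+ 2)%:E))%E).
  apply: ge0_le_integral => //.
  - by move=> x _; apply: integral_ge0 => v _; exact: int0.
  - apply: emeasurable_funD; first by apply: measurable_funeM; exact/measurable_EFinP.
    by apply/measurable_EFinP; exact: measurable_funM.
  move=> x _.
  have -> : col_integral (fun y => (gauss_col (col_mx x%:M y : 'cV_(1 + n)) *
        norm2 (M *m (col_mx x%:M y : 'cV_(1 + n)) + w)%R ^+ 2)%:E) =
      ((gauss_density t x)%:E * col_integral (fun y : 'cV[R]_n =>
        (gauss_col y * norm2 (M' *m y + (x *: m + w))%R ^+ 2)%:E))%E.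
    rewrite -col_integralZl; [|by rewrite lee_fin gauss_density_ge0|exact: mint'|exact: int0].
    apply: eq_integral => v _; rewrite -EFinM gauss_col_mx -mulrA; congr (_ * (_ * norm2 _ ^+ 2))%:E.
    by rewrite {1}ME (@mul_row_col _ p 1 n 1) mul_mx_scalar addrAC addrC.
  apply: le_trans (lee_wpmul2l _ (IH M' (x *: m + w))) _; first by rewrite lee_fin gauss_density_ge0.
  rewrite -!EFinM -EFinD lee_fin le_eqVlt; apply/orP; left; apply/eqP; ring.
rewrite ge0_integralD//; last 4 first.
- by move=> x _; rewrite mule_ge0// lee_fin ?gauss_density_ge0// mulr_ge0// mulr_ge0// ltW.
- by apply: measurable_funeM; exact/measurable_EFinP.
- by move=> x _; rewrite lee_fin mulr_ge0 ?gauss_density_ge0 ?sqr_ge0.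
- by apply/measurable_EFinP; exact: measurable_funM.
rewrite ge0_integralZl//; last 3 first.
- exact/measurable_EFinP.
- by move=> x _; rewrite lee_fin gauss_density_ge0.
- by rewrite lee_fin mulr_ge0// mulr_ge0// ltW.
rewrite integral_gauss_density// mule1; apply: le_trans (leeD2l _ (gauss_density_moment m w)) _.
by rewrite -EFinD lee_fin trE mulrDr; lra.
Qed.

End gaussian_moments.

(** * Heat kernel, covering radius and mixing times *)

Section heat_on_torus.
Variables (R : realType) (n : nat) (B : 'M[R]_n).
Hypothesis Bunit : B \in unitmx.
Local Notation FD := (fundamental_domain B).
Local Notation RM := (measurableTypeR R).
Local Notation heat := (torus_heat (lattice B)).
Local Notation detB := (lattice_det B).
Local Notation fd := (fd_indic B).

Lemma lattice_det_gt0 : 0 < detB.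
Proof. by rewrite normr_gt0 -unitfE -unitmxE. Qed.

Lemma heat_esumZ c t y : 0 <= c -> 0 < t ->
  ((c * heat t y)%:E = \esum_(z in setT) (c * gauss_col t (y + B *m ivec R z))%:E)%E.
Proof.
move=> c0 t0; apply/esym/has_sum_ge0P; first by move=> z; rewrite mulr_ge0// gauss_col_ge0.
apply: eq_has_sum (has_sumZ c (torus_heat_has_sum Bunit y t0)) => z.
by rewrite gauss_colE// addrC.
Qed.

Lemma heat_esum t y : 0 < t ->
  ((heat t y)%:E = \esum_(z in setT) (gauss_col t (y + B *m ivec R z))%:E)%E.
Proof.
move=> t0; have := heat_esumZ y ler01 t0; rewrite mul1r => ->.
by apply: eq_esum => z _; rewrite mul1r.
Qed.

Lemma heat_ge0 t y : 0 < t -> 0 <= heat t y.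
Proof.
move=> t0; rewrite -lee_fin heat_esum// esum_ge0// => z _.
by rewrite lee_fin gauss_col_ge0.
Qed.

Lemma torus_integralE (g : 'cV[R]_n -> R) :
  torus_integral B g = col_integral (fun y => fd y * (g y)%:E)%E.
Proof.
rewrite /torus_integral integral_mkcond; apply: eq_integral => v _.
rewrite patchE /fd_indic indicE.
have -> : (v \in @tuple_col R n @^-1` FD) = (tuple_col v \in FD) by [].
by case: (_ \in _); rewrite ?mul1e ?mul0e.
Qed.

Lemma heat_measurable t : 0 < t ->
  measurable_fun [set: n.-tuple RM] (fun v => heat t (tuple_col v) : RM).
Proof.
move=> t0; apply/measurable_EFinP.
rewrite (_ : EFin \o _ = (fun v : n.-tuple RM =>
   \esum_(z in setT) (gauss_col t (tuple_col v + B *m ivec R z))%:E)%E).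
  apply: measurable_esum => [z|z v]; last by rewrite lee_fin gauss_col_ge0.
  have := col_measurable_affine 1%:M (B *m ivec R z) (@gauss_col_measurable R t t0 n).
  by under eq_fun do rewrite mul1mx.
by apply/funext => v /=; rewrite heat_esum.
Qed.

(** The heat kernel is the periodisation of the Gaussian, so unfolding gives the Gaussian's total
    mass. *)
Lemma fd_integral_heat t : 0 < t ->
  col_integral (fun y => fd y * (heat t y)%:E)%E = 1%E.
Proof.
move=> t0; rewrite -(@col_integral_gauss R t t0 n) [RHS](@col_integral_unfold _ _ B)//.
- by apply: eq_integral => v _; rewrite heat_esum.
- exact: gauss_col_measurable.
- by move=> y; rewrite lee_fin gauss_col_ge0.
Qed.

Lemma le_col_integral (f g : 'cV[R]_n -> \bar R) :
  col_measurable f -> col_measurable g -> (forall y, 0 <= f y)%E ->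
  (forall y, f y <= g y)%E -> (col_integral f <= col_integral g)%E.
Proof. by move=> mf mg f0 fg; apply: ge0_le_integral. Qed.

(* No change-of-variables formula is used: the volume of the fundamental domain is
   compared with the determinant through the heat kernel, of total mass [1]. *)
Lemma fd_volume_bounds t e : 0 < t -> 0 <= e < 1 ->
  (forall y, `|detB * heat t y - 1| <= e) ->
  exists V : R, [/\ col_integral fd = V%:E, (1 - e) * V <= detB & detB <= (1 + e) * V].
Proof.
move=> t0 /andP[e0 e1] he; have d0 := lattice_det_gt0.
have mfd := fd_indic_measurable Bunit.
have mheat : col_measurable (fun y => (heat t y)%:E) by apply/measurable_EFinP; exact: heat_measurable.
have fh0 y : (0 <= fd y * (heat t y)%:E)%E by rewrite mule_ge0 ?fd_indic_ge0 ?lee_fin ?heat_ge0.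
have mfh : col_measurable (fun y => fd y * (heat t y)%:E)%E by exact: emeasurable_funM.
have detE : col_integral (fun y => detB%:E * (fd y * (heat t y)%:E))%E = detB%:E.
  by rewrite col_integralZl// ?fd_integral_heat ?mule1// lee_fin ltW.
have fdc (c : R) : 0 <= c -> col_integral (fun y => c%:E * fd y)%E = (c%:E * col_integral fd)%E.
  by move=> c0; rewrite col_integralZl// => y; exact: fd_indic_ge0.
have dfE y : (detB%:E * (fd y * (heat t y)%:E) = (detB * heat t y)%:E * fd y)%E.
  by rewrite muleCA -EFinM muleC.
have h1 : ((1 - e)%:E * col_integral fd <= detB%:E)%E.
  rewrite -fdc; last by lra.
  rewrite -[leRHS]detE.
  apply: le_col_integral.
  - exact: measurable_funeM.
  - exact: measurable_funeM.
  - by move=> y; rewrite mule_ge0 ?fd_indic_ge0// lee_fin; lra.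
  move=> y; rewrite dfE lee_wpmul2r ?fd_indic_ge0// lee_fin.
  by have := he y; rewrite ler_norml => /andP[]; lra.
have h2 : (detB%:E <= (1 + e)%:E * col_integral fd)%E.
  rewrite -fdc; last by lra.
  rewrite -[leLHS]detE.
  apply: le_col_integral.
  - exact: measurable_funeM.
  - exact: measurable_funeM.
  - by move=> y; rewrite mule_ge0// lee_fin ltW.
  move=> y; rewrite dfE lee_wpmul2r ?fd_indic_ge0// lee_fin.
  by have := he y; rewrite ler_norml => /andP[]; lra.
have V0 : (0 <= col_integral fd)%E by apply: integral_ge0 => v _; exact: fd_indic_ge0.
move: V0 h1 h2; case: (col_integral fd) => [V _||//].
  by rewrite -!EFinM !lee_fin => h1 h2; exists V.
by move=> _; rewrite gt0_muley ?leye_eq// lte_fin; lra.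
Qed.

End heat_on_torus.

(** * L_1 mixing bounds the covering radii of the images of the lattice *)

Section covering_radius_bounds.
Variables (R : realType) (n : nat) (B : 'M[R]_n).
Hypothesis Bunit : B \in unitmx.
Local Notation FD := (fundamental_domain B).
Local Notation RM := (measurableTypeR R).
Local Notation heat := (torus_heat (lattice B)).
Local Notation detB := (lattice_det B).
Local Notation fd := (fd_indic B).

Lemma norm2D_lt (r : R) (x y : 'cV[R]_n) : 0 < r ->
  norm2 x < r -> norm2 y < r -> norm2 (x + y) < 2 * r.
Proof.
move=> r0 xr yr; rewrite -(@ltr_pXn2r _ 2) ?nnegrE ?norm2_ge0 ?mulr_ge0 ?(ltW r0)//.
have x2 : norm2 x ^+ 2 < r ^+ 2 by rewrite ltr_pXn2r ?nnegrE ?norm2_ge0 ?(ltW r0).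
have y2 : norm2 y ^+ 2 < r ^+ 2 by rewrite ltr_pXn2r ?nnegrE ?norm2_ge0 ?(ltW r0).
have xy : 0 <= norm2 (x + (-1) *: y) ^+ 2 by exact: sqr_ge0.
move: x2 y2 xy; rewrite !norm2_sqr !(dotpDl, dotpDr) !dotpZl !dotpZr (dotpC y x); lra.
Qed.

Lemma uncovered_point (L : set 'cV[R]_n) (r : R) : 0 < r ->
  (r%:E < covering_radius L)%E -> exists x, forall u, L u -> r < norm2 (x - u).
Proof.
move=> r0 rL; apply: contrapT => /forallNP h.
suff : (covering_radius L <= r%:E)%E by rewrite leNgt rL.
apply: ereal_inf_lbound; exists r => //; split; first exact: ltW.
apply/seteqP; split => // x _.
have /existsNP[u /not_implyP[Lu /negP]] := h x; rewrite -leNgt => ur.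
exists u => //; exists (r^-1 *: (x - u)); last first.
  by rewrite scalerA mulfV ?gt_eqF// scale1r addrC subrK.
rewrite /= -(@ler_pXn2r _ 2) ?nnegrE ?norm2_ge0// norm2_sqr dotpZl dotpZr -norm2_sqr.
rewrite mulrA -expr2 exprVn mulrC ler_pdivrMr ?exprn_gt0// expr1n mul1r.
by rewrite ler_pXn2r ?nnegrE ?norm2_ge0 ?(ltW r0).
Qed.

Definition far_set (M : 'M[R]_n) (r : R) : set 'cV[R]_n :=
  [set y | forall z, r <= norm2 (M *m (y + B *m ivec R z))].

Lemma far_set_measurable M r : col_measurable (fun y => (\1_(far_set M r) y)%:E).
Proof.
apply/measurable_EFinP.
have -> : (fun v : n.-tuple RM => \1_(far_set M r) (tuple_col v) : R) =
    \1_(@tuple_col R n @^-1` far_set M r) by [].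
apply: measurable_indic.
(* A countable intersection over integer vectors. Codes of no vector contribute the whole space, and
   [Num.max 0 r] keeps squaring monotone when [r] is negative. *)
pose F (k : nat) : set (n.-tuple RM) := if pickle_inv k is Some z then
  (fun v => norm2 (M *m tuple_col v + M *m (B *m ivec R z)) ^+ 2 : RM) @^-1` `[Num.max 0 r ^+ 2, +oo[%classic
  else setT.
have -> : @tuple_col R n @^-1` far_set M r = \bigcap_k F k.
  have FP v z : (Num.max 0 r ^+ 2 <= norm2 (M *m tuple_col v + M *m (B *m ivec R z)) ^+ 2) =
      (r <= norm2 (M *m (tuple_col v + B *m ivec R z))).
    rewrite -mulmxDr ler_pXn2r ?nnegrE ?norm2_ge0 ?le_max ?lexx//.
    by rewrite ge_max norm2_ge0.
  apply/seteqP; split => v /=.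
    move=> h k _; rewrite /F; case: pickle_inv => // z.
    by rewrite /= in_itv/= andbT FP.
  move=> h z; have := h (choice.pickle z) I; rewrite /F pickleK_inv /= in_itv/= andbT.
  by rewrite FP.
apply: bigcapT_measurable => k; rewrite /F; case: pickle_inv => [z|]; last exact: measurableT.
rewrite -[X in measurable X]setTI.
by apply: measurable_dotp_tuple => //; exact: measurable_itv.
Qed.

Lemma far_set_periodic M r y z : far_set M r (y + B *m ivec R z) <-> far_set M r y.
Proof.
have ivecD z1 z2 : ivec R (z1 + z2) = ivec R z1 + ivec R z2 :> 'cV_n by rewrite /ivec map_mxD.
split => h w.
  by have := h (w - z); rewrite -addrA -mulmxDr -ivecD addrCA subrr addr0.
by rewrite -addrA -mulmxDr -ivecD; exact: h.
Qed.

Lemma far_set_reflect M r h y : 0 < r ->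
  (forall z, 2 * r < norm2 (M *m (h + B *m ivec R z))) ->
  far_set M r y \/ far_set M r (h - y).
Proof.
move=> r0 hfar; apply: contrapT => /not_orP[/existsNP[z1 /negP]]; rewrite -ltNge => y1.
move=> /existsNP[z2 /negP]; rewrite -ltNge => y2.
have := norm2D_lt r0 y1 y2; rewrite -mulmxDr.
have -> : y + B *m ivec R z1 + (h - y + B *m ivec R z2) = h + B *m ivec R (z1 + z2).
  rewrite /ivec map_mxD mulmxDr; move: (B *m _) (B *m _) => b1 b2.
  by rewrite addrACA [y + _]addrC subrK.
by rewrite ltNge ltW.
Qed.

(* Under the heat kernel the distance from [M y] to [M L] is at most of order
   [sqrt (t * tr (M^T M))], whereas under the uniform distribution it is at least
   half of the covering radius with probability at least one half. *)
Lemma far_set_mixing (V t r : R) (M : 'M[R]_n) (h : 'cV[R]_n) :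
  col_integral fd = V%:E -> detB <= (1 + 1 / 8) * V -> 0 < t ->
  ((detB^-1)%:E * torus_integral B (fun x => `|detB * heat t x - 1|%R) < (1 / 4)%:E)%E ->
  0 < r -> (forall z, 2 * r < norm2 (M *m (h + B *m ivec R z))) ->
  r ^+ 2 <= 11 * t * \tr (M^T *m M).
Proof.
move=> fdV detV t0 L1 r0 hfar; have d0 := lattice_det_gt0 Bunit.
pose iA y : \bar R := (\1_(far_set M r) y)%:E.
have mA : col_measurable iA := far_set_measurable M r.
have A0 y : (0 <= iA y)%E by rewrite lee_fin indicE.
have Aper y z : iA (y + B *m ivec R z) = iA y.
  have : (y + B *m ivec R z \in far_set M r) = (y \in far_set M r).
    have [h1 h2] := far_set_periodic M r y z.
    by apply/idP/idP => /set_mem; [move/h1|move/h2]; exact: mem_set.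
  by rewrite /iA !indicE => ->.
have mfd := fd_indic_measurable Bunit.
have fd0 := @fd_indic_ge0 R n B.
have mAh : col_measurable (fun y => iA (h - y)).
  have := col_measurable_affine (- 1%:M) h mA.
  by under eq_fun do rewrite mulNmx mul1mx addrC.
(* Integrate 1 <= iA y + iA (h - y); by [fd_integral_reflect] both terms have the same integral. *)
have half : (V%:E <= col_integral (fun y => fd y * iA y) + col_integral (fun y => fd y * iA y))%E.
  rewrite -{2}(fd_integral_reflect Bunit h mA A0 Aper) -ge0_integralD//; last 4 first.
  - by move=> v _; rewrite mule_ge0.
  - exact: emeasurable_funM.
  - by move=> v _; rewrite mule_ge0.
  - exact: emeasurable_funM.
  rewrite -fdV -[leRHS]/(col_integral (fun y => fd y * iA y + fd y * iA (h - y)%R)%E).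
  apply: le_col_integral => //.
    by apply: emeasurable_funD; exact: emeasurable_funM.
  move=> y; rewrite -ge0_muleDr// -[leLHS]mule1 lee_wpmul2l//.
  rewrite /iA !indicE -EFinD lee_fin.
  by have [yA|yA] := far_set_reflect y r0 hfar; rewrite (mem_set yA) ?lerDl ?lerDr.
pose dev y : \bar R := (`|detB * heat t y - 1|)%:E.
have mheat := heat_measurable Bunit t0.
have mdev : col_measurable dev.
  apply/measurable_EFinP; apply: measurableT_comp => //.
  by apply: measurable_funB => //; exact: measurable_funM.
have dev0 y : (0 <= dev y)%E by rewrite lee_fin.
(* Markov majorant: on the far set the weight |M y|^2 / r^2 is at least 1 at every lattice
   translate, so the periodisation of [G] dominates detB f_t there. *)
pose G y : \bar R := (detB / r ^+ 2 * (gauss_col t y * norm2 (M *m y + 0) ^+ 2))%:E.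
have G0 y : (0 <= G y)%E.
  by rewrite lee_fin mulr_ge0 ?divr_ge0 ?exprn_ge0 ?(ltW d0) ?(ltW r0)// mulr_ge0 ?gauss_col_ge0 ?sqr_ge0.
have mG' : col_measurable (fun y => (gauss_col t y * norm2 (M *m y + 0) ^+ 2)%:E).
  apply/measurable_EFinP; apply: measurable_funM; first exact: measurable_gauss_col.
  exact: measurable_dotp_tuple.
have mG : col_measurable G.
  by apply/measurable_EFinP; apply: measurable_funM => //; exact/measurable_EFinP.
have GS0 y : (0 <= \esum_(z in setT) G (y + B *m ivec R z)%R)%E by exact: esum_ge0.
have mGS : col_measurable (fun y => \esum_(z in setT) G (y + B *m ivec R z)%R)%E.
  apply: measurable_esum => // z.
  have := col_measurable_affine 1%:M (B *m ivec R z) mG.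
  by under eq_fun do rewrite mul1mx.
have ptw y : (iA y <= dev y + \esum_(z in setT) G (y + B *m ivec R z)%R)%E.
  have [yA|yA] := pselect (far_set M r y); last first.
    by rewrite /iA indicE memNset// adde_ge0.
  rewrite /iA indicE mem_set//; apply: (@le_trans _ _ (dev y + (detB * heat t y)%:E)%E).
    by rewrite -EFinD lee_fin [leLHS](_ : _ = 1)//; have := ler_norm (- (detB * heat t y - 1)); rewrite normrN; lra.
  rewrite leeD2l// heat_esumZ ?(ltW d0)//; apply: le_esum => z _.
  rewrite lee_fin addr0 (_ : detB / r ^+ 2 * _ =
    detB * gauss_col t (y + B *m ivec R z) * (norm2 (M *m (y + B *m ivec R z)) ^+ 2 / r ^+ 2)); last first.
    by field; rewrite gt_eqF.
  rewrite ler_peMr ?mulr_ge0 ?gauss_col_ge0 ?(ltW d0)// ler_pdivlMr ?exprn_gt0// mul1r.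
  by rewrite ler_pXn2r ?nnegrE ?norm2_ge0 ?(ltW r0).
have fdA : (col_integral (fun y => fd y * iA y) <=
    torus_integral B (fun x => `|detB * heat t x - 1|%R) +
    (detB / r ^+ 2 * (2 * t * \tr (M^T *m M)))%:E)%E.
  apply: (@le_trans _ _ (col_integral (fun y => fd y * dev y) + col_integral G)%E).
    rewrite [X in (_ + X)%E](col_integral_unfold Bunit mG G0) -ge0_integralD//; last 4 first.
    - by move=> v _; rewrite mule_ge0.
    - exact: emeasurable_funM.
    - by move=> v _; rewrite mule_ge0.
    - exact: emeasurable_funM.
      rewrite -[leRHS]/(col_integral (fun y =>
      fd y * dev y + fd y * (\esum_(z in setT) G (y + B *m ivec R z)%R))%E).
    apply: le_col_integral.
    - exact: emeasurable_funM.
    - by apply: emeasurable_funD; exact: emeasurable_funM.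
    - by move=> y; rewrite mule_ge0.
    by move=> y; rewrite -ge0_muleDr// lee_wpmul2l.
  rewrite torus_integralE leeD2l//.
  have -> : col_integral G = ((detB / r ^+ 2)%:E *
      col_integral (fun y => (gauss_col t y * norm2 (M *m y + 0) ^+ 2)%:E))%E.
    rewrite -col_integralZl//.
    - by rewrite lee_fin divr_ge0 ?exprn_ge0 ?(ltW d0) ?(ltW r0).
    - by move=> y; rewrite lee_fin mulr_ge0 ?gauss_col_ge0 ?sqr_ge0.
  rewrite [leRHS]EFinM lee_wpmul2l ?lee_fin ?divr_ge0 ?exprn_ge0 ?(ltW d0) ?(ltW r0)//.
  apply: le_trans (gauss_col_moment t0 M 0) _.
  by rewrite lee_fin norm2_sqr /dotp big1 ?addr0// => i _; rewrite mxE mul0r.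
have TI0 : (0 <= torus_integral B (fun x => `|detB * heat t x - 1|%R))%E.
  by apply: integral_ge0 => v _; rewrite lee_fin.
move: L1 fdA TI0; case: (torus_integral B _) => [T||//]; last first.
  by rewrite gt0_muley ?lte_fin ?invr_gt0.
rewrite -EFinM lte_fin ltr_pdivrMl// => TL fdA _.
have : (V%:E <= (T + detB / r ^+ 2 * (2 * t * \tr (M^T *m M)))%:E +
   (T + detB / r ^+ 2 * (2 * t * \tr (M^T *m M)))%:E)%E.
  by apply: le_trans half _; exact: leeD.
rewrite -EFinD lee_fin => Vle.
have tr0 := mxtrace_gram_ge0 M.
have ttr0 : 0 <= t * \tr (M^T *m M) by rewrite mulr_ge0// ltW.
(* With K the Gaussian term, V <= 2 (T + K), T < detB / 4 and V >= (8/9) detB give K >= (4/9 - 1/4)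
   detB = (7/36) detB; then 2 * 36 / 7 <= 11. *)
have : detB * (7 / 36) <= detB * (2 * (t * \tr (M^T *m M)) / r ^+ 2).
  have e1 : detB / r ^+ 2 * (2 * t * \tr (M^T *m M)) =
      detB * (2 * (t * \tr (M^T *m M)) / r ^+ 2) by field; rewrite gt_eqF.
  by move: Vle; rewrite e1; lra.
by rewrite ler_pM2l// ler_pdivlMr ?exprn_gt0//; lra.
Qed.

Lemma covering_radius_mixing (V t : R) (M : 'M[R]_n) : M \in unitmx ->
  col_integral fd = V%:E -> detB <= (1 + 1 / 8) * V -> 0 < t ->
  ((detB^-1)%:E * torus_integral B (fun x => `|detB * heat t x - 1|%R) < (1 / 4)%:E)%E ->
  (covering_radius [set M *m u | u in lattice B] <=
   (Num.sqrt (44 * t * \tr (M^T *m M)))%:E)%E.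
Proof.
move=> Mu fdV detV t0 L1; rewrite leNgt; apply/negP => crgt.
set s := Num.sqrt _ in crgt.
have s0 : 0 <= s by exact: sqrtr_ge0.
(* An intermediate radius: the covering radius is an infimum, not excluded here from being infinite,
   and an uncovered point is available only at a strictly smaller radius. Applying [far_set_mixing]
   at rho / 2 turns 11 into 44. *)
have [rho srho rhocr] : exists2 rho, s < rho &
    (rho%:E < covering_radius [set M *m u | u in lattice B])%E.
  move: crgt; case: (covering_radius _) => [c||//].
    by rewrite lte_fin => sc; exists ((s + c) / 2); rewrite ?lte_fin; lra.
  by move=> _; exists (s + 1); [lra|exact: ltry].
have rho0 : 0 < rho by exact: le_lt_trans srho.
have [x xfar] := uncovered_point rho0 rhocr.
have r0 : 0 < rho / 2 by lra.
have := @far_set_mixing V t (rho / 2) M (invmx M *m x) fdV detV t0 L1 r0.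
apply/not_implyP; split.
  move=> z; rewrite mulrC divfK// mulmxDr mulKVmx//.
  have -> : x + M *m (B *m ivec R z) = x - M *m (B *m ivec R (- z)).
    by rewrite /ivec map_mxN !mulmxN opprK.
  apply: xfar; exists (B *m ivec R (- z)) => //; by exists (- z).
apply/negP; rewrite -ltNge.
have : s ^+ 2 < rho ^+ 2 by rewrite ltr_pXn2r ?nnegrE ?(ltW rho0).
rewrite sqr_sqrtr; last by rewrite mulr_ge0 ?mxtrace_gram_ge0// mulr_ge0// ltW.
by rewrite expr_div_n; lra.
Qed.

(** The centre of a basis cell has coordinate [i0] at distance at least 1/2 from every integer,
    while that coordinate of a vector in the unit ball is at most [K] in absolute value. The
    identity matrix is kept in the statement to match [covering_radius_mixing]. *)
Lemma covering_radius_gt0 : (0 < n)%N ->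
  exists2 rho : R, 0 < rho & (rho%:E <= covering_radius [set 1%:M *m u | u in lattice B])%E.
Proof.
move=> n0; pose i0 := Ordinal n0.
pose K : R := \sum_j `|invmx B i0 j|.
have K0 : 0 <= K by apply: sumr_ge0 => j _.
(* [K + 1] keeps the denominator positive whatever the value of [K]. *)
exists ((2 * (K + 1))^-1); first by rewrite invr_gt0 mulr_gt0//; lra.
apply: le_ereal_inf_tmp => _ [r [r0 cover] <-]; rewrite lee_fin.
have [_ [_ [z _ <-] <-] [v v1]] : [set u + r *: v | u in [set 1%:M *m u | u in lattice B] &
    v in [set v | norm2 v <= 1]] (B *m const_mx (1 / 2)) by rewrite cover.
rewrite mul1mx => /(congr1 (mulmx (invmx B))).
rewrite mulmxDr -scalemxAr !mulKmx// => /matrixP/(_ i0 0).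
rewrite mxE [X in X + _]mxE [X in _ + X]mxE [RHS]mxE => E.
have vj j : `|v j 0| <= 1.
  rewrite -(@ler_pXn2r _ 2) ?nnegrE// real_normK ?num_real// expr1n.
  apply: (@le_trans _ _ (norm2 v ^+ 2)); last by rewrite expr_le1// norm2_ge0.
  rewrite norm2_sqr /dotp (bigD1 j)//= -expr2 lerDl sumr_ge0// => k _.
  by rewrite -expr2 sqr_ge0.
have wK : `|(invmx B *m v) i0 0| <= K.
  rewrite mxE; apply: le_trans (ler_norm_sum _ _ _) _; apply: ler_sum => j _.
  by rewrite normrM ler_piMr.
have half : 1 / 2 <= `|1 / 2 - (z i0 0)%:~R| :> R.
  have [zle|zge] : (z i0 0 <= 0) \/ (1 <= z i0 0) by lia.
    have : (z i0 0)%:~R <= 0 :> R by rewrite lerz0.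
    by move=> ?; rewrite ger0_norm; lra.
  have : 1 <= (z i0 0)%:~R :> R by rewrite ler1z.
  by move=> ?; rewrite ler0_norm; lra.
have rK : 1 / 2 <= r * K.
  apply: le_trans half _; rewrite -E addrAC subrr add0r normrM ger0_norm//.
  exact: ler_wpM2l.
rewrite -[leLHS]mul1r ler_pdivrMr; last by rewrite mulr_gt0//; lra.
have : r * K <= r * (K + 1) by rewrite ler_wpM2l//; lra.
lra.
Qed.

End covering_radius_bounds.

(** * Comparison of the two mixing times *)

Section mixing_times.
Variables (R : realType) (n : nat) (B : 'M[R]_n).
Hypothesis n0 : (0 < n)%N.
Hypothesis Bunit : B \in unitmx.
Local Notation heat := (torus_heat (lattice B)).
Local Notation detB := (lattice_det B).
Local Notation fd := (fd_indic B).
Local Notation eta := (smoothing_parameter (lattice B)).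

Definition L1_mixed (t : R) : Prop := 0 < t /\
  ((detB^-1)%:E * torus_integral B (fun x => `|detB * heat t x - 1|%R) < (1 / 4)%:E)%E.

Lemma eta2_gt0 : 0 < 3 * eta ^+ 2.
Proof. by have [eta0 _] := smoothing_parameterP n0 Bunit; rewrite mulr_gt0// exprn_gt0. Qed.

Lemma heat_near_uniform y : `|detB * heat (3 * eta ^+ 2) y - 1| <= 1 / 8.
Proof.
have [D hD] := has_sum_dual_theta Bunit eta2_gt0.
apply: le_trans (heat_deviation Bunit y eta2_gt0 hD) _.
exact: dual_theta_smoothing hD.
Qed.

Lemma fd_volume : exists V : R,
  [/\ col_integral fd = V%:E, (1 - 1 / 8) * V <= detB & detB <= (1 + 1 / 8) * V].
Proof.
by apply: (fd_volume_bounds Bunit eta2_gt0) => [|y]; [lra|exact: heat_near_uniform].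
Qed.

Lemma mixing_time_Linfty_le : (mixing_time_Linfty B <= (3 * eta ^+ 2)%:E)%E.
Proof.
apply: ereal_inf_lbound; exists (3 * eta ^+ 2) => //; split; first exact: eta2_gt0.
by move=> x; apply: le_lt_trans (heat_near_uniform x) _; lra.
Qed.

Lemma mixing_time_Linfty_ge0 : (0 <= mixing_time_Linfty B)%E.
Proof. by apply: le_ereal_inf_tmp => _ [t [t0 _] <-]; rewrite lee_fin ltW. Qed.

(** Shows that the L_1 mixing time is finite: integrating the deviation gives at most V / 8 <= detB
    / 7 < detB / 4. *)
Lemma L1_mixed_eta : L1_mixed (3 * eta ^+ 2).
Proof.
split; first exact: eta2_gt0.
have [V [fdV V1 V2]] := fd_volume; have d0 := lattice_det_gt0 Bunit.
rewrite torus_integralE.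
have mfd := fd_indic_measurable Bunit.
have le8 : (col_integral (fun y => fd y * (`|detB * heat (3 * eta ^+ 2) y - 1|)%:E) <=
    (1 / 8)%:E * V%:E)%E.
  rewrite -fdV -col_integralZl//; last by move=> y; exact: fd_indic_ge0.
  apply: le_col_integral.
  - apply: emeasurable_funM => //; apply/measurable_EFinP; apply: measurableT_comp => //.
    apply: measurable_funB => //; apply: measurable_funM => //.
    exact: (heat_measurable Bunit eta2_gt0).
  - exact: measurable_funeM.
  - by move=> y; rewrite mule_ge0 ?fd_indic_ge0.
  by move=> y; rewrite muleC lee_wpmul2r ?fd_indic_ge0// lee_fin heat_near_uniform.
apply: le_lt_trans (lee_wpmul2l _ le8) _; first by rewrite lee_fin invr_ge0 ltW.
by rewrite -!EFinM lte_fin ltr_pdivrMl//; lra.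
Qed.

Lemma eta_mu_le t : L1_mixed t -> (eta_mu (lattice B) <= (Num.sqrt (44 * t))%:E)%E.
Proof.
move=> [t0 L1]; apply: ge_ereal_sup => _ [M Mu <-].
have [V [fdV _ V2]] := fd_volume.
have h := covering_radius_mixing Bunit Mu fdV V2 t0 L1.
apply: le_trans (lee_wpmul2r _ h) _; first by rewrite lee_fin invr_ge0 sqrtr_ge0.
rewrite -EFinM lee_fin sqrtrM; last by rewrite mulr_ge0// ltW.
rewrite -mulrA ler_piMr ?sqrtr_ge0//.
have [->|s0] := eqVneq (Num.sqrt (\tr (M^T *m M))) 0; first by rewrite mul0r.
by rewrite divff.
Qed.

(** [covering_radius_mixing] for the identity matrix, of trace [n]. It makes the L_1 mixing time
    positive, so that a product with an infinite constant is infinite. *)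
Lemma L1_mixed_lower_bound : exists2 b : R, 0 < b & forall t, L1_mixed t -> b <= t.
Proof.
have [rho rho0 hrho] := covering_radius_gt0 Bunit n0.
have nR : 0 < n%:R :> R by rewrite ltr0n.
exists (rho ^+ 2 / (44 * n%:R)); first by rewrite divr_gt0 ?exprn_gt0// mulr_gt0.
move=> t [t0 L1]; have [V [fdV _ V2]] := fd_volume.
have := le_trans hrho (covering_radius_mixing Bunit (unitmx1 _ _) fdV V2 t0 L1).
rewrite trmx1 mulmx1 mxtrace1 lee_fin => h.
rewrite ler_pdivrMr ?mulr_gt0// mulrCA mulrA.
rewrite -[leRHS]sqr_sqrtr; last by rewrite mulr_ge0// mulr_ge0// ltW.
by rewrite ler_pXn2r ?nnegrE ?sqrtr_ge0// ltW.
Qed.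

Lemma mixing_time_Linfty_bound (C t : R) : 0 < C ->
  (eta%:E <= C%:E * eta_mu (lattice B))%E -> L1_mixed t ->
  (mixing_time_Linfty B <= (132 * C ^+ 2 * t)%:E)%E.
Proof.
move=> C0 hC L1; apply: le_trans mixing_time_Linfty_le _; rewrite lee_fin.
have [t0 _] := L1; have [eta0 _] := smoothing_parameterP n0 Bunit.
have : (eta%:E <= C%:E * (Num.sqrt (44 * t))%:E)%E.
  by apply: le_trans hC _; rewrite lee_wpmul2l ?eta_mu_le// lee_fin ltW.
rewrite -EFinM lee_fin => le1.
have : eta ^+ 2 <= (C * Num.sqrt (44 * t)) ^+ 2.
  by rewrite ler_pXn2r ?nnegrE ?mulr_ge0 ?sqrtr_ge0// ltW.
rewrite exprMn sqr_sqrtr; last by rewrite mulr_ge0// ltW.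
lra.
Qed.

End mixing_times.

(** The bound holds for each admissible constant and each mixed time separately. It remains to pass
    to both infima, first in the time and then in the constant. *)
Theorem theorem7p1 (R : realType) :
  exists c : R, 0 < c /\
    forall (n : nat) (B : 'M[R]_n), (1 <= n)%N -> B \in unitmx ->
      (mixing_time_Linfty B <= c%:E * C_eta_mu R n ^+ 2 * mixing_time_L1 B)%E.
Proof.
exists 132; split => // n B n0 Bunit.
have [b b0 hb] := L1_mixed_lower_bound n0 Bunit.
have L1E : mixing_time_L1 B = ereal_inf [set t%:E | t in L1_mixed B] by [].
have tau1_le := ereal_inf_lbound (ex_intro2 _ _ _ (L1_mixed_eta n0 Bunit) erefl :
  [set t%:E | t in L1_mixed B] (3 * smoothing_parameter (lattice B) ^+ 2)%:E).
have tau1_ge : (b%:E <= mixing_time_L1 B)%E.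
  by apply: le_ereal_inf_tmp => _ [t /hb bt <-]; rewrite lee_fin.
have := mixing_time_Linfty_le n0 Bunit; have := mixing_time_Linfty_ge0 B.
have := @mixing_time_Linfty_bound R n B n0 Bunit.
case: (mixing_time_Linfty B) => [a||//] bound; rewrite ?lee_fin// => a0 _.
have [tau1 tau1E] : exists tau1 : R, mixing_time_L1 B = tau1%:E.
  move: tau1_ge tau1_le; rewrite -L1E; case: (mixing_time_L1 B) => // r.
  by exists r.
rewrite tau1E in tau1_ge *; have tau10 : 0 < tau1 by apply: lt_le_trans b0 _; rewrite -lee_fin.
have bound2 C : 0 < C -> (forall B' : 'M[R]_n, B' \in unitmx ->
    ((smoothing_parameter (lattice B'))%:E <= C%:E * eta_mu (lattice B'))%E) ->
    a <= 132 * C ^+ 2 * tau1.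
  move=> C0 hC; have k0 : 0 < 132 * C ^+ 2 by rewrite mulr_gt0// exprn_gt0.
  rewrite mulrC -ler_pdivrMr// -lee_fin -tau1E L1E.
  apply: le_ereal_inf_tmp => _ [t Lt <-]; rewrite lee_fin ler_pdivrMr// mulrC -lee_fin.
  exact: bound C0 (hC B Bunit) Lt.
(* The constant for which the bound would be an equality; it is a lower bound for every admissible
   constant, hence for their infimum, and avoids taking an infimum of squares. *)
pose q := Num.sqrt (a / (132 * tau1)).
have k0 : 0 < 132 * tau1 by rewrite mulr_gt0.
have q2 : q ^+ 2 * (132 * tau1) = a by rewrite sqr_sqrtr ?divr_ge0 ?(ltW k0)// divfK// gt_eqF.
have q0 : 0 <= q by exact: sqrtr_ge0.
have : (q%:E <= C_eta_mu R n)%E.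
  apply: le_ereal_inf_tmp => _ [C [C0 hC] <-]; rewrite lee_fin.
  rewrite -(@ler_pXn2r _ 2) ?nnegrE ?(ltW C0)// -(ler_pM2r k0) q2.
  by have := bound2 C C0 hC; lra.
case: (C_eta_mu R n) => [C||//].
  rewrite lee_fin => qC; rewrite -EFin_expe -!EFinM lee_fin.
  have : q ^+ 2 * (132 * tau1) <= C ^+ 2 * (132 * tau1).
    by rewrite ler_pM2r// ler_pXn2r ?nnegrE// (le_trans q0).
  by rewrite q2; lra.
(* Infinite constant: the right side is infinite because [tau1] is positive. *)
by move=> _; rewrite expe2 mulyy gt0_muley ?lte_fin// gt0_mulye ?lte_fin// leey.
Qed.
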